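(* Suppose Assumptions (A1) and (A2) below hold and $q_\tau$ satisfies the model assumptions below. Run the mini-batch P-FGD algorithm below with batch sizes $n_t\ge1$, cumulative sample sizes $N_t=\sum_{i=1}^t n_i$ satisfying $n_t/N_t\to0$, step sizes $\gamma_t = A\,n_t/N_t$, and truncation dimensions $J_t=\lceil N_t^{1/(2s+1)}\rceil$. Then for a sufficiently large constant $A>0$ (depending only on the constants in the assumptions), $$\mathbb{E}\,\|\widehat q_t - q_\tau\|_{L_2}^2 = O\big(N_t^{-\frac{2s}{2s+1}}\big)\quad\text{as } t\to\infty.$$
   Context: Data: at each time $t=1,2,\dots$ a batch $\{(\mathbf{X}_{t,i},Y_{t,i})\}_{i=1}^{n_t}$ arrives; all observations across all batches are i.i.d. copies of a random pair $(\mathbf{X},Y)\in[0,1]^p\times\mathbb{R}$. Fix $\tau\in(0,1)$ and let $q_\tau(\mathbf{x}) = \inf\{v\in\mathbb{R}: F_{Y|\mathbf{X}=\mathbf{x}}(v)\ge\tau\}$ be the conditional $\tau$-quantile. Bases: for each $k=1,\dots,p$, $\{\psi_{kj}\}_{j\ge1}$ is an orthonormal basis (w.r.t. Lebesgue measure) of functions in $L_2[0,1]$ that is centered ($\int_0^1\psi_{kj}=0$), with $\sup_{k,j}\|\psi_{kj}\|_\infty\le M$ for some $M\ge1$. Write $\mathbf{x}=(x^{(1)},\dots,x^{(p)})$. Model: $q_\tau(\mathbf{x}) = \alpha^*+\sum_{k=1}^p f_k(x^{(k)})$ with $f_k=\sum_{j\ge1}\theta^*_{kj}\psi_{kj}$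 and $\sum_{j\ge1}j^{2s}(\theta^*_{kj})^2<Q^2$ for each $k$, where $s>1/2$, $Q>0$ are known. Let $R>0$ satisfy $\|\boldsymbol\theta^*\|_1:=|\alpha^*|+\sum_{k,j}|\theta^*_{kj}|\le R$, and set $B:=MR$. Assumption (A1): $\mathbf{X}$ has a density $p_X$ with $0<C_1\le p_X(\mathbf{x})\le C_2<\infty$ on $[0,1]^p$. Assumption (A2): $Y$ given $\mathbf{X}=\mathbf{x}$ has a density $p_{Y|\mathbf{X}}(y|\mathbf{x})$ with $c_1\le p_{Y|\mathbf{X}}(y|\mathbf{x})\le c_2$ for all $\mathbf{x}\in[0,1]^p$, $y\in[-B,B]$, with $c_1,c_2>0$. Mini-batch P-FGD: $\boldsymbol\Psi_t(\mathbf{x}) = (1,\psi_{11}(x^{(1)}),\dots,\psi_{1J_t}(x^{(1)}),\dots,\psi_{pJ_t}(x^{(p)}))^\top\in\mathbb{R}^{1+pJ_t}$. Set $\boldsymbol\theta_0=\mathbf{0}$. At time $t$: pad $\boldsymbol\theta_{t-1}$ with zeros to dimension $1+pJ_t$; let $\widehat q_{t-1}(\mathbf{x})=\boldsymbol\theta_{t-1}^\top\boldsymbol\Psi_t(\mathbf{x})$; compute $G_t=\frac1{n_t}\sum_{i=1}^{n_t}(\tau-\mathbb{I}(Y_{t,i}\le\widehat q_{t-1}(\mathbf{X}_{t,i})))\boldsymbol\Psi_t(\mathbf{X}_{t,i})$; set $\tilde{\boldsymbol\theta}_t=\boldsymbol\theta_{t-1}+\gamma_tG_t$ and $\boldsymbol\theta_t=\Pi_{\mathcal{B}(R)}(\tilde{\boldsymbol\theta}_t)$,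 the Euclidean projection onto $\{\boldsymbol\theta:\|\boldsymbol\theta\|_1\le R\}$. The estimator is $\widehat q_t(\mathbf{x})=\boldsymbol\theta_t^\top\boldsymbol\Psi_t(\mathbf{x})$. $\|\cdot\|_{L_2}$ is the $L_2$ norm w.r.t. Lebesgue measure on $[0,1]^p$. *)

(* Defs.v *)
From mathcomp Require Import all_boot all_order all_algebra.
From mathcomp Require Import all_classical all_reals all_analysis.
Import Order.TTheory GRing.Theory Num.Theory.
Import numFieldNormedType.Exports.

Set Implicit Arguments.
Unset Strict Implicit.
Unset Printing Implicit Defensive.

Local Open Scope classical_set_scope.
Local Open Scope ring_scope.

Section PFGD.
Variable R : realType.

Notation leb := (@lebesgue_measure R).

(* Iterated one-dimensional Lebesgue integrals over [0,1] (by Tonelli this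
   is the integral w.r.t. Lebesgue measure on [0,1]^m for nonnegative
   measurable integrands). Points are functions nat -> R, coordinate j
   being integrated at stage j. *)
Fixpoint iter_cube_int (m : nat) (f : (nat -> R) -> \bar R) : \bar R :=
  match m with
  | 0 => f (fun _ => 0)
  | m'.+1 => (\int[leb]_(u in `[(0%R:R), (1%R:R)]) iter_cube_int m'
                 (fun x => f (fun j => if j == m' then u else x j)))%E
  end.

Definition cube_int (p : nat) (F : ('I_p -> R) -> \bar R) : \bar R :=
  iter_cube_int p (fun x => F (fun k : 'I_p => x (nat_of_ord k))).

Definition in_cube (p : nat) (x : 'I_p -> R) : Prop :=
  forall k, 0 <= x k <= 1.

Definition cond_cdf (p : nat) (pYX : ('I_p -> R) -> R -> R) (x : 'I_p -> R)
  (v : R) : \bar R :=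
  (\int[leb]_(y in `]-oo, v]) (pYX x y)%:E)%E.

Definition cond_quantile (p : nat) (pYX : ('I_p -> R) -> R -> R) (tau : R)
  (x : 'I_p -> R) : R :=
  inf [set v : R | (tau%:E <= cond_cdf pYX x v)%E].

(* psi k j is the paper's psi_{k,j+1} (indices j start at 0 here).       *)
Definition centered_onb_bounded (p : nat) (psi : 'I_p -> nat -> R -> R)
  (M : R) : Prop :=
  forall k : 'I_p,
  [/\ (forall j : nat, measurable_fun `[(0%R:R), (1%R:R)] (psi k j)),
      (forall j, (\int[leb]_(x in `[(0%R:R), (1%R:R)]) (psi k j x)%:E = 0)%E),
      (forall j l, (\int[leb]_(x in `[(0%R:R), (1%R:R)]) (psi k j x * psi k l x)%:E
                    = (j == l)%:R%:E)%E),
      (* basis of the centered subspace of L2[0,1] (maximality /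
         completeness: a centered L2 function orthogonal to every psi k j
         vanishes a.e.) *)
      (forall f : R -> R, measurable_fun `[(0%R:R), (1%R:R)] f ->
         (\int[leb]_(x in `[(0%R:R), (1%R:R)]) (f x ^+ 2)%:E < +oo)%E ->
         (\int[leb]_(x in `[(0%R:R), (1%R:R)]) (f x)%:E = 0)%E ->
         (forall j, (\int[leb]_(x in `[(0%R:R), (1%R:R)]) (f x * psi k j x)%:E = 0)%E) ->
         {ae leb, forall x, [set` `[(0%R:R), (1%R:R)]] x -> f x = 0})
    &
      (forall j x, 0 <= x <= 1 -> `|psi k j x| <= M)].

(* a coefficient vector: intercept and (k, j) coefficients; the vector
   theta in R^{1 + p J} is represented by a coefficient family supported on
   j < J (zero padding is automatic). *)
Definition coef (p : nat) := (R * ('I_p -> nat -> R))%type.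

Definition supported (p J : nat) (c : coef p) : Prop :=
  forall k j, (J <= j)%N -> c.2 k j = 0.

Definition l1norm (p J : nat) (c : coef p) : R :=
  `|c.1| + \sum_(k < p) \sum_(j < J) `|c.2 k j|.

Definition sqdist (p J : nat) (c c' : coef p) : R :=
  (c.1 - c'.1) ^+ 2 + \sum_(k < p) \sum_(j < J) (c.2 k j - c'.2 k j) ^+ 2.

Definition is_l1ball_proj (p J : nat) (Rad : R) (v w : coef p) : Prop :=
  [/\ supported J w, l1norm J w <= Rad &
      forall u, supported J u -> l1norm J u <= Rad -> sqdist J v w <= sqdist J v u].

Definition qhat (p : nat) (psi : 'I_p -> nat -> R -> R) (J : nat) (c : coef p)
  (x : 'I_p -> R) : R :=
  c.1 + \sum_(k < p) \sum_(j < J) c.2 k j * psi k j (x k).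

Definition cumsize (n : nat -> nat) (t : nat) : nat := \sum_(1 <= i < t.+1) n i.

Definition trunc_dim (s : R) (Nt : nat) : nat :=
  `|Num.ceil ((Nt%:R : R) `^ (1 / (2 * s + 1)))|%N.

Definition pfgd_tilde (p : nat) (psi : 'I_p -> nat -> R -> R) (tau : R)
  (J nt : nat) (gam : R) (X : nat -> 'I_p -> R) (Y : nat -> R)
  (th : coef p) : coef p :=
  let r i := tau - (Y i <= qhat psi J th (X i))%R%:R in
  (th.1 + gam * ((nt%:R)^-1 * \sum_(i < nt) r i),
   fun k j => th.2 k j +
     gam * (if (j < J)%N then (nt%:R)^-1 * \sum_(i < nt) r i * psi k j (X i k)
            else 0)).

Definition pfgd_run (p : nat) (psi : 'I_p -> nat -> R -> R) (tau Rad A : R)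
  (s : R) (n : nat -> nat) (X : nat -> nat -> 'I_p -> R) (Y : nat -> nat -> R)
  (theta : nat -> coef p) : Prop :=
  theta 0 = (0, fun _ _ => 0) /\
  forall t, (0 < t)%N ->
    is_l1ball_proj (trunc_dim s (cumsize n t)) Rad
      (pfgd_tilde psi tau (trunc_dim s (cumsize n t)) (n t)
         (A * (n t)%:R / (cumsize n t)%:R) (X t) (Y t) (theta t.-1))
      (theta t).

Definition rect_event d (Omega : measurableType d) (p : nat)
  (X : 'I_p -> Omega -> R) (Y : Omega -> R) (A : 'I_p -> set R) (B : set R)
  : set Omega :=
  [set w | (forall k, A k (X k w)) /\ B (Y w)].

(* (X_{t,i}, Y_{t,i}), t >= 1, i < n_t, are i.i.d. copies of (X, Y), where X
   has density pX on [0,1]^p and Y | X = x has density pYX x. Distributions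
   and independence are stated on the generating pi-system of measurable
   rectangles. *)
Definition iid_sample d (Omega : measurableType d) (P : probability Omega R)
  (p : nat) (n : nat -> nat) (X : nat -> nat -> 'I_p -> Omega -> R)
  (Y : nat -> nat -> Omega -> R) (pX : ('I_p -> R) -> R)
  (pYX : ('I_p -> R) -> R -> R) : Prop :=
  let valid ti := (0 < ti.1)%N && (ti.2 < n ti.1)%N in
  [/\
      (forall t i k, measurable_fun setT (X t i k)),
      (forall t i, measurable_fun setT (Y t i)),
      (forall t i, valid (t, i) ->
        forall (A : 'I_p -> set R) (B : set R),
        (forall k, measurable (A k)) -> measurable B ->
        P (rect_event (X t i) (Y t i) A B) =
        cube_int (fun x => ((\prod_(k < p) \1_(A k) (x k)) * pX x)%:E *
                           \int[leb]_(y in B) (pYX x y)%:E)%E)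
    &
      (forall (S : seq (nat * nat)), uniq S -> all valid S ->
        forall (A : nat * nat -> 'I_p -> set R) (B : nat * nat -> set R),
        (forall ti k, measurable (A ti k)) -> (forall ti, measurable (B ti)) ->
        P (\bigcap_(ti in [set` S]) rect_event (X ti.1 ti.2) (Y ti.1 ti.2) (A ti) (B ti))
        = (\prod_(ti <- S) P (rect_event (X ti.1 ti.2) (Y ti.1 ti.2) (A ti) (B ti)))%E)].

End PFGD.

Definition series_sum (R : realType) (u : nat -> R) : R :=
  limn (series u : R^nat).

(* Main.v *)
Require Import Defs.
From HB Require Import structures.
From mathcomp Require Import all_boot all_order all_algebra.
From mathcomp Require Import all_classical all_reals all_analysis.
From mathcomp Require Import measurable_realfun ring lra.
Import Order.TTheory GRing.Theory Num.Theory.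
Import numFieldNormedType.Exports.
Local Open Scope classical_set_scope.
Local Open Scope ring_scope.

(** The squared error [E |qhat_t - q|^2] satisfies a one-step recursion.  The
    projection is non-expansive and [theta*] truncated to [J_t] coordinates stays
    in the ball, so expanding the square leaves a drift term and the squared
    norm of the batch gradient.  Conditionally on the past, the cdf of [Y] given
    [X = x] grows at a rate in [[c1, c2]] on [[-B, B]], so the drift is at most
    [- c1 C1 / 2 * error + c2 C2 / 2 * tail].  Independence inside the batch
    leaves [1 / n_t] of the diagonal terms, plus the squared mean gradient, which
    is at most [c2^2 C2^2 * error] by duality (Bessel).  With [gamma_t = A n_t / N_t]
    this gives [e_t <= (1 - c1 C1 A rho_t / 2) e_(t-1) + K rho_t N_t^(-b)], where
    [rho_t = n_t / N_t] and [b = 2 s / (2 s + 1)], and induction yields the rate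
    as soon as [A >= 6 / (c1 C1)].

    Neither density is assumed jointly measurable, so the law of [(X, Y)] is only
    accessible on rectangles, through iterated lower integrals that are merely
    monotone and homogeneous.  Expectations of additive functions of [X] are
    therefore computed on a finite partition of the cube into product cells on
    which these functions are constant up to [e]. *)

Set Implicit Arguments.
Unset Strict Implicit.
Unset Printing Implicit Defensive.

(** The squared mean gradient enters with [gamma_t ^ 2], so as [rho_t] tends to 0 it eventually
    costs at most half of the drift [c1 C1 A rho_t]; this is the factor 1/2 in the recursion. The
    diagonal terms carry [gamma_t ^ 2 / n_t = A ^ 2 rho_t / N_t] times a squared feature norm of
    order at most [J_t], and [J_t] is chosen so that [J_t / N_t] and the tail, of order
    [J_t ^ (- 2 s)], are both of order [N_t ^ (- b)]. The threshold for [A] makes [c1 C1 A / 2] at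
    least 3: passing from [N_(t-1)] to [N_t] costs a factor [1 + 2 rho_t], and one more [rho_t] pays
    for the noise.

    Two measurability obstacles shape the rest. The iterates are given outcome by outcome as
    minimisers; the Lipschitz property of the projection shows that they depend measurably on the
    samples seen so far, as Fubini requires. The basis is measurable on [[0, 1]] only, while samples
    may leave the cube on a null event, so the argument runs on a modified sample and is transferred
    back by monotonicity of the lower integral. *)

(** * Lower integrals and iterated integrals over the cube *)

Section lower_integral.
Import HBNNSimple.
Context d (T : measurableType d) (R : realType).
Variable mu : {measure set T -> \bar R}.
Local Open Scope ereal_scope.

(** The integral of a nonnegative function is a supremum over the simple functions below it, so
    monotonicity holds for arbitrary integrands. *)
Lemma le_lower_integral (D : set T) (f g : T -> \bar R) :
  (forall x, D x -> 0 <= f x) -> (forall x, D x -> f x <= g x) ->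
  \int[mu]_(x in D) f x <= \int[mu]_(x in D) g x.
Proof.
move=> f0 fg; have g0 x : D x -> 0 <= g x.
  by move=> Dx; apply: le_trans (fg _ Dx); exact: f0.
rewrite !ge0_integralE//; apply: le_ereal_sup => _ [h hf <-].
by exists h => // x; apply: le_trans (hf x) _; exact: lee_restrict.
Qed.

(** Dividing by [c] turns a simple function below [c * f] into one below [f]. The converse
    inequality is this one applied to [c^-1] and [c * f]. *)
Lemma lower_integralZl_le (D : set T) (f : T -> \bar R) (c : R) : (0 < c)%R ->
  (forall x, D x -> 0 <= f x) ->
  \int[mu]_(x in D) (c%:E * f x) <= c%:E * \int[mu]_(x in D) f x.
Proof.
move=> c0 f0; rewrite !ge0_integralE//; last first.
  by move=> x Dx; rewrite mule_ge0 ?f0// lee_fin ltW.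
apply: ge_ereal_sup => _ [h hf <-].
have ci0 : (0 <= c^-1)%R by rewrite invr_ge0 ltW.
have -> : sintegral mu h = c%:E * sintegral mu (scale_nnsfun h ci0).
  rewrite sintegralrM muleA -EFinM mulfV ?gt_eqF// mul1e //.
rewrite lee_pmul2l ?lte_fin//; apply: ereal_sup_ubound => /=.
exists (scale_nnsfun h ci0) => // x.
have := hf x; rewrite !patchE; case: ifP => [xD|_].
  move=> hcf; rewrite /= -(@lee_pmul2l _ c%:E) ?lte_fin// -EFinM mulVKf ?gt_eqF//.
by move=> /= hx; rewrite EFinM mule_ge0_le0// lee_fin.
Qed.

Lemma lower_integralZl (D : set T) (f : T -> \bar R) (c : R) : (0 <= c)%R ->
  (forall x, D x -> 0 <= f x) ->
  \int[mu]_(x in D) (c%:E * f x) = c%:E * \int[mu]_(x in D) f x.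
Proof.
rewrite le_eqVlt => /predU1P[<-|c0] f0.
  by rewrite mul0e (eq_integral (cst 0)) ?integral0// => x _; rewrite mul0e.
apply/eqP; rewrite eq_le lower_integralZl_le//=.
have ci0 : (0 < c^-1)%R by rewrite invr_gt0.
rewrite -(@lee_pmul2l _ c^-1%:E) ?lte_fin// muleA -EFinM mulVf ?gt_eqF// mul1e.
apply: le_trans (lower_integralZl_le ci0 _); last first.
  by move=> x Dx; rewrite mule_ge0 ?f0// lee_fin ltW.
apply: le_lower_integral => // x Dx.
by rewrite muleA -EFinM mulVf ?gt_eqF// mul1e.
Qed.

End lower_integral.

Section iterated.
Variable R : realType.
Notation leb := (@lebesgue_measure R).
Notation I01 := [set` `[0%R : R, 1%R]].
Local Open Scope ereal_scope.

Definition in_unit (x : nat -> R) : Prop := forall j, (0 <= x j <= 1)%R.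

Lemma in_unit_upd m u (x : nat -> R) : (0 <= u <= 1)%R -> in_unit x ->
  in_unit (fun j => if j == m then u else x j).
Proof. by move=> u01 x01 j; case: ifP. Qed.

Lemma in_unit0 : in_unit (fun=> 0%R).
Proof. by move=> j; rewrite lexx ler01. Qed.

Lemma iter_cube_int_ge0 m f : (forall x, in_unit x -> 0 <= f x) ->
  0 <= iter_cube_int m f :> \bar R.
Proof.
elim: m f => [|m ih] f f0 /=; first exact: f0 in_unit0.
apply: integral_ge0 => u /=; rewrite in_itv/= => u01; apply: ih => x x01.
by apply: f0; apply: in_unit_upd.
Qed.

Lemma le_iter_cube_int m f g :
  (forall x, in_unit x -> 0 <= f x) -> (forall x, in_unit x -> f x <= g x) ->
  iter_cube_int m f <= iter_cube_int m g :> \bar R.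
Proof.
elim: m f g => [|m ih] f g f0 fg /=; first exact: fg in_unit0.
apply: le_lower_integral => u /=; rewrite in_itv/= => u01.
  by apply: iter_cube_int_ge0 => x x01; apply: f0; apply: in_unit_upd.
by apply: ih => x x01; [apply: f0|apply: fg]; apply: in_unit_upd.
Qed.

Lemma eq_iter_cube_int m f g :
  (forall x, in_unit x -> f x = g x) ->
  iter_cube_int m f = iter_cube_int m g :> \bar R.
Proof.
elim: m f g => [|m ih] f g fg /=; first exact: fg in_unit0.
apply: eq_integral => u; rewrite inE/= in_itv/= => u01.
by apply: ih => x x01; apply: fg; apply: in_unit_upd.
Qed.

Lemma iter_cube_intZl m f (c : R) : (0 <= c)%R ->
  (forall x, in_unit x -> 0 <= f x) ->
  iter_cube_int m (fun x => c%:E * f x) = c%:E * iter_cube_int m f :> \bar R.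
Proof.
move=> c0; elim: m f => [|m ih] f f0 //=.
rewrite -lower_integralZl//; last first.
  move=> u /=; rewrite in_itv/= => u01; apply: iter_cube_int_ge0 => x x01.
  by apply: f0; apply: in_unit_upd.
apply: eq_integral => u; rewrite inE/= in_itv/= => u01.
by rewrite ih// => x x01; apply: f0; apply: in_unit_upd.
Qed.

Lemma leb_I01 : leb I01 = 1%:E.
Proof. by rewrite lebesgue_measure_itv/= lte_fin ltr01 sube0. Qed.

Definition len01 (A : set R) : R := fine (leb (A `&` I01)).

Lemma len01E A : measurable A -> leb (A `&` I01) = (len01 A)%:E.
Proof.
move=> mA; rewrite fineK// ge0_fin_numE//.
apply: (@le_lt_trans _ _ (leb I01)); last by rewrite leb_I01 ltry.
by apply: le_measure; rewrite ?inE//; exact: measurableI.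
Qed.

Lemma len01_ge0 A : (0 <= len01 A)%R.
Proof. exact/fine_ge0/measure_ge0. Qed.

Lemma integral_indic_I01 A : measurable A ->
  \int[leb]_(x in I01) (\1_A x)%:E = (len01 A)%:E.
Proof. by move=> mA; rewrite -len01E//; apply: integral_indic. Qed.

(** Step functions on boxes stay measurable at every stage, so for them the iterated integral is
    additive; every other integrand is sandwiched between such functions. The weights are
    generalised in the induction because fixing the outermost coordinate [u] turns [c i] into
    [c i * \1_(A i m) u]. *)
Lemma iter_cube_int_simple (I : finType) m (c : I -> R) (A : I -> nat -> set R) :
  (forall i k, measurable (A i k)) -> (forall i, (0 <= c i)%R) ->
  iter_cube_int m
    (fun x => (\sum_i c i * \prod_(k < m) \1_(A i k) (x k))%R%:E)
  = (\sum_i c i * \prod_(k < m) len01 (A i k))%R%:E.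
Proof.
move=> mA; elim: m c => [|m ih] c c0 /=.
  by congr EFin; apply: eq_bigr => i _; rewrite !big_ord0.
under eq_integral => u _.
  rewrite (_ : (fun x : nat -> R => _) = (fun x =>
    (\sum_i (c i * \1_(A i m) u) * \prod_(k < m) \1_(A i k) (x k))%R%:E)).
    rewrite ih; last by move=> i; rewrite mulr_ge0.
    rewrite -sumEFin.
    under eq_bigr do rewrite -mulrA (mulrC (\1_ _ _)) mulrA EFinM.
    over.
  apply/funext => x; congr EFin; apply: eq_bigr => i _.
  rewrite big_ord_recr/= eqxx -mulrA; congr (_ * _)%R; rewrite mulrC.
  congr (_ * _)%R; apply: eq_bigr => k _.
  by rewrite ltn_eqF.
rewrite ge0_integral_sum//; last 2 first.
- move=> i; apply: measurable_funeM; apply/measurable_EFinP.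
  have K := @measurable_indic _ _ R I01 _ (mA i m). exact: K.
- move=> i u _; rewrite -EFinM lee_fin mulr_ge0// mulr_ge0//.
  by apply: prodr_ge0 => k _; exact: len01_ge0.
rewrite -sumEFin; apply: eq_bigr => i _.
rewrite ge0_integralZl//; last 2 first.
- apply/measurable_EFinP; exact: (@measurable_indic _ _ R I01 _ (mA i m)).
- by rewrite lee_fin mulr_ge0//; apply: prodr_ge0 => k _; exact: len01_ge0.
transitivity ((c i * \prod_(k < m) len01 (A i k))%:E * (len01 (A i m))%:E).
  congr (_ * _). exact: (integral_indic_I01 (mA i m)).
by rewrite big_ord_recr/= mulrA EFinM.
Qed.

End iterated.

(** * Bounded measurable functions and their integrals *)

(** This class is closed under all the operations needed and integrable for finite measures, so one
    closure argument discharges both measurability and integrability of an integrand. *)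
Definition bmeas d (T : measurableType d) (R : realType) (D : set T)
  (f : T -> R) := measurable_fun D f /\ exists K, forall x, D x -> `|f x| <= K.

Section bounded_measurable.
Context d (T : measurableType d) (R : realType) (D : set T).
Implicit Types f g : T -> R.

Lemma bmeas_cst c : bmeas D (fun=> c : R).
Proof. by split; [exact: measurable_cst|exists `|c|]. Qed.

Lemma bmeasD f g : bmeas D f -> bmeas D g -> bmeas D (fun x => f x + g x).
Proof.
move=> [mf [K fK]] [mg [L gL]]; split; first exact: measurable_funD.
exists (K + L) => x Dx; apply: le_trans (ler_normD _ _) _.
by rewrite lerD ?fK ?gL.
Qed.

Lemma bmeasM f g : bmeas D f -> bmeas D g -> bmeas D (fun x => f x * g x).
Proof.
move=> [mf [K fK]] [mg [L gL]]; split; first exact: measurable_funM.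
by exists (K * L) => x Dx; rewrite normrM ler_pM ?fK ?gL.
Qed.

Lemma bmeasZ c f : bmeas D f -> bmeas D (fun x => c * f x).
Proof. by move=> ?; apply: bmeasM => //; exact: bmeas_cst. Qed.

Lemma bmeasN f : bmeas D f -> bmeas D (fun x => - f x).
Proof.
move=> bf; rewrite (_ : (fun x => _) = (fun x => -1 * f x)); first exact: bmeasZ.
by apply/funext => x; rewrite mulN1r.
Qed.

Lemma bmeasB f g : bmeas D f -> bmeas D g -> bmeas D (fun x => f x - g x).
Proof. by move=> bf bg; apply: bmeasD => //; exact: bmeasN. Qed.

Lemma bmeas_sqr f : bmeas D f -> bmeas D (fun x => f x ^+ 2).
Proof. by move=> bf; apply: bmeasM. Qed.

Lemma bmeas_sum (I : Type) (r : seq I) (Q : pred I) (f : I -> T -> R) :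
  (forall i, bmeas D (f i)) -> bmeas D (fun x => \sum_(i <- r | Q i) f i x).
Proof.
move=> bf; elim: r => [|i r ih].
  rewrite (_ : (fun x => _) = (fun=> 0)); first exact: bmeas_cst.
  by apply/funext => x; rewrite big_nil.
rewrite (_ : (fun x => _) = (fun x => (if Q i then f i x else 0) +
   \sum_(j <- r | Q j) f j x)).
  by apply: bmeasD => //; case: (Q i) => //; exact: bmeas_cst.
by apply/funext => x; rewrite big_cons; case: ifP => //; rewrite add0r.
Qed.

Lemma bmeas_max f g : bmeas D f -> bmeas D g ->
  bmeas D (fun x => Num.max (f x) (g x)).
Proof.
move=> [mf [K fK]] [mg [L gL]]; split; first exact: measurable_maxr.
exists (Num.max K L) => x Dx; rewrite /Num.max; case: ifP => _.
  by case: ifP => KL; [exact: gL|apply: le_trans (gL _ Dx) _; rewrite leNgt KL].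
by case: ifP => KL; [apply: le_trans (fK _ Dx) (ltW KL)|exact: fK].
Qed.

Lemma measurable_boolR (b : T -> bool) : measurable_fun D b ->
  measurable_fun D (fun x => (b x)%:R : R).
Proof.
move=> mb; have mn : measurable_fun setT (fun b : bool => b%:R : R) by [].
exact: (measurableT_comp mn mb).
Qed.

Lemma bmeas_bool (b : T -> bool) : measurable_fun D b ->
  bmeas D (fun x => (b x)%:R : R).
Proof.
move=> mb; split; first exact: measurable_boolR.
by exists 1 => x _; case: (b x); rewrite ?normr1 ?normr0.
Qed.

Lemma bmeas_indic A : measurable A -> bmeas D (\1_A : T -> R).
Proof.
move=> mA; split; first exact: measurable_indic.
by exists 1 => x _; rewrite indicE; case: (_ \in _); rewrite ?normr1 ?normr0.
Qed.

Lemma bmeas_eq f g : {in D, f =1 g} -> bmeas D f -> bmeas D g.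
Proof.
move=> fg [mf [K fK]]; split; first exact: eq_measurable_fun mf.
by exists K => x Dx; rewrite -fg ?inE// fK.
Qed.

Lemma bmeas_ub f : bmeas D f ->
  exists2 K, 0 < K & forall x, D x -> `|f x| <= K.
Proof.
move=> [_ [K fK]]; exists (`|K| + 1); first by rewrite ltr_wpDl.
by move=> x Dx; apply: le_trans (fK _ Dx) _; rewrite ler_wpDr// ler_norm.
Qed.

End bounded_measurable.

Section bounded_integral.
Context d (T : measurableType d) (R : realType) (mu : {measure set T -> \bar R}).
Variable D : set T.
Hypothesis mD : measurable D.
Hypothesis fD : (mu D < +oo)%E.
Implicit Types f g : T -> R.

Lemma bmeas_integrable f : bmeas D f -> mu.-integrable D (EFin \o f).
Proof.
move=> bf; have [K K0 fK] := bmeas_ub bf; case: bf => mf _.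
apply: measurable_bounded_integrable => //.
by exists K; split; [exact: gtr0_real|move=> M KM x Dx; apply: le_trans (fK _ Dx) (ltW KM)].
Qed.

Lemma bintD f g : bmeas D f -> bmeas D g ->
  \int[mu]_(x in D) (f x + g x) = \int[mu]_(x in D) f x + \int[mu]_(x in D) g x.
Proof. by move=> bf bg; apply: RintegralD => //; exact: bmeas_integrable. Qed.

Lemma bintZ c f : bmeas D f ->
  \int[mu]_(x in D) (c * f x) = c * \int[mu]_(x in D) f x.
Proof. by move=> bf; apply: RintegralZl => //; exact: bmeas_integrable. Qed.

Lemma bint_cst c : \int[mu]_(x in D) c = c * fine (mu D).
Proof. exact: Rintegral_cst. Qed.

Lemma bint_sum (I : Type) (r : seq I) (Q : pred I) (f : I -> T -> R) :
  (forall i, bmeas D (f i)) ->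
  \int[mu]_(x in D) (\sum_(i <- r | Q i) f i x)
    = \sum_(i <- r | Q i) \int[mu]_(x in D) f i x.
Proof.
move=> bf; elim: r => [|i r ih].
  under eq_Rintegral do rewrite big_nil.
  by rewrite big_nil bint_cst mul0r.
under eq_Rintegral do rewrite big_cons.
rewrite big_cons; case: ifP => _ //.
by rewrite bintD ?ih//; exact: bmeas_sum.
Qed.

Lemma le_bint f g : bmeas D f -> bmeas D g -> (forall x, D x -> f x <= g x) ->
  \int[mu]_(x in D) f x <= \int[mu]_(x in D) g x.
Proof. by move=> bf bg fg; apply: le_Rintegral => //; exact: bmeas_integrable. Qed.

Lemma bintE f : bmeas D f ->
  (\int[mu]_(x in D) (f x)%:E)%E = (\int[mu]_(x in D) f x)%:E.
Proof.
move=> bf; rewrite /Rintegral fineK//.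
exact: (@integrable_fin_num _ _ _ mu D mD (EFin \o f) (bmeas_integrable bf)).
Qed.

End bounded_integral.

Section bounded_convergence.
Context d (T : measurableType d) (R : realType) (mu : {measure set T -> \bar R}).
Variable D : set T.
Hypothesis mD : measurable D.
Hypothesis fD : (mu D < +oo)%E.

Lemma bmeas_cvg (f_ : nat -> T -> R) (f : T -> R) K :
  (forall n, measurable_fun D (f_ n)) ->
  (forall n x, D x -> `|f_ n x| <= K) ->
  (forall x, D x -> f_ ^~ x @ \oo --> f x) -> bmeas D f.
Proof.
move=> mf fK ff; split; first exact: measurable_fun_cvg ff.
exists K => x Dx.
have /cvg_norm nf := ff _ Dx.
rewrite -(cvg_lim _ nf)//; apply: limr_le; first exact: cvgP nf.
by near=> n; exact: fK.
Unshelve. all: by end_near. Qed.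

Lemma bint_cvg (f_ : nat -> T -> R) (f : T -> R) K :
  (forall n, measurable_fun D (f_ n)) ->
  (forall n x, D x -> `|f_ n x| <= K) ->
  (forall x, D x -> f_ ^~ x @ \oo --> f x) ->
  (fun n => \int[mu]_(x in D) f_ n x) @ \oo --> \int[mu]_(x in D) f x.
Proof.
move=> mf fK ff.
have bf : bmeas D f := bmeas_cvg mf fK ff.
have bfn n : bmeas D (f_ n) by split => //; exists K => x; exact: fK.
have cE : (fun n => \int[mu]_(x in D) (f_ n x)%:E)%E @ \oo -->
    (\int[mu]_(x in D) (f x)%:E)%E.
  have h1 n : measurable_fun D (fun x => (f_ n x)%:E) by apply/measurable_EFinP; exact: mf.
  have h2 x : D x -> (fun n => (f_ n x)%:E) @ \oo --> (f x)%:E.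
    by move=> Dx; apply: cvg_EFin; [exact: nearW|exact: ff].
  have h3 : mu.-integrable D (fun=> K%:E).
    by apply: (bmeas_integrable mD fD); exact: bmeas_cst.
  have h4 n x : D x -> (`|(f_ n x)%:E| <= K%:E)%E by move=> Dx; rewrite lee_fin; exact: fK.
  exact: (dominated_cvg mD h1 h2 _ h3 h4).
rewrite (bintE mD fD bf) in cE.
have cE' : (fun n => (\int[mu]_(x in D) f_ n x)%:E) @ \oo --> (\int[mu]_(x in D) f x)%:E.
  by apply: cvg_trans cE; apply: near_eq_cvg; near=> n; rewrite bintE.
exact: (fine_cvg cE').
Unshelve. all: by end_near. Qed.

End bounded_convergence.

(** * Second moments of additive functions on the cube *)

Section cube.
Variable R : realType.
Notation leb := (@lebesgue_measure R).
Notation I01 := [set` `[0%R : R, 1%R]].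

Lemma measurable_I01 : measurable I01.
Proof. exact: measurable_itv. Qed.

Lemma leb_I01_fin : (leb I01 < +oo)%E.
Proof. by rewrite leb_I01 ltry. Qed.

Lemma bint_I01_cst (c : R) : \int[leb]_(x in I01) c = c.
Proof.
transitivity (c * fine (leb I01)); first exact: (bint_cst leb measurable_I01).
by rewrite leb_I01 mulr1.
Qed.

Implicit Types f g : R -> R.

Lemma I01E f : bmeas I01 f ->
  (\int[leb]_(x in I01) (f x)%:E)%E = (\int[leb]_(x in I01) f x)%:E.
Proof. exact: (@bintE _ _ R leb I01 measurable_I01 leb_I01_fin). Qed.

Lemma I01D f g : bmeas I01 f -> bmeas I01 g ->
  \int[leb]_(x in I01) (f x + g x) = \int[leb]_(x in I01) f x + \int[leb]_(x in I01) g x.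
Proof. exact: (@bintD _ _ R leb I01 measurable_I01 leb_I01_fin). Qed.

Lemma I01Z c f : bmeas I01 f ->
  \int[leb]_(x in I01) (c * f x) = c * \int[leb]_(x in I01) f x.
Proof. exact: (@bintZ _ _ R leb I01 measurable_I01 leb_I01_fin). Qed.

Lemma I01_sum (I : Type) (r : seq I) (Q : pred I) (f : I -> R -> R) :
  (forall i, bmeas I01 (f i)) ->
  \int[leb]_(x in I01) (\sum_(i <- r | Q i) f i x)
    = \sum_(i <- r | Q i) \int[leb]_(x in I01) f i x.
Proof. exact: (@bint_sum _ _ R leb I01 measurable_I01 leb_I01_fin). Qed.

(** Fixing the outermost coordinate gives the same expression with constant term [a + g m u], hence
    the induction over all [a]. When its square is expanded, the term [2 * a * g m u] integrates to
    zero by centering. *)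
Lemma iter_cube_int_sqr m (g : nat -> R -> R) a :
  (forall k, bmeas I01 (g k)) -> (forall k, \int[leb]_(x in I01) g k x = 0) ->
  iter_cube_int m (fun x => ((a + \sum_(k < m) g k (x k)) ^+ 2)%:E)
  = (a ^+ 2 + \sum_(k < m) \int[leb]_(x in I01) (g k x ^+ 2))%:E.
Proof.
move=> bg g0; elim: m a => [|m ih] a /=; first by rewrite !big_ord0 !addr0.
under eq_integral => u _.
  rewrite (_ : (fun x : nat -> R => _) = (fun x =>
    (((a + g m u) + \sum_(k < m) g k (x k)) ^+ 2)%:E)).
    rewrite ih; over.
  apply/funext => x; congr (_ ^+ 2)%:E.
  rewrite big_ord_recr/= eqxx addrAC addrA; congr (_ + _ + _).
  by apply: eq_bigr => k _; rewrite ltn_eqF.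
set S := \sum_(k < m) _.
have bA : bmeas I01 (fun u => a ^+ 2 + S + (2 * a) * g m u + g m u ^+ 2).
  by do !apply: bmeasD; [exact: bmeas_cst..|exact/bmeasZ/bg|exact/bmeas_sqr/bg].
transitivity (\int[leb]_(u in I01) (a ^+ 2 + S + (2 * a) * g m u + g m u ^+ 2))%:E.
  rewrite -I01E//; apply: eq_integral => u _.
  by congr EFin; ring.
congr EFin; rewrite big_ord_recr/= -/S.
rewrite I01D; last 2 first.
- by do !apply: bmeasD; [exact: bmeas_cst..|exact/bmeasZ/bg].
- exact/bmeas_sqr/bg.
rewrite I01D; last 2 first.
- exact: bmeas_cst.
- exact/bmeasZ/bg.
by rewrite bint_I01_cst I01Z// g0; ring.
Qed.

Variable p : nat.
Implicit Types (F G : ('I_p -> R) -> \bar R).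

(** The iterated integral runs over sequences indexed by [nat]; families indexed by ['I_p] are
    extended by a default value. *)
Let ext T (d : T) (g : 'I_p -> T) (j : nat) : T := oapp g d (insub j).
Let extE T (d : T) (g : 'I_p -> T) (k : 'I_p) : ext d g k = g k.
Proof. by rewrite /ext valK. Qed.

Lemma in_unit_in_cube (x : nat -> R) : in_unit x ->
  in_cube (fun k : 'I_p => x (nat_of_ord k)).
Proof. by move=> x01 k. Qed.

Lemma le_cube_int F G : (forall x, in_cube x -> 0 <= F x)%E ->
  (forall x, in_cube x -> F x <= G x)%E -> (cube_int F <= cube_int G)%E.
Proof.
by move=> F0 FG; apply: le_iter_cube_int => x /in_unit_in_cube;
  [exact: F0|exact: FG].
Qed.

Lemma eq_cube_int F G :
  (forall x, in_cube x -> F x = G x) -> cube_int F = cube_int G.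
Proof. by move=> FG; apply: eq_iter_cube_int => x /in_unit_in_cube/FG. Qed.

Lemma cube_intZl F (c : R) : 0 <= c -> (forall x, in_cube x -> 0 <= F x)%E ->
  cube_int (fun x => c%:E * F x)%E = (c%:E * cube_int F)%E.
Proof.
by move=> c0 F0; apply: iter_cube_intZl => // x /in_unit_in_cube/F0.
Qed.

Lemma cube_int_simple (I : finType) (c : I -> R) (A : I -> 'I_p -> set R) :
  (forall i k, measurable (A i k)) -> (forall i, 0 <= c i) ->
  cube_int (fun x => (\sum_i c i * \prod_(k < p) \1_(A i k) (x k))%:E)
  = (\sum_i c i * \prod_(k < p) len01 (A i k))%:E.
Proof.
move=> mA c0.
have := @iter_cube_int_simple R I p c (fun i => ext set0 (A i)) _ c0.
rewrite /cube_int => h; rewrite (_ : \sum_i _ =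
  \sum_i c i * \prod_(k < p) len01 (ext set0 (A i) k)); last first.
  by apply: eq_bigr => i _; under eq_bigr do rewrite -(extE set0 (A i)).
rewrite -h; last by move=> i k; rewrite /ext; case: insubP => //= k' _ _.
apply: eq_iter_cube_int => x _; congr EFin; apply: eq_bigr => i _.
by under eq_bigr do rewrite -(extE set0 (A i)).
Qed.

Lemma cube_int_sqr (g : 'I_p -> R -> R) a :
  (forall k, bmeas I01 (g k)) -> (forall k, \int[leb]_(x in I01) g k x = 0) ->
  cube_int (fun x => ((a + \sum_(k < p) g k (x k)) ^+ 2)%:E)
  = (a ^+ 2 + \sum_(k < p) \int[leb]_(x in I01) (g k x ^+ 2))%:E.
Proof.
move=> bg g0; have := @iter_cube_int_sqr p (ext (fun=> 0) g) a _ _.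
rewrite /cube_int => h; rewrite (_ : \sum_(k < p) _ =
  \sum_(k < p) \int[leb]_(x in I01) (ext (fun=> 0) g k x ^+ 2)); last first.
  by apply: eq_bigr => k _; rewrite extE.
rewrite -h.
- apply: eq_iter_cube_int => x _; congr (_ ^+ 2)%:E; congr (_ + _).
  by apply: eq_bigr => k _; rewrite extE.
- by move=> k; rewrite /ext; case: insubP => //= _; exact: bmeas_cst.
- by move=> k; rewrite /ext; case: insubP => //= _; rewrite bint_I01_cst.
Qed.

End cube.

(** * Series with absolutely summable coefficients, and Parseval *)

Section series_functions.
Variable R : realType.
Notation leb := (@lebesgue_measure R).
Notation I01 := [set` `[0%R : R, 1%R]].
Implicit Types (c : nat -> R) (S : R).

(** Summability is expressed by a uniform bound on partial sums, which passes to differences and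
    truncations without any limit. *)
Definition l1bound c S := forall n, \sum_(j < n) `|c j| <= S.

Lemma l1bound_ge0 c S : l1bound c S -> 0 <= S.
Proof. by move=> /(_ 0%N); rewrite big_ord0. Qed.

Lemma l1boundB c c' S S' : l1bound c S -> l1bound c' S' ->
  l1bound (fun j => c j - c' j) (S + S').
Proof.
move=> cS cS' n; apply: le_trans (lerD (cS n) (cS' n)).
by rewrite -big_split/=; apply: ler_sum => j _; exact: ler_normB.
Qed.

Lemma l1bound_trunc c S J : l1bound c S ->
  l1bound (fun j => if (j < J)%N then c j else 0) S.
Proof.
move=> cS n; apply: le_trans (cS n); apply: ler_sum => j _.
by case: ifP => // _; rewrite normr0.
Qed.

Lemma l1bound_fin c J : (forall j, (J <= j)%N -> c j = 0) ->
  l1bound c (\sum_(j < J) `|c j|).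
Proof.
move=> c0 n; have [nJ|Jn] := leqP n J.
  rewrite -!(big_mkord xpredT (fun j => `|c j|)) (big_cat_nat (leq0n _) nJ)//=.
  by rewrite lerDl sumr_ge0.
rewrite -!(big_mkord xpredT (fun j => `|c j|)) (big_cat_nat (leq0n _) (ltnW Jn))//=.
rewrite [X in _ + X](_ : _ = 0) ?addr0// big_nat big1// => j /andP[Jj _].
by rewrite c0// normr0.
Qed.

Lemma summable_cvg c S : l1bound c S -> cvgn (series c).
Proof.
move=> cS; apply: normed_cvg; change (cvgn (series (fun j => `|c j|))).
apply: nondecreasing_is_cvgn.
  apply/nondecreasing_seqP => n.
  by rewrite /series/= [leRHS]big_nat_recr//= lerDl.
by exists S => _ [n _ <-]; rewrite /series/= big_mkord; exact: cS.
Qed.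

(** A single coefficient is already bounded by [S], so each square is at most [S] times the absolute
    value. *)
Lemma sqr_summable c S n : l1bound c S ->
  \sum_(j < n) c j ^+ 2 <= S ^+ 2.
Proof.
move=> cS; have S0 := l1bound_ge0 cS.
apply: (@le_trans _ _ (\sum_(j < n) S * `|c j|)).
  apply: ler_sum => j _; rewrite -real_normK ?num_real// expr2.
  rewrite ler_wpM2r//; apply: le_trans (cS j.+1).
  by rewrite big_ord_recr/= lerDr sumr_ge0.
by rewrite -mulr_sumr expr2 ler_wpM2l.
Qed.

Definition sqsum c : R := limn (series (fun j => c j ^+ 2)).

Lemma sqsum_cvg c S : l1bound c S ->
  (fun n => \sum_(j < n) c j ^+ 2) @ \oo --> sqsum c.
Proof.
move=> cS; have -> : (fun n => \sum_(j < n) c j ^+ 2) =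
    series (fun j => c j ^+ 2).
  by apply/funext => n; rewrite /series/= big_mkord.
apply: nondecreasing_is_cvgn.
  apply/nondecreasing_seqP => n.
  by rewrite /series/= [leRHS]big_nat_recr//= lerDl sqr_ge0.
exists (S ^+ 2) => _ [n _ <-]; rewrite /series/= big_mkord.
exact: sqr_summable.
Qed.

Lemma sqsum_le c S K : l1bound c S -> (forall n, \sum_(j < n) c j ^+ 2 <= K) ->
  sqsum c <= K.
Proof.
move=> cS cK; rewrite -(cvg_lim _ (sqsum_cvg cS))//; apply: limr_le.
  exact: cvgP (sqsum_cvg cS).
exact: nearW.
Qed.

Lemma sqsum_ge0 c S : l1bound c S -> 0 <= sqsum c.
Proof.
move=> cS; rewrite -(cvg_lim _ (sqsum_cvg cS))//; apply: limr_ge.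
  exact: cvgP (sqsum_cvg cS).
by apply: nearW => n; apply: sumr_ge0 => j _; exact: sqr_ge0.
Qed.

Lemma sqsum_split c S J : l1bound c S ->
  sqsum c = \sum_(j < J) c j ^+ 2 + sqsum (fun j => if (j < J)%N then 0 else c j).
Proof.
move=> cS; have tS : l1bound (fun j => if (j < J)%N then 0 else c j) S.
  move=> n; apply: le_trans (cS n); apply: ler_sum => j _.
  by case: ifP => // _; rewrite normr0.
have h := sqsum_cvg cS.
apply: (cvg_unique (@Rhausdorff R) h); rewrite /mkset.
have h' : (fun n => \sum_(j < J) c j ^+ 2 +
    \sum_(j < n) (if (j < J)%N then 0 else c j) ^+ 2) @ \oo -->
    \sum_(j < J) c j ^+ 2 + sqsum (fun j => if (j < J)%N then 0 else c j).
  by apply: cvgD; [exact: cvg_cst|exact: (sqsum_cvg tS)].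
apply: cvg_trans h'; apply: near_eq_cvg; near=> n.
have Jn : (J <= n)%N by near: n; exists J.
rewrite /= /cst -!(big_mkord xpredT (fun j => c j ^+ 2)).
rewrite -(big_mkord xpredT (fun j => (if (j < J)%N then 0 else c j) ^+ 2)).
rewrite [RHS](big_cat_nat (leq0n _) Jn)//= [X in _ + X](big_cat_nat (leq0n _) Jn)//=.
rewrite [X in _ + (X + _)](_ : _ = 0) ?add0r; last first.
  by rewrite big_nat big1// => j /andP[_ ->]; rewrite expr0n.
congr (_ + _); rewrite big_nat [RHS]big_nat; apply: eq_bigr => j /andP[Jj _].
by rewrite ltnNge Jj.
Unshelve. all: by end_near. Qed.

Section basis.
Variables (psi : nat -> R -> R) (M : R).
Hypothesis mpsi : forall j, measurable_fun I01 (psi j).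
Hypothesis psiM : forall j x, I01 x -> `|psi j x| <= M.
Hypothesis psi0 : forall j, \int[leb]_(x in I01) psi j x = 0.
Hypothesis psion : forall j l, \int[leb]_(x in I01) (psi j x * psi l x) = (j == l)%:R.

Let bpsi j : bmeas I01 (psi j).
Proof. by split; [exact: mpsi|exists M => x; exact: psiM]. Qed.

Let M0 : 0 <= M.
Proof.
have := @psiM 0%N 0; rewrite /= in_itv/= lexx ler01 => /(_ isT).
by apply: le_trans; exact: normr_ge0.
Qed.

Definition serfun c (x : R) : R := limn (series (fun j => c j * psi j x)).

Lemma l1bound_psi c S x : l1bound c S -> I01 x ->
  l1bound (fun j => c j * psi j x) (M * S).
Proof.
move=> cS x01 n; apply: (@le_trans _ _ (\sum_(j < n) M * `|c j|)).
  by apply: ler_sum => j _; rewrite normrM mulrC ler_wpM2r// psiM.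
by rewrite -mulr_sumr ler_wpM2l.
Qed.

Lemma serfun_cvg c S x : l1bound c S -> I01 x ->
  (fun n => \sum_(j < n) c j * psi j x) @ \oo --> serfun c x.
Proof.
move=> cS x01; have -> : (fun n => \sum_(j < n) c j * psi j x) =
    series (fun j => c j * psi j x).
  by apply/funext => n; rewrite /series/= big_mkord.
exact: (summable_cvg (l1bound_psi cS x01)).
Qed.

Lemma psum_le c S n x : l1bound c S -> I01 x ->
  `|\sum_(j < n) c j * psi j x| <= M * S.
Proof.
move=> cS x01; apply: le_trans (ler_norm_sum _ _ _) _.
exact: (l1bound_psi cS x01).
Qed.

Lemma bmeas_psum c n : bmeas I01 (fun x => \sum_(j < n) c j * psi j x).
Proof. by apply: bmeas_sum => j; exact/bmeasZ/bpsi. Qed.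

Lemma bmeas_serfun c S : l1bound c S -> bmeas I01 (serfun c).
Proof.
move=> cS; apply: (@bmeas_cvg _ _ _ _ (fun n x => \sum_(j < n) c j * psi j x) _ (M * S)).
- by move=> n; case: (bmeas_psum c n).
- by move=> n x; exact: psum_le.
- by move=> x; exact: serfun_cvg.
Qed.

Lemma serfunB c c' S S' x : l1bound c S -> l1bound c' S' -> I01 x ->
  serfun (fun j => c j - c' j) x = serfun c x - serfun c' x.
Proof.
move=> cS cS' x01; apply: (cvg_unique (@Rhausdorff R) (serfun_cvg (l1boundB cS cS') x01)); rewrite /mkset.
have h : (fun n => \sum_(j < n) c j * psi j x - \sum_(j < n) c' j * psi j x) @ \oo -->
    serfun c x - serfun c' x.
  by apply: cvgB; [exact: (serfun_cvg cS)|exact: (serfun_cvg cS')].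
apply: cvg_trans h; apply: near_eq_cvg; near=> n => /=.
by rewrite -sumrB; apply: eq_bigr => j _; rewrite mulrBl.
Unshelve. all: by end_near. Qed.

Lemma serfun_fin c J x : (forall j, (J <= j)%N -> c j = 0) -> I01 x ->
  serfun c x = \sum_(j < J) c j * psi j x.
Proof.
move=> c0 x01; apply: (cvg_unique (@Rhausdorff R) (serfun_cvg (l1bound_fin c0) x01)); rewrite /mkset.
apply: cvg_near_cst; near=> n.
have Jn : (J <= n)%N by near: n; exists J.
rewrite -!(big_mkord xpredT (fun j => c j * psi j x)) (big_cat_nat (leq0n _) Jn)//=.
rewrite [X in _ + X](_ : _ = 0) ?addr0// big_nat big1// => j /andP[Jj _].
by rewrite c0// mul0r.
Unshelve. all: by end_near. Qed.

Lemma int_serfun c S : l1bound c S -> \int[leb]_(x in I01) serfun c x = 0.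
Proof.
move=> cS; have h := @bint_cvg _ _ R leb I01 (@measurable_I01 R) (@leb_I01_fin R)
  (fun n x => \sum_(j < n) c j * psi j x) (serfun c) (M * S)
  (fun n => (bmeas_psum c n).1) (fun n x => @psum_le c S n x cS)
  (fun x => @serfun_cvg c S x cS).
apply: (cvg_unique (@Rhausdorff R) h); rewrite /mkset.
apply: cvg_near_cst; near=> n.
transitivity (\sum_(j < n) \int[leb]_(x in I01) (c j * psi j x)).
  by apply: I01_sum => j; exact/bmeasZ/bpsi.
by rewrite big1// => j _; rewrite I01Z// psi0 mulr0.
Unshelve. all: by end_near. Qed.

Lemma int_psum_sqr c n :
  \int[leb]_(x in I01) ((\sum_(j < n) c j * psi j x) ^+ 2) = \sum_(j < n) c j ^+ 2.
Proof.
transitivity (\int[leb]_(x in I01) (\sum_(j < n) \sum_(l < n)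
    (c j * c l) * (psi j x * psi l x))).
  apply: eq_Rintegral => x _; rewrite expr2 big_distrl/=; apply: eq_bigr => j _.
  by rewrite big_distrr/=; apply: eq_bigr => l _; ring.
have bb j l : bmeas I01 (fun x => (c j * c l) * (psi j x * psi l x)).
  by apply: bmeasZ; exact: bmeasM.
rewrite I01_sum; last by move=> j; apply: bmeas_sum => l; exact: bb.
apply: eq_bigr => j _; rewrite I01_sum; last by move=> l; exact: bb.
rewrite (bigD1 j)//= I01Z ?psion ?eqxx ?mulr1; last exact: bmeasM.
rewrite big1 ?addr0// => l lj; rewrite I01Z ?psion; last exact: bmeasM.
by rewrite (_ : (j == l :> nat) = false) ?mulr0//; apply/negbTE; rewrite eq_sym.
Qed.

(** The partial sums are uniformly bounded by [M * S], so bounded convergence carries Parseval for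
    finite sums to the limit. *)
Lemma int_serfun_sqr c S : l1bound c S ->
  \int[leb]_(x in I01) (serfun c x ^+ 2) = sqsum c.
Proof.
move=> cS; have h := @bint_cvg _ _ R leb I01 (@measurable_I01 R) (@leb_I01_fin R)
  (fun n x => (\sum_(j < n) c j * psi j x) ^+ 2) (fun x => serfun c x ^+ 2) ((M * S) ^+ 2).
have {}h : (fun n => \sum_(j < n) c j ^+ 2) @ \oo --> \int[leb]_(x in I01) (serfun c x ^+ 2).
  apply: cvg_trans (h _ _ _).
  - by apply: near_eq_cvg; near=> n; apply: int_psum_sqr.
  - by move=> n; case: (bmeas_sqr (bmeas_psum c n)).
  - by move=> n x x01; rewrite normrX lerXn2r ?nnegrE ?mulr_ge0 ?(l1bound_ge0 cS)//;
      exact: psum_le.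
  - by move=> x x01; apply: cvgM; apply: serfun_cvg x01.
exact: (cvg_unique (@Rhausdorff R) h (sqsum_cvg cS)).
Unshelve. all: by end_near. Qed.

End basis.
End series_functions.

(** * Independence of generated sigma-algebras, and Fubini for independent variables *)

Section indep_sigma.
Context d (T : measurableType d) (R : realType) (P : probability T R).
Local Open Scope ereal_scope.

(** For a fixed [B], the events independent of [B] form a Dynkin system, and [G] is closed under
    intersection. *)
Lemma indep_sigma_left (G : set (set T)) (B : set T) :
  setI_closed G -> G `<=` measurable -> measurable B ->
  (forall A, G A -> P (A `&` B) = P A * P B) ->
  forall A, <<s G >> A -> P (A `&` B) = P A * P B.
Proof.
move=> GI Gm mB GB A sA.
have sm : <<s G >> `<=` @measurable _ T.
  by apply: smallest_sub => //; exact: sigma_algebra_measurable.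
have fB : P B \is a fin_num by exact: fin_num_measure.
have hC (S : set T) : measurable S -> P (S `&` B) = P S * P B ->
    P (~` S `&` B) = P (~` S) * P B.
  move=> mS PS; rewrite setIC -setDE measureD//; last by rewrite ltey_eq fB.
  transitivity (P B - P S * P B); first by rewrite [B `&` S]setIC; congr (_ - _); exact: PS.
  by rewrite (probability_setC _ mS) muleBl ?mul1e// fin_num_measure.
have hU (F : (set T)^nat) : (forall n, measurable (F n)) -> trivIset setT F ->
    (forall n, P (F n `&` B) = P (F n) * P B) ->
    P (\bigcup_n F n `&` B) = P (\bigcup_n F n) * P B.
  move=> mF tF PF; rewrite setI_bigcupl measure_semi_bigcup; last 3 first.
  - by move=> n; exact: measurableI.
  - exact: trivIset_setIr.
  - by apply: bigcupT_measurable => n; exact: measurableI.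
  rewrite (@measure_semi_bigcup _ _ _ P F)//; last exact: bigcupT_measurable.
  transitivity (\sum_(i <oo) (fine (P B))%:E * P (F i)).
    by apply: eq_eseriesr => n _; rewrite fineK// muleC; exact: PF.
  by rewrite nneseriesZl// fineK// muleC.
apply: (@dynkin_induction _ (g_sigma_algebraType G) G
  (fun A : set T => P (A `&` B) = P A * P B)) sA => //.
- by rewrite setTI (probability_setT P) mul1e.
- by move=> S sS PS; exact: (hC _ (sm _ sS) PS).
- by move=> F mF tF PF; exact: (hU _ (fun n => sm _ (mF n)) tF PF).
Qed.

(** The one-sided extension is applied twice: to the second factor with [A] fixed, then to the first
    factor with a generator of the second fixed. *)
Lemma indep_sigma (G1 G2 : set (set T)) :
  setI_closed G1 -> setI_closed G2 ->
  G1 `<=` measurable -> G2 `<=` measurable ->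
  (forall A B, G1 A -> G2 B -> P (A `&` B) = P A * P B) ->
  forall A B, <<s G1 >> A -> <<s G2 >> B -> P (A `&` B) = P A * P B.
Proof.
move=> I1 I2 m1 m2 h A B sA sB.
have sm G : G `<=` @measurable _ T -> <<s G >> `<=` @measurable _ T.
  by move=> Gm; apply: smallest_sub => //; exact: sigma_algebra_measurable.
rewrite setIC muleC; apply: (indep_sigma_left I2 m2 _ _ sB); first exact: sm sA.
move=> C GC; rewrite setIC muleC; apply: (indep_sigma_left I1 m1 _ _ sA).
  exact: m2.
by move=> D GD; exact: h.
Qed.

End indep_sigma.

Section probability_integral.
Context d (T : measurableType d) (R : realType) (P : probability T R).

Lemma probT_fin : (P setT < +oo)%E.
Proof. by rewrite (probability_setT P) ltry. Qed.

Lemma prob_int_cst (c : R) : \int[P]_w c = c.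
Proof.
transitivity (c * fine (P setT)); first exact: (bint_cst P measurableT).
by rewrite probability_setT mulr1.
Qed.

Lemma prob_int_shift (g : T -> R) K : bmeas setT g ->
  \int[P]_w (g w + K) = \int[P]_w g w + K.
Proof.
move=> bg; rewrite -[in RHS](prob_int_cst K).
exact: (bintD measurableT probT_fin bg (bmeas_cst setT K)).
Qed.

Lemma prob_int_le (g : T -> R) K : bmeas setT g -> (forall w, g w <= K) ->
  \int[P]_w g w <= K.
Proof.
move=> bg gK; rewrite -[leRHS]prob_int_cst.
by apply: (le_bint measurableT probT_fin bg (bmeas_cst setT K)) => w _.
Qed.

Lemma prob_int_ge (g : T -> R) K : bmeas setT g -> (forall w, K <= g w) ->
  K <= \int[P]_w g w.
Proof.
move=> bg gK; rewrite -[leLHS]prob_int_cst.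
by apply: (le_bint measurableT probT_fin (bmeas_cst setT K) bg) => w _.
Qed.

End probability_integral.

Section indep_fubini.
Context d (T : measurableType d) (R : realType) (P : probability T R).
Context d1 d2 (T1 : measurableType d1) (T2 : measurableType d2).
Variables (V : {mfun T >-> T1}) (Z : {mfun T >-> T2}).
Hypothesis indVZ : forall A B, measurable A -> measurable B ->
  (P (V @^-1` A `&` Z @^-1` B) = P (V @^-1` A) * P (Z @^-1` B))%E.

Let mVZ : measurable_fun setT (fun w => (V w, Z w)).
Proof. by apply: measurable_fun_pair; exact: measurable_funPT. Qed.

Let VZ : {mfun T >-> (T1 * T2)%type} :=
  HB.pack (fun w => (V w, Z w)) (isMeasurableFun.Build _ _ _ _ _ mVZ).

Local Open Scope ereal_scope.

(** Independence on rectangles identifies the joint law with the product of the marginal laws, so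
    Tonelli applies. The inner integral runs over the same space, [w'] acting as an independent copy
    of the outcome. *)
Lemma ge0_indep_fubini (f : T1 * T2 -> \bar R) :
  measurable_fun setT f -> (forall x, 0 <= f x) ->
  \int[P]_w f (V w, Z w) = \int[P]_w \int[P]_w' f (V w, Z w').
Proof.
move=> mf f0.
transitivity (\int[distribution P VZ]_x f x).
  by rewrite ge0_integral_pushforward// => x _; exact: f0.
transitivity (\int[distribution P V \x distribution P Z]_x f x).
  apply: eq_measure_integral => A mA _; apply/esym.
  by apply: product_measure_unique => // C D mC mD; exact: indVZ.
rewrite fubini_tonelli1//.
have mF : measurable_fun setT (fubini_F (distribution P Z) f).
  exact: measurable_fun_fubini_tonelli_F.
rewrite ge0_integral_pushforward//; last first.
  by move=> x _; apply: integral_ge0 => y _; exact: f0.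
apply: eq_integral => w _ /=.
have mp : measurable_fun setT (fun y : T2 => (V w, y)).
  by apply: measurable_fun_pair; [exact: measurable_cst|exact: measurable_id].
by rewrite /fubini_F ge0_integral_pushforward//; exact: (measurableT_comp mf mp).
Qed.

Local Open Scope ring_scope.

Lemma bmeas_indep_section (f : T1 * T2 -> R) x : bmeas setT f ->
  bmeas setT (fun w' => f (x, Z w')).
Proof.
move=> [mf [K fK]]; split; last by exists K => w _; exact: fK.
apply: (measurableT_comp mf); apply: measurable_fun_pair => //.
Qed.

Lemma bmeas_indep_int (f : T1 * T2 -> R) : bmeas setT f ->
  bmeas setT (fun x => \int[P]_w' f (x, Z w')).
Proof.
move=> bf; have [K K0 fK] := bmeas_ub bf.
have bx x := bmeas_indep_section x bf.
split.
(* Adding the bound [K] makes the integrand nonnegative, so that Tonelli applies; the constant is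
   subtracted at the end. *)
- pose F := fun z => (f z + K)%:E.
  have mF : measurable_fun setT F.
    by apply/measurable_EFinP; case: (bmeasD bf (bmeas_cst setT K)).
  have F0 z : (0 <= F z)%E.
    rewrite lee_fin -lerBlDr sub0r.
    by have := fK z I; rewrite ler_norml => /andP[].
  have mFF : measurable_fun setT (fubini_F (distribution P Z) F).
    exact: measurable_fun_fubini_tonelli_F.
  rewrite (_ : (fun x => _) = (fun x => fine (fubini_F (distribution P Z) F x) - K)).
    apply: measurable_funB; last exact: measurable_cst.
    by apply: measurableT_comp mFF; exact: fine_measurable.
  apply/funext => x; have mp : measurable_fun setT (fun y : T2 => (x, y)).
    by apply: measurable_fun_pair; [exact: measurable_cst|exact: measurable_id].
  rewrite /fubini_F ge0_integral_pushforward//; last exact: (measurableT_comp mF mp).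
  rewrite preimage_setT /F /=.
  have -> : fine (\int[P]_w (f (x, Z w) + K)%:E)%E = \int[P]_w (f (x, Z w) + K) by [].
  by rewrite prob_int_shift// addrK.
- exists K => x _; rewrite ler_norml; apply/andP; split.
    apply: prob_int_ge => // w.
    by have := fK (x, Z w) I; rewrite ler_norml => /andP[].
  apply: prob_int_le => // w.
  by have := fK (x, Z w) I; rewrite ler_norml => /andP[].
Qed.

Lemma indep_fubini (f : T1 * T2 -> R) : bmeas setT f ->
  \int[P]_w f (V w, Z w) = \int[P]_w \int[P]_w' f (V w, Z w').
Proof.
move=> bf; have [K K0 fK] := bmeas_ub bf.
have bx x := bmeas_indep_section x bf.
have bVZ : bmeas setT (fun w => f (V w, Z w)).
  by split; [exact: (measurableT_comp bf.1 mVZ)|exists K => w _; exact: fK].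
have bI : bmeas setT (fun w => \int[P]_w' f (V w, Z w')).
  have [mI [L IL]] := bmeas_indep_int bf.
  split; last by exists L => w _; exact: IL.
  exact: (measurableT_comp mI).
apply: (@addIr _ K); rewrite -!prob_int_shift//.
have mF : measurable_fun setT (fun z => (f z + K)%:E).
  by apply/measurable_EFinP; case: (bmeasD bf (bmeas_cst setT K)).
have F0 z : (0 <= (f z + K)%:E)%E.
  rewrite lee_fin -lerBlDr sub0r.
  by have := fK z I; rewrite ler_norml => /andP[].
rewrite /Rintegral (ge0_indep_fubini mF F0); congr fine.
apply: eq_integral => w _; rewrite (bintE measurableT (probT_fin P))//.
  by rewrite prob_int_shift.
by apply: bmeasD; [exact: bx|exact: bmeas_cst].
Qed.

End indep_fubini.

(** * Finite partitions on which given functions are almost constant *)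

Section finite_approximation.
Variable R : realType.
Notation I01 := [set` `[0%R : R, 1%R]].

(* Cells are indexed by the outcomes of finitely many threshold tests
   [a_l <= g i x], with thresholds spaced by [e]. *)
Lemma finite_approx (N : nat) (K e : R) : 0 < e -> exists T : finType,
  forall g : 'I_N -> R -> R, (forall i, measurable_fun I01 (g i)) ->
  (forall i x, I01 x -> `|g i x| <= K) ->
  exists (iota : R -> T) (r : T -> R),
  [/\ forall m, measurable (I01 `&` iota @^-1` [set m]),
      forall m, I01 (r m) &
      forall x, I01 x -> forall i, `|g i (r (iota x)) - g i x| <= e].
Proof.
(* The quotients [(g + K) / e] lie in [[0, 2 * K / e]]; the additional indices leave room for the
   threshold just above the largest value. The index type depends on [N], [K] and [e] only, so one
   type can serve all coordinates. *)
move=> e0; pose L := (Num.truncn (2 * K / e)).+3.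
exists {ffun 'I_N * 'I_L -> bool} => g mg gK.
pose a (l : nat) := - K + l%:R * e.
pose iota x := [ffun il : 'I_N * 'I_L => a il.2 <= g il.1 x].
have I0 : I01 0 by rewrite /= in_itv/= lexx ler01.
have close x y : I01 x -> I01 y -> iota x = iota y -> forall i, g i y - g i x <= e.
  move=> x01 y01 xy i; rewrite leNgt; apply/negP => gt.
  have K0 : 0 <= K by exact: le_trans (gK i 0 I0).
  have := gK i x x01; rewrite ler_norml => /andP[gl gu].
  have u0 : 0 <= (g i x + K) / e by rewrite divr_ge0 ?(ltW e0)// -lerBlDr sub0r.
  (* Threshold [n] is the last one not above [g i x]. If [g i y] exceeded [g i x] by more than [e],
     threshold [n.+1] would separate the two points. *)
  pose n := Num.truncn ((g i x + K) / e).
  have /andP[n1 n2] := truncn_itv u0; rewrite -/n in n1 n2.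
  have nL : (n.+1 < L)%N.
    rewrite /L ltnS ltnS; apply: leqW; apply: le_truncn; rewrite ler_pM2r ?invr_gt0//; lra.
  move: xy => /ffunP/(_ (i, Ordinal nL)); rewrite !ffunE/= /a.
  have n1' : n%:R * e <= g i x + K by rewrite -ler_pdivlMr.
  have n2' : g i x + K < n.+1%:R * e by rewrite -ltr_pdivrMr.
  have n3 : n.+1%:R * e = n%:R * e + e by rewrite -natr1 mulrDl mul1r.
  have -> : (- K + n.+1%:R * e <= g i x) = false by apply/negbTE; rewrite -ltNge; lra.
  by have -> : (- K + n.+1%:R * e <= g i y) = true by lra.
(* An empty cell receives the representative 0, which still lies in the unit interval. *)
pose r m := xget 0 [set x | I01 x /\ iota x = m].
exists iota, r; split.
- move=> m.
  have -> : I01 `&` iota @^-1` [set m] = I01 `&`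
      \bigcap_(il in [set: 'I_N * 'I_L])
        (~` I01 `|` (I01 `&` (fun x => a il.2 <= g il.1 x) @^-1` [set m il])).
    apply/seteqP; split => x [x01].
      by move=> /= xm; split => // il _; right; split => //=; rewrite -xm ffunE.
    move=> /= h; split => //; apply/ffunP => il; rewrite ffunE.
    by have [//|[_ /= ->]] := h il I.
  apply: measurableI => //; apply: fin_bigcap_measurable => // il _.
  apply: measurableU; first exact: measurableC.
  have mb : measurable_fun I01 (fun x => a il.2 <= g il.1 x).
    by apply: measurable_fun_ler; [exact: measurable_cst|exact: mg].
  exact: mb.
- move=> m; rewrite /r; case: xgetP => //=.
  by move=> x _ [].
- move=> x x01 i.
  have [r01 rE] : I01 (r (iota x)) /\ iota (r (iota x)) = iota x.
    by rewrite /r; case: xgetP => [y _ //|/(_ x)]; case.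
  rewrite ler_norml; apply/andP; split.
    by rewrite lerNl opprB; exact: close.
  exact: close.
Qed.

End finite_approximation.

(** * Euclidean projection onto the l1 ball, and measurability of its values *)

Section projection.
Context (R : realType) (I : finType) (Rad : R).
Implicit Types u v w : I -> R.

Definition l1proj v w := \sum_i `|w i| <= Rad /\
  forall u, \sum_i `|u i| <= Rad ->
    \sum_i (v i - w i) ^+ 2 <= \sum_i (v i - u i) ^+ 2.

(** If the inner product were positive, moving from [w] towards [u] would stay in the ball by
    convexity and come closer to [v]. *)
Lemma l1proj_obtuse v w u : l1proj v w -> \sum_i `|u i| <= Rad ->
  \sum_i (v i - w i) * (u i - w i) <= 0.
Proof.
move=> [wR wmin] uR; rewrite leNgt; apply/negP => ip.
set S := \sum_i _ in ip; set D := \sum_i (u i - w i) ^+ 2.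
have D0 : 0 <= D by apply: sumr_ge0 => i _; exact: sqr_ge0.
(* This step length gives [l * D <= S], so the squared distance changes by
   [- 2 * l * S + l ^+ 2 * D <= - l * S < 0]. *)
pose l := S / (S + D); have SD : 0 < S + D by rewrite ltr_wpDr.
have lSD : l * (S + D) = S by rewrite /l divfK ?gt_eqF.
have l0 : 0 < l by rewrite divr_gt0.
have l1 : l <= 1 by rewrite ler_pdivrMr// mul1r lerDl.
clearbody l.
have := wmin (fun i => w i + l * (u i - w i)) _.
have -> : \sum_i (v i - (w i + l * (u i - w i))) ^+ 2 =
   \sum_i (v i - w i) ^+ 2 - 2 * l * S + l ^+ 2 * D.
  rewrite /S /D !mulr_sumr -sumrB -big_split/=; apply: eq_bigr => i _; ring.
have h : \sum_i `|w i + l * (u i - w i)| <= Rad.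
  apply: (@le_trans _ _ (\sum_i ((1 - l) * `|w i| + l * `|u i|))).
    apply: ler_sum => i _; rewrite (_ : w i + l * (u i - w i) = (1 - l) * w i + l * u i); last by ring.
    apply: le_trans (ler_normD _ _) _.
    by rewrite !normrM (gtr0_norm l0) ger0_norm ?subr_ge0.
  rewrite big_split/= -!mulr_sumr.
  have : (1 - l) * \sum_i `|w i| <= (1 - l) * Rad by rewrite ler_wpM2l ?subr_ge0.
  have : l * \sum_i `|u i| <= l * Rad by rewrite ler_wpM2l// ltW.
  lra.
move=> /(_ h); have lD : l * D <= S by rewrite -[leRHS]lSD mulrDr lerDr mulr_ge0// ltW.
have lS : 0 < l * S by rewrite mulr_gt0.
have : l ^+ 2 * D <= l * S by rewrite expr2 -mulrA ler_wpM2l// ltW.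
lra.
Qed.

Lemma l1proj_nonexp v w u : l1proj v w -> \sum_i `|u i| <= Rad ->
  \sum_i (w i - u i) ^+ 2 <= \sum_i (v i - u i) ^+ 2.
Proof.
move=> vw uR; have h := l1proj_obtuse vw uR.
have -> : \sum_i (v i - u i) ^+ 2 = \sum_i (v i - w i) ^+ 2 +
    \sum_i (w i - u i) ^+ 2 - 2 * \sum_i (v i - w i) * (u i - w i).
  rewrite mulr_sumr -big_split/= -sumrB; apply: eq_bigr => i _; ring.
have : 0 <= \sum_i (v i - w i) ^+ 2 by apply: sumr_ge0 => i _; exact: sqr_ge0.
lra.
Qed.

(** The two obtuse-angle inequalities, each taken against the other projection, are added. *)
Lemma l1proj_lip v w v' w' : l1proj v w -> l1proj v' w' ->
  \sum_i (w i - w' i) ^+ 2 <= \sum_i (v i - v' i) ^+ 2.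
Proof.
move=> vw vw'; have h := l1proj_obtuse vw vw'.1.
have h' := l1proj_obtuse vw' vw.1.
have h2 : 0 <= \sum_i ((v i - v' i) - (w i - w' i)) ^+ 2.
  by apply: sumr_ge0 => i _; exact: sqr_ge0.
have : \sum_i ((v i - v' i) - (w i - w' i)) ^+ 2 =
   \sum_i (v i - v' i) ^+ 2 - \sum_i (w i - w' i) ^+ 2 +
   2 * (\sum_i (v i - w i) * (w' i - w i) + \sum_i (v' i - w' i) * (w i - w' i)).
  rewrite -[in X in 2 * X]big_split/= mulr_sumr -sumrB -big_split/=.
  by apply: eq_bigr => i _; ring.
lra.
Qed.

(** The l1 distance of the inputs bounds each coordinate of the output: this is the form required by
    [lipschitz_measurable], which makes the iterates measurable. *)
Lemma l1proj_coord_lip v w v' w' i : l1proj v w -> l1proj v' w' ->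
  `|w i - w' i| <= \sum_j `|v j - v' j|.
Proof.
move=> vw vw'; have S0 : 0 <= \sum_j `|v j - v' j| by exact: sumr_ge0.
rewrite -(@ler_pXn2r _ 2)// ?nnegrE// real_normK ?num_real//.
apply: (@le_trans _ _ (\sum_j (w j - w' j) ^+ 2)).
  by rewrite (bigD1 i)//= lerDl sumr_ge0// => j _; exact: sqr_ge0.
apply: le_trans (l1proj_lip vw vw') _.
apply: (@le_trans _ _ (\sum_j `|v j - v' j| * \sum_j `|v j - v' j|)).
  apply: ler_sum => j _; rewrite -real_normK ?num_real// expr2 ler_wpM2l//.
  by rewrite (bigD1 j)//= lerDl sumr_ge0.
by rewrite -mulr_suml expr2.
Qed.

End projection.

Section lipschitz_measurable.
Context d (T : measurableType d) (R : realType) (I : finType).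
Variables (v : I -> T -> R) (phi : T -> R).
Hypothesis mv : forall i, measurable_fun setT (v i).
Hypothesis lip : forall x y, `|phi x - phi y| <= \sum_i `|v i x - v i y|.

Let cell n x : {ffun I -> int} := [ffun i => Num.floor (v i x * n.+1%:R)].
Let rep n z := xget point [set x | cell n x = z].
Let phin n x := phi (rep n (cell n x)).

Let cell_rep n x : cell n (rep n (cell n x)) = cell n x.
Proof. by rewrite /rep; case: xgetP => [y _ /= -> //|/(_ x) /= nx]; case: nx. Qed.

Let phin_close n x : `|phin n x - phi x| <= #|I|%:R / n.+1%:R.
Proof.
apply: le_trans (lip _ _) _.
rewrite -sum1_card natr_sum mulr_suml; apply: ler_sum => i _.
have /ffunP/(_ i) := cell_rep n x; rewrite !ffunE => fE.
set a := v i (rep _ _) in fE *; set b := v i x in fE *.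
have /andP[a1 a2] := floor_itv (a * n.+1%:R).
have /andP[b1 b2] := floor_itv (b * n.+1%:R).
rewrite fE in a1 a2; rewrite intrD in a2 b2.
rewrite ler_pdivlMr// -[X in _ * X]ger0_norm// -normrM mulrBl ler_norml.
by apply/andP; split; lra.
Qed.

Let measurable_cell n z : measurable [set x | cell n x = z].
Proof.
have -> : [set x | cell n x = z] = \bigcap_(i in [set: I])
   (setT `&` (fun x => v i x * n.+1%:R) @^-1` `[(z i)%:~R, (z i + 1)%:~R[).
  apply/seteqP; split => x /=.
    move=> <- i _; split => //=; rewrite ffunE in_itv/=; exact: floor_itv.
  move=> h; apply/ffunP => i; rewrite ffunE; apply: floor_def.
  by have [_] := h i Logic.I; rewrite /= in_itv.
apply: fin_bigcap_measurable => // i _.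
have mvi : measurable_fun setT (fun x => v i x * n.+1%:R).
  by apply: measurable_funM => //; exact: measurable_cst.
exact: mvi.
Qed.

Let measurable_phin n : measurable_fun setT (phin n).
Proof.
move=> _ B mB; rewrite setTI.
have -> : phin n @^-1` B = \bigcup_(z in [set: {ffun I -> int}])
   ([set x | cell n x = z] `&` [set x | B (phi (rep n z))]).
  apply/seteqP; split => x /=; first by move=> h; exists (cell n x).
  by move=> [z _ [/= <-]].
apply: countable_bigcupT_measurable; first exact: countableP.
move=> z; have [Bz|Bz] := pselect (B (phi (rep n z))).
  rewrite (_ : [set x | B (phi (rep n z))] = setT) ?setIT//.
  by apply/seteqP; split.
rewrite (_ : [set x | B (phi (rep n z))] = set0) ?setI0//.
by apply/seteqP; split.
Qed.

(** Rounding the values of all [v i] to the grid of mesh [1 / n.+1] cuts the space into countably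
    many measurable cells. Freezing [phi] at a representative of each cell gives measurable
    functions within [#|I| / n.+1] of [phi]. *)
Lemma lipschitz_measurable : measurable_fun setT phi.
Proof.
apply: (@measurable_fun_cvg _ _ _ setT phin) => // x _.
apply/cvgrPdist_le => e e0; near=> n.
rewrite distrC; apply: le_trans (phin_close n x) _.
rewrite ler_pdivrMr// -ler_pdivrMl//.
apply: (@le_trans _ _ n%:R); last by rewrite ler_nat.
near: n; exact: nbhs_infty_ger.
Unshelve. all: by end_near. Qed.

End lipschitz_measurable.

(** * Laws with a density and their quantiles *)

Section density_quantile.
Variable R : realType.
Notation leb := (@lebesgue_measure R).
Variable f : R -> R.
Hypothesis mf : measurable_fun setT f.
Hypothesis f0 : forall y, 0 <= f y.
Hypothesis f1 : (\int[leb]_(y in setT) (f y)%:E = 1)%E.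
Local Open Scope ereal_scope.

Definition mass (A : set R) : \bar R := \int[leb]_(y in A) (f y)%:E.

Let mfE (A : set R) : measurable_fun A (EFin \o f).
Proof. by apply/measurable_EFinP; exact: measurable_funS mf. Qed.

Lemma mass_ge0 A : 0 <= mass A.
Proof. by apply: integral_ge0 => y _; rewrite lee_fin. Qed.

Lemma mass_le A B : A `<=` B -> mass A <= mass B.
Proof.
move=> AB; rewrite /mass integral_mkcond [leRHS]integral_mkcond.
apply: le_lower_integral => y _; first by apply: erestrict_ge0 => z _; rewrite lee_fin.
rewrite !patchE; case: ifPn => yA; last first.
  by case: ifP => _ //; rewrite lee_fin.
by rewrite ifT// inE; apply: AB; rewrite inE in yA.
Qed.

Lemma mass_le1 A : mass A <= 1.
Proof. by rewrite -f1; apply: mass_le. Qed.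

Lemma mass_fin A : mass A \is a fin_num.
Proof.
by rewrite ge0_fin_numE ?mass_ge0// (le_lt_trans (mass_le1 A))// ltry.
Qed.

Lemma massU A B : measurable A -> measurable B -> A `&` B = set0 ->
  mass (A `|` B) = mass A + mass B.
Proof.
move=> mA mB AB; apply: ge0_integral_setU => //.
- exact: mfE.
- by move=> y _; rewrite lee_fin.
- exact/disj_set2P.
Qed.

Lemma mass_split (a : R) : mass `]-oo, a] + mass `]a, +oo[ = 1.
Proof.
rewrite -massU//.
  rewrite (_ : _ `|` _ = setT); first exact: f1.
  apply/seteqP; split => // y _ /=; rewrite !in_itv/= andbT.
  by case: (leP y a); [left|right].
apply/seteqP; split => // y [/=]; rewrite !in_itv/= andbT => ya ay.
by have := lt_le_trans ay ya; rewrite ltxx.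
Qed.

Lemma mass_itv (a b : R) : (a <= b)%R ->
  mass `]-oo, b] = mass `]-oo, a] + mass `]a, b].
Proof.
move=> ab; rewrite -massU//.
  congr mass; apply/seteqP; split => y /=; rewrite !in_itv/=.
    by move=> yb; case: (leP y a) => ya; [left|right].
  by case=> [ya|/andP[]//]; exact: le_trans ab.
apply/seteqP; split => // y [/=]; rewrite !in_itv/= => ya /andP[ay _].
by have := lt_le_trans ay ya; rewrite ltxx.
Qed.

Lemma mass_ub (a b c : R) (A : set R) : (a <= b)%R -> (0 <= c)%R ->
  A `<=` [set` `[a, b]] -> (forall y, (a <= y <= b)%R -> (f y <= c)%R) ->
  mass A <= (c * (b - a))%:E.
Proof.
move=> ab c0 Aab fc; apply: (@le_trans _ _ (mass `[a, b])); first exact: mass_le.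
have -> : (c * (b - a))%:E = \int[leb]_(y in `[a, b]) c%:E.
  rewrite integral_cst//= lebesgue_measure_itv/= lte_fin.
  case: ltP => [_|ba]; first by rewrite EFinM EFinB.
  by rewrite mule0 (_ : b = a) ?subrr ?mulr0//; apply/eqP; rewrite eq_le ba.
apply: le_lower_integral => y /=; rewrite in_itv/= => yab; first by rewrite lee_fin.
by rewrite lee_fin fc.
Qed.

Lemma mass_lb (a b c : R) : (a <= b)%R -> (0 <= c)%R ->
  (forall y, (a < y <= b)%R -> (c <= f y)%R) ->
  (c * (b - a))%:E <= mass `]a, b].
Proof.
move=> ab c0 fc.
have -> : (c * (b - a))%:E = \int[leb]_(y in `]a, b]) c%:E.
  rewrite integral_cst//= lebesgue_measure_itv/= lte_fin.
  case: ltP => [_|ba]; first by rewrite EFinM EFinB.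
  by rewrite mule0 (_ : b = a) ?subrr ?mulr0//; apply/eqP; rewrite eq_le ba.
by apply: le_lower_integral => y /=; rewrite in_itv/= => yab; rewrite lee_fin// fc.
Qed.

Lemma mass_cvg (F : nat -> set R) : (forall n, measurable (F n)) ->
  nondecreasing_seq F -> (fun n => mass (F n)) @ \oo --> mass (\bigcup_n F n).
Proof.
move=> mF ndF.
have f0' n x : F n x -> 0 <= (EFin \o f) x by move=> _; rewrite lee_fin.
exact: (@ge0_nondecreasing_set_cvg_integral _ (measurableTypeR R) R F (EFin \o f) leb ndF mF
  (fun n => @mfE (F n)) f0').
Qed.

Lemma mass_bigcup_le (F : nat -> set R) K : (forall n, measurable (F n)) ->
  nondecreasing_seq F -> (forall n, mass (F n) <= K) -> mass (\bigcup_n F n) <= K.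
Proof.
move=> mF ndF FK; have h := mass_cvg mF ndF.
rewrite -(cvg_lim _ h)//; apply: lime_le; first exact: cvgP h.
exact: nearW.
Qed.

Let nd_left (b : nat -> R) : {homo b : m n / (m <= n)%N >-> (m <= n)%R} ->
  nondecreasing_seq (fun n => [set` `]-oo, b n]]).
Proof.
move=> hb m n mn; rewrite subsetEset => y /=; rewrite !in_itv/= => ybm.
by rewrite (le_trans ybm)// hb.
Qed.

Let nd_right (b : nat -> R) : {homo b : m n / (m <= n)%N >-> (n <= m)%R} ->
  nondecreasing_seq (fun n => [set` `]b n, +oo[]).
Proof.
move=> hb m n mn; rewrite subsetEset => y /=; rewrite !in_itv/= !andbT => ybm.
by rewrite (le_lt_trans _ ybm)// hb.
Qed.

Let lt_inv (z : R) : (0 < z)%R -> exists n : nat, (n.+1%:R^-1 < z)%R.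
Proof.
move=> z0; exists (Num.truncn z^-1).
by rewrite invf_plt ?posrE// truncnS_gt.
Qed.

(** A law with a density has no atoms, so the level [tau] is attained exactly. The bounds on [tau]
    make the level set nonempty and bounded below, so that [inf] is a true infimum and not a default
    value. *)
Lemma quantileE (tau : R) : (0 < tau < 1)%R ->
  mass `]-oo, inf [set v | tau%:E <= mass `]-oo, v]]] = tau%:E.
Proof.
move=> /andP[tau0 tau1]; pose S : set R := [set v | tau%:E <= mass `]-oo, v]]; rewrite -/S; set q := inf S.
have neS : S !=set0.
  apply: contrapT => nS.
  suff : mass (\bigcup_n [set` `]-oo, (n%:R : R)]]) <= tau%:E.
    rewrite (_ : \bigcup_n _ = setT); first by rewrite /mass f1 lee_fin leNgt tau1.
    apply/seteqP; split => // y _; exists (Num.truncn y).+1 => //=.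
    by rewrite in_itv/= ltW// truncnS_gt.
  apply: mass_bigcup_le => //; first by apply: nd_left => m n; rewrite ler_nat.
  by move=> n; rewrite leNgt; apply/negP => h; apply: nS; exists n%:R; exact: (ltW h).
have lbS : has_lbound S.
  apply: contrapT => nS.
  suff : mass (\bigcup_n [set` `](- n%:R)%R, +oo[]) <= (1 - tau)%:E.
    rewrite (_ : \bigcup_n _ = setT).
      by rewrite /mass f1 lee_fin leNgt ltrBlDr ltrDl tau0.
    apply/seteqP; split => // y _; exists (Num.truncn (- y)).+1 => //=.
    by rewrite in_itv/= andbT ltrNl truncnS_gt.
  apply: mass_bigcup_le => //.
    by apply: nd_right => m n mn; rewrite lerN2 ler_nat.
  move=> n; have tn : tau%:E <= mass `]-oo, (- n%:R)%R].
    rewrite leNgt; apply/negP => h; apply: nS; exists (- n%:R)%R => v Sv.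
    rewrite leNgt; apply/negP => vn; move: h; rewrite ltNge => /negP; apply.
    apply: le_trans Sv _; apply: mass_le => y /=; rewrite !in_itv/= => yv.
    exact: le_trans yv (ltW vn).
  have := mass_split (- n%:R)%R; move: tn.
  rewrite -(fineK (mass_fin `]-oo, (- n%:R)%R])) -(fineK (mass_fin `](- n%:R)%R, +oo[)).
  by rewrite -EFinD !lee_fin => tn [] h; lra.
have below v : (v < q)%R -> mass `]-oo, v] < tau%:E.
  move=> vq; rewrite ltNge; apply/negP => tv.
  have := ge_inf lbS tv; rewrite -/q => qv.
  by have := lt_le_trans vq qv; rewrite ltxx.
have above v : (q < v)%R -> tau%:E <= mass `]-oo, v].
  move=> qv; have [u Su uv] := inf_lt neS qv.
  apply: le_trans Su _; apply: mass_le => y /=; rewrite !in_itv/= => yu.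
  exact: le_trans yu (ltW uv).
apply/eqP; rewrite eq_le; apply/andP; split.
(* Absence of an atom at [q] allows the half-line to be exhausted from strictly below [q], where the
   mass is less than [tau]. *)
- have -> : mass `]-oo, q] = mass `]-oo, q[.
    by apply/esym; apply: integral_itv_bndo_bndc; exact: mfE.
  suff : mass (\bigcup_n [set` `]-oo, (q - n.+1%:R^-1)%R]]) <= tau%:E.
    apply: le_trans; apply: mass_le => y /=; rewrite in_itv/= => yq.
    have qy : (0 < q - y)%R by rewrite subr_gt0.
    have [n hn] := lt_inv qy.
    by exists n => //=; rewrite in_itv/= lerBrDr addrC -lerBrDr ltW.
  apply: mass_bigcup_le => //.
    apply: nd_left => m n mn; rewrite lerD2l lerN2 lef_pV2 ?posrE//.
    by rewrite ler_nat ltnS.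
  by move=> n; apply/ltW/below; rewrite ltrBlDr ltrDl.
(* The lower bound is obtained through the complement: the mass to the right of [q] is at most
   [1 - tau]. *)
- suff : mass (\bigcup_n [set` `](q + n.+1%:R^-1)%R, +oo[]) <= (1 - tau)%:E.
    move=> h; have {}h : mass `]q, +oo[ <= (1 - tau)%:E.
      apply: le_trans h; apply: mass_le => y /=; rewrite in_itv/= andbT => yq.
      have qy : (0 < y - q)%R by rewrite subr_gt0.
      have [n hn] := lt_inv qy.
      by exists n => //=; rewrite in_itv/= andbT -ltrBrDl.
    move: h (mass_split q).
    rewrite -(fineK (mass_fin `]-oo, q])) -(fineK (mass_fin `]q, +oo[)).
    by rewrite -EFinD !lee_fin => h [] h'; lra.
  apply: mass_bigcup_le => //.
    apply: nd_right => m n mn; rewrite lerD2l lef_pV2 ?posrE//.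
    by rewrite ler_nat ltnS.
  move=> n; have qn : (q < q + n.+1%:R^-1)%R by rewrite ltrDl.
  move: (above _ qn) (mass_split (q + n.+1%:R^-1)%R).
  rewrite -(fineK (mass_fin `]-oo, (q + n.+1%:R^-1)%R])).
  rewrite -(fineK (mass_fin `](q + n.+1%:R^-1)%R, +oo[)).
  by rewrite -EFinD !lee_fin => h [] h'; lra.
Qed.

End density_quantile.

(** * Additive functions and product cells *)

Section additive.
Variables (R : realType) (p : nat).
Notation I01 := [set` `[0%R : R, 1%R]].

Definition addf (a : R) (h : 'I_p -> R -> R) (x : 'I_p -> R) : R :=
  a + \sum_(k < p) h k (x k).

(** One partition serves several functions at once, so that they can be frozen together. It is built
    coordinate by coordinate, which makes its cells rectangles, the sets on which the law of a
    sample is specified. *)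
Definition cell_approx N (F : 'I_N -> ('I_p -> R) -> R) := forall e : R, 0 < e ->
  exists (T : finType) (iota : 'I_p -> R -> T) (r : 'I_p -> T -> R),
  [/\ forall k m, measurable (I01 `&` iota k @^-1` [set m]),
      forall k m, I01 (r k m) &
      forall x, in_cube x -> forall i,
        `|F i (fun k => r k (iota k (x k))) - F i x| <= e].

Lemma addf_cell_approx N (a : 'I_N -> R) (h : 'I_N -> 'I_p -> R -> R) :
  (forall i k, bmeas I01 (h i k)) -> cell_approx (fun i => addf (a i) (h i)).
Proof.
move=> bh e e0.
have [K hK] : exists K, forall i k x, I01 x -> `|h i k x| <= K.
  have /choice[f fP] : forall ik : 'I_N * 'I_p, exists K, 0 < K /\
      forall x, I01 x -> `|h ik.1 ik.2 x| <= K.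
    by move=> ik; have [K K0 hK] := bmeas_ub (bh ik.1 ik.2); exists K.
  exists (\sum_ik f ik) => i k x x01.
  apply: le_trans ((fP (i, k)).2 x x01) _.
  by rewrite (bigD1 (i, k))//= lerDl sumr_ge0// => ik _; exact: ltW (fP ik).1.
(* Each of the [p] summands receives this share of the error; the successor keeps the denominator
   positive. *)
have e0' : 0 < e / p.+1%:R by rewrite divr_gt0.
have [T hT] := @finite_approx R N K _ e0'.
have /choice[f fP] : forall k : 'I_p, exists ir : (R -> T) * (T -> R),
    [/\ forall m, measurable (I01 `&` ir.1 @^-1` [set m]),
      forall m, I01 (ir.2 m) &
      forall x, I01 x -> forall i, `|h i k (ir.2 (ir.1 x)) - h i k x| <= e / p.+1%:R].
  move=> k; have [|i x|iota [r irP]] := hT (fun i => h i k).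
  - by move=> i; case: (bh i k).
  - exact: hK.
  - by exists (iota, r).
exists T, (fun k => (f k).1), (fun k => (f k).2); split.
- by move=> k m; case: (fP k) => + _ _; exact.
- by move=> k m; case: (fP k) => _ + _; exact.
- move=> x x01 i; rewrite /addf opprD addrACA subrr add0r -sumrB.
  apply: le_trans (ler_norm_sum _ _ _) _.
  apply: (@le_trans _ _ (\sum_(k < p) (e / p.+1%:R))).
    by apply: ler_sum => k _; case: (fP k) => _ _; apply; rewrite /= in_itv/=; exact: x01.
  rewrite sumr_const card_ord -[_ *+ p]mulr_natr mulrAC ler_pdivrMr//.
  by rewrite ler_wpM2l ?ltW// ltr_nat.
Qed.

Lemma bmeas_addf d (T : measurableType d) (X : 'I_p -> T -> R) a h :
  (forall k, measurable_fun setT (X k)) -> (forall k w, 0 <= X k w <= 1) ->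
  (forall k, bmeas I01 (h k)) -> bmeas setT (fun w => addf a h (X^~ w)).
Proof.
move=> mX X01 bh; apply: bmeasD; first exact: bmeas_cst.
apply: bmeas_sum => k; have [mh [K hK]] := bh k.
have XI w : I01 (X k w) by rewrite /= in_itv/=; exact: X01.
split; last by exists K => w _; exact: hK.
apply: (@measurable_comp _ _ _ _ _ _ I01) => //.
by move=> _ [w _ <-]; exact: XI.
Qed.

End additive.

(** * Expectations over one sample, computed cell by cell *)

Section one_sample.
Variables (R : realType) (p : nat) (d : measure_display) (Omega : measurableType d).
Variable P : probability Omega R.
Variables (X : 'I_p -> Omega -> R) (Y : Omega -> R).
Variables (pX : ('I_p -> R) -> R) (pYX : ('I_p -> R) -> R -> R).
Variables (tau C1 C2 c1 c2 B : R).
Notation leb := (@lebesgue_measure R).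
Notation I01 := [set` `[0%R : R, 1%R]].

Hypothesis mX : forall k, measurable_fun setT (X k).
Hypothesis mY : measurable_fun setT Y.
Hypothesis X01 : forall k w, 0 <= X k w <= 1.
Hypothesis law : forall (A : 'I_p -> set R) (B : set R),
  (forall k, measurable (A k)) -> measurable B ->
  P (rect_event X Y A B) =
  cube_int (fun x => ((\prod_(k < p) \1_(A k) (x k)) * pX x)%:E *
                      \int[leb]_(y in B) (pYX x y)%:E)%E.
Hypothesis tau01 : 0 < tau < 1.
Hypothesis C10 : 0 < C1.
Hypothesis c10 : 0 < c1.
Hypothesis pXb : forall x, in_cube x -> C1 <= pX x <= C2.
Hypothesis dens : forall x, in_cube x ->
  [/\ measurable_fun setT (pYX x), (forall y, 0 <= pYX x y)
    & (\int[leb]_(y in setT) (pYX x y)%:E = 1)%E].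
Hypothesis densb : forall x y, in_cube x -> - B <= y <= B -> c1 <= pYX x y <= c2.
Hypothesis B0 : 0 <= B.

Let cube0 : in_cube (fun _ : 'I_p => 0 : R).
Proof. by move=> k; rewrite lexx ler01. Qed.

Lemma C12 : C1 <= C2.
Proof. by have /andP[] := pXb cube0; exact: le_trans. Qed.

Lemma c12 : c1 <= c2.
Proof.
have : - B <= 0 <= B by rewrite oppr_le0 B0.
by move=> /(densb cube0)/andP[]; exact: le_trans.
Qed.

Let C20 : 0 < C2. Proof. exact: lt_le_trans C10 C12. Qed.
Let c20 : 0 < c2. Proof. exact: lt_le_trans c10 c12. Qed.

Definition pr (E : set Omega) : R := fine (P E).

Lemma prE E : measurable E -> P E = (pr E)%:E.
Proof. by move=> mE; rewrite fineK// fin_num_measure. Qed.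

Lemma pr_ge0 E : 0 <= pr E.
Proof. exact/fine_ge0/measure_ge0. Qed.

Lemma int_indic_pr E : measurable E -> \int[P]_w \1_E w = pr E.
Proof. by move=> mE; rewrite /Rintegral integral_indic// setIT. Qed.

Notation q := (cond_quantile pYX tau).

(** The cdf equals [tau] at [q x] and its slope lies between [c1] and [c2] as far as [a]; [min] and
    [max] pick the correct extreme slope for either sign of [a - q x]. *)
Lemma cdf_bounds x a : in_cube x -> - B <= q x <= B -> - B <= a <= B ->
  ((tau + Num.min (c1 * (a - q x)) (c2 * (a - q x)))%:E <= cond_cdf pYX x a)%E /\
  (cond_cdf pYX x a <= (tau + Num.max (c1 * (a - q x)) (c2 * (a - q x)))%:E)%E.
Proof.
move=> xc /andP[qB1 qB2] /andP[aB1 aB2]; have [mf f0 f1] := dens xc.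
have qE : mass (pYX x) `]-oo, q x] = tau%:E := quantileE mf f0 f1 tau01.
have lb y : - B <= y <= B -> c1 <= pYX x y by move=> /(densb xc)/andP[].
have ub y : - B <= y <= B -> pYX x y <= c2 by move=> /(densb xc)/andP[].
rewrite -[cond_cdf _ _ _]/(mass (pYX x) `]-oo, a]).
have c1c2 := c12.
have [qa|aq] := leP (q x) a.
  have := mass_itv mf f0 qa; rewrite qE => ->.
  have zz : 0 <= a - q x by rewrite subr_ge0.
  have zc : c1 * (a - q x) <= c2 * (a - q x) by rewrite ler_wpM2r.
  rewrite (min_idPl zc) (max_idPr zc) !EFinD; split; apply: leeD2l.
    apply: mass_lb => //; first exact: ltW.
    by move=> y /andP[y1 y2]; apply: lb; apply/andP; split; lra.
  apply: mass_ub => //; first exact: ltW.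
    by move=> y /=; rewrite !in_itv/= => /andP[/ltW -> ->].
  by move=> y /andP[y1 y2]; apply: ub; apply/andP; split; lra.
have := mass_itv mf f0 (ltW aq); rewrite qE.
have zz : a - q x <= 0 by rewrite subr_le0 ltW.
have zc : c2 * (a - q x) <= c1 * (a - q x) by rewrite ler_wnM2r.
rewrite (min_idPr zc) (max_idPl zc).
have h1 : ((c1 * (q x - a))%:E <= mass (pYX x) `]a, q x])%E.
  apply: mass_lb => //; [exact: ltW..|move=> y /andP[y1 y2]].
  by apply: lb; apply/andP; split; lra.
have h2 : (mass (pYX x) `]a, q x] <= (c2 * (q x - a))%:E)%E.
  apply: mass_ub => //; [exact: ltW..| |].
    by move=> y /=; rewrite !in_itv/= => /andP[/ltW -> ->].
  by move=> y /andP[y1 y2]; apply: ub; apply/andP; split; lra.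
move: h1 h2; rewrite -(fineK (mass_fin f0 f1 `]-oo, a])).
rewrite -(fineK (mass_fin f0 f1 `]a, q x])) -EFinD !lee_fin => h1 h2 [] h3.
by split; nra.
Qed.

Lemma measurable_rect A B' : (forall k, measurable (A k)) -> measurable B' ->
  measurable (rect_event X Y A B').
Proof.
move=> mA mB.
have -> : rect_event X Y A B' =
    (\bigcap_(k in [set: 'I_p]) (setT `&` X k @^-1` A k)) `&` (setT `&` Y @^-1` B').
  apply/seteqP; split => w /=.
    by move=> [wA wB]; split => // k _; split => //; exact: wA.
  by move=> [wA [_ wB]]; split => // k; have [] := wA k I.
apply: measurableI; last exact: mY.
by apply: fin_bigcap_measurable => // k _; exact: mX.
Qed.

Let prodA (A : 'I_p -> set R) x : \prod_(k < p) \1_(A k) (x k) =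
  (if `[< forall k, A k (x k) >] then 1 else 0) :> R.
Proof.
case: asboolP => [h|h].
  by apply: big1 => k _; rewrite indicE mem_set.
have [k hk] : exists k, ~ A k (x k) by apply/existsNP.
by rewrite (bigD1 k)//= indicE memNset// mul0r.
Qed.

Let massT x : in_cube x -> (\int[leb]_(y in setT) (pYX x y)%:E = 1)%E.
Proof. by case/dens. Qed.

Let rect0 A B' x : in_cube x -> (0 <= ((\prod_(k < p) \1_(A k) (x k)) * pX x)%:E *
                      \int[leb]_(y in B') (pYX x y)%:E)%E.
Proof.
move=> xc; have [_ f0 _] := dens xc.
rewrite mule_ge0//; last by apply: integral_ge0 => y _; rewrite lee_fin.
rewrite lee_fin mulr_ge0//; first by apply: prodr_ge0 => k _; rewrite indicE.
by have /andP[+ _] := pXb xc; apply: le_trans; exact: ltW.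
Qed.

(** Replaces integration of a conditional probability over a cell: the bound leaves the lower
    integral as a constant factor. *)
Lemma rect_mass_le A B' c : (forall k, measurable (A k)) -> measurable B' -> 0 <= c ->
  (forall x, in_cube x -> (forall k, A k (x k)) ->
     (\int[leb]_(y in B') (pYX x y)%:E <= c%:E)%E) ->
  pr (rect_event X Y A B') <= c * pr (rect_event X Y A setT).
Proof.
move=> mA mB c0 h; rewrite -lee_fin EFinM -!prE; [|exact: measurable_rect..].
rewrite !law// -cube_intZl//; last by move=> x; exact: rect0.
apply: le_cube_int => x xc; first exact: rect0.
rewrite prodA massT// mule1; case: asboolP => [hA|]; last by rewrite mul0r !mul0e mule0.
rewrite mul1r muleC lee_wpmul2r ?h// lee_fin.
by have /andP[+ _] := pXb xc; apply: le_trans; exact: ltW.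
Qed.

Lemma rect_mass_ge A B' c : (forall k, measurable (A k)) -> measurable B' ->
  (forall x, in_cube x -> (forall k, A k (x k)) ->
     (c%:E <= \int[leb]_(y in B') (pYX x y)%:E)%E) ->
  c * pr (rect_event X Y A setT) <= pr (rect_event X Y A B').
Proof.
(* Scaling the lower integral requires a nonnegative factor; for negative [c] the claim is
   trivial. *)
move=> mA mB h; have [c0|c0] := leP 0 c; last first.
  by apply: (@le_trans _ _ 0); rewrite ?pr_ge0// mulr_le0_ge0 ?pr_ge0// ltW.
rewrite -lee_fin EFinM -!prE; [|exact: measurable_rect..].
rewrite !law// -cube_intZl//; last by move=> x; exact: rect0.
apply: le_cube_int => x xc.
  by rewrite mule_ge0 ?lee_fin//; exact: rect0.
rewrite prodA massT// mule1; case: asboolP => [hA|]; last by rewrite mul0r !mul0e mule0.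
rewrite mul1r muleC [leRHS]muleC; rewrite [leRHS]muleC lee_wpmul2l ?h// lee_fin.
by have /andP[+ _] := pXb xc; apply: le_trans; exact: ltW.
Qed.

Definition vol (A : 'I_p -> set R) : R := \prod_(k < p) len01 (A k).

Let cube_rect A c : (forall k, measurable (A k)) -> 0 <= c ->
  cube_int (fun x => (c * \prod_(k < p) \1_(A k) (x k))%:E) = (c * vol A)%:E.
Proof.
move=> mA c0; have := @cube_int_simple R p 'I_1 (fun=> c) (fun=> A) (fun=> mA) (fun=> c0).
rewrite big_ord1 => <-; apply: eq_cube_int => x _.
by rewrite big_ord1.
Qed.

Lemma rect_vol A : (forall k, measurable (A k)) ->
  C1 * vol A <= pr (rect_event X Y A setT) <= C2 * vol A.
Proof.
move=> mA; have ind0 x : 0 <= \prod_(k < p) \1_(A k) (x k) :> R.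
  by apply: prodr_ge0 => k _; rewrite indicE.
rewrite -!lee_fin -!cube_rect ?(ltW C10) ?(ltW C20)// -prE; last exact: measurable_rect.
rewrite law//; apply/andP; split; apply: le_cube_int => x xc.
- by rewrite lee_fin mulr_ge0// ltW.
- rewrite massT// mule1 lee_fin mulrC ler_wpM2l//.
  by have /andP[] := pXb xc.
- exact: rect0.
- rewrite massT// mule1 lee_fin mulrC ler_wpM2r//.
  by have /andP[] := pXb xc.
Qed.


Let PT := probT_fin P.

Lemma int_indic4 (a1 a2 a3 a4 : R) (S1 S2 S3 S4 : set Omega) :
  measurable S1 -> measurable S2 -> measurable S3 -> measurable S4 ->
  \int[P]_w (a1 * \1_S1 w + a2 * \1_S2 w + a3 * \1_S3 w + a4 * \1_S4 w) =
  a1 * pr S1 + a2 * pr S2 + a3 * pr S3 + a4 * pr S4.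
Proof.
move=> m1 m2 m3 m4.
have b a S : measurable S -> bmeas setT (fun w => a * (\1_S w : R)).
  by move=> mS; apply: bmeasZ; exact: bmeas_indic.
rewrite (bintD measurableT PT); [|do !apply: bmeasD; exact: b|exact: b].
rewrite (bintD measurableT PT); [|do !apply: bmeasD; exact: b|exact: b].
rewrite (bintD measurableT PT); [|exact: b|exact: b].
by rewrite !(bintZ measurableT PT) ?int_indic_pr//; exact: bmeas_indic.
Qed.

Lemma int_indic1 (a : R) (S : set Omega) : measurable S ->
  \int[P]_w (a * \1_S w) = a * pr S.
Proof.
move=> mS; rewrite (bintZ measurableT PT) ?int_indic_pr//.
exact: bmeas_indic.
Qed.

Section cells.
Variables (T : finType) (iota : 'I_p -> R -> T) (r : 'I_p -> T -> R).
Hypothesis miota : forall k m, measurable (I01 `&` iota k @^-1` [set m]).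
Hypothesis r01 : forall k m, I01 (r k m).
Implicit Types m : {ffun 'I_p -> T}.

Definition cell_box m k : set R := I01 `&` iota k @^-1` [set m k].
Definition cell_event m := rect_event X Y (cell_box m) setT.
Definition cell_of (x : 'I_p -> R) : {ffun 'I_p -> T} := [ffun k => iota k (x k)].
Definition cell_rep m : 'I_p -> R := fun k => r k (m k).

Lemma measurable_cell_box m k : measurable (cell_box m k).
Proof. exact: miota. Qed.

Lemma measurable_cell_event m : measurable (cell_event m).
Proof. by apply: measurable_rect => // k; exact: miota. Qed.

Lemma cell_boxP m x : in_cube x -> (forall k, cell_box m k (x k)) <-> cell_of x = m.
Proof.
move=> xc; split => [h|<- k].
  by apply/ffunP => k; rewrite ffunE; have [_] := h k.
by split; rewrite /= ?ffunE// in_itv/=; exact: xc.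
Qed.

Lemma X_in_cube w : in_cube (X^~ w).
Proof. by move=> k; exact: X01. Qed.

Lemma cell_eventP m B' w :
  rect_event X Y (cell_box m) B' w <-> cell_of (X^~ w) = m /\ B' (Y w).
Proof.
split => [[h hB]|[h hB]]; split => //.
  by apply/(cell_boxP _ (X_in_cube w)).
by move=> k; have := (cell_boxP m (X_in_cube w)).2 h; exact.
Qed.

Lemma cell_eventE m w : \1_(cell_event m) w = (cell_of (X^~ w) == m)%:R :> R.
Proof.
rewrite indicE; congr (_%:R); congr nat_of_bool; apply/idP/eqP.
  by rewrite inE => /cell_eventP[].
by move=> h; rewrite inE; apply/cell_eventP.
Qed.

Lemma cell_rep_cube m : in_cube (cell_rep m).
Proof. by move=> k; have := r01 k (m k); rewrite /= in_itv. Qed.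

Lemma cell_sum (g : Omega -> R) : bmeas setT g ->
  \int[P]_w g w = \sum_m \int[P]_w (g w * \1_(cell_event m) w).
Proof.
move=> bg; rewrite -(bint_sum measurableT PT); last first.
  by move=> m; apply: bmeasM => //; exact/bmeas_indic/measurable_cell_event.
apply: eq_Rintegral => w _; rewrite (bigD1 (cell_of (X^~ w)))//=.
rewrite cell_eventE eqxx mulr1 big1 ?addr0// => m mm.
by rewrite cell_eventE eq_sym (negbTE mm) mulr0.
Qed.

Lemma pr_cell_sum : \sum_m pr (cell_event m) = 1.
Proof.
rewrite -[RHS](prob_int_cst P 1) (cell_sum (bmeas_cst setT 1)).
by apply: eq_bigr => m _; rewrite int_indic1 ?mul1r//; exact: measurable_cell_event.
Qed.

Lemma cell_simple (c : {ffun 'I_p -> T} -> R) x : in_cube x ->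
  \sum_m c m * \prod_(k < p) \1_(cell_box m k) (x k) = c (cell_of x).
Proof.
move=> xc; rewrite (bigD1 (cell_of x))//= prodA asboolT ?mulr1; last first.
  exact/cell_boxP.
rewrite big1 ?addr0// => m mm; rewrite prodA asboolF ?mulr0//.
by move=> /(cell_boxP _ xc) E; rewrite E eqxx in mm.
Qed.

(** The constant 1 is integrated in two ways, over the full box and as the sum of the cell
    indicators. *)
Lemma cell_vol_sum : \sum_m vol (cell_box m) = 1.
Proof.
have h := @cube_int_simple R p _ (fun=> 1) cell_box measurable_cell_box (fun=> ler01).
have : cube_int (fun _ : 'I_p -> R => 1%:E) = 1%:E :> \bar R.
  have v1 : vol (fun=> setT) = 1.
    by apply: big1 => k _; rewrite /len01 setTI leb_I01.
  have := @cube_rect (fun=> setT) 1 (fun=> measurableT) ler01.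
  rewrite v1 mulr1 => E; rewrite -[RHS]E; apply: eq_cube_int => x _.
  by rewrite big1 ?mulr1// => k _; rewrite indicE in_setT.
rewrite (@eq_cube_int _ _ _ (fun x => (\sum_m 1 *
    \prod_(k < p) \1_(cell_box m k) (x k))%:E)).
  by rewrite h => -[] <-; apply: eq_bigr => m _; rewrite mul1r.
by move=> x xc; rewrite (cell_simple (fun=> 1)).
Qed.

Lemma vol_ge0 A : 0 <= vol A.
Proof. by apply: prodr_ge0 => k _; exact: len01_ge0. Qed.

End cells.

(* [2 * K * e] bounds the oscillation of [v ^+ 2] on a cell. *)
Lemma second_moment_bounds (v : ('I_p -> R) -> R) K J :
  cell_approx (fun _ : 'I_1 => v) -> (forall x, in_cube x -> `|v x| <= K) ->
  bmeas setT (fun w => v (X^~ w)) ->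
  cube_int (fun x => (v x ^+ 2)%:E) = J%:E ->
  C1 * J <= \int[P]_w (v (X^~ w) ^+ 2) <= C2 * J.
Proof.
move=> va vK bv vJ; set S := \int[P]_w _.
have K0 : 0 <= K by apply: le_trans (vK _ cube0).
suff h e : 0 < e -> S <= C2 * (J + 2 * K * e) + 2 * K * e /\
                     C1 * (J - 2 * K * e) - 2 * K * e <= S.
  (* All errors per unit of [e] add up to this constant. With [e] equal to the supposed gap divided
     by it, the extra 1 makes the error strictly smaller than the gap. *)
  have D0 : 0 < C2 * (2 * K) + 2 * K + C1 * (2 * K) + 1.
    by have := C10; have := C20; nra.
  apply/andP; split; rewrite -subr_ge0 leNgt; apply/negP => lt0.
  - have ge : 0 < (C1 * J - S) / (C2 * (2 * K) + 2 * K + C1 * (2 * K) + 1).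
      by rewrite divr_gt0//; lra.
    have [_] := h _ ge; move: ge; set e := _ / _ => ge.
    have : e * (C2 * (2 * K) + 2 * K + C1 * (2 * K) + 1) = C1 * J - S.
      by rewrite divfK// gt_eqF.
    have := mulr_ge0 (mulr_ge0 (ltW C10) (mulr_ge0 (ler0n _ 2) K0)) (ltW ge).
    have := mulr_ge0 (mulr_ge0 (ltW C20) (mulr_ge0 (ler0n _ 2) K0)) (ltW ge).
    have := mulr_ge0 K0 (ltW ge).
    by lra.
  - have ge : 0 < (S - C2 * J) / (C2 * (2 * K) + 2 * K + C1 * (2 * K) + 1).
      by rewrite divr_gt0//; lra.
    have [+ _] := h _ ge; move: ge; set e := _ / _ => ge.
    have : e * (C2 * (2 * K) + 2 * K + C1 * (2 * K) + 1) = S - C2 * J.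
      by rewrite divfK// gt_eqF.
    have := mulr_ge0 (mulr_ge0 (ltW C10) (mulr_ge0 (ler0n _ 2) K0)) (ltW ge).
    have := mulr_ge0 (mulr_ge0 (ltW C20) (mulr_ge0 (ler0n _ 2) K0)) (ltW ge).
    have := mulr_ge0 K0 (ltW ge).
    by lra.
move=> e0; have [T [iota [r [mi r01 ap]]]] := va e e0.
pose vm m := v (cell_rep r m).
have vmK m : `|vm m| <= K by apply/vK/cell_rep_cube.
have osc x : in_cube x -> `|v x ^+ 2 - vm (cell_of iota x) ^+ 2| <= 2 * K * e.
  move=> xc; have := ap x xc ord0.
  have -> : v (fun k => r k (iota k (x k))) = vm (cell_of iota x).
    by congr v; apply/funext => k; rewrite /cell_rep ffunE.
  move=> h; rewrite subr_sqr normrM mulrC ler_pM//.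
    apply: le_trans (ler_normD _ _) _; rewrite (_ : 2 * K = K + K); last by ring.
    exact: lerD (vK _ xc) (vmK _).
  by rewrite distrC.
(* The same step function is summed against cell volumes and against cell probabilities; the density
   bounds compare the two sums cell by cell. *)
pose SV := \sum_m vm m ^+ 2 * vol (cell_box iota m).
pose SP := \sum_m vm m ^+ 2 * pr (cell_event iota m).
have SP1 : C1 * SV <= SP.
  rewrite mulr_sumr; apply: ler_sum => m _; rewrite mulrCA ler_wpM2l ?sqr_ge0//.
  by have /andP[] := rect_vol (measurable_cell_box mi m).
have SP2 : SP <= C2 * SV.
  rewrite mulr_sumr; apply: ler_sum => m _; rewrite mulrCA ler_wpM2l ?sqr_ge0//.
  by have /andP[] := rect_vol (measurable_cell_box mi m).
have Ke0 : 0 <= 2 * K * e := mulr_ge0 (mulr_ge0 (ler0n _ 2) K0) (ltW e0).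
have mE m := measurable_cell_event mi m.
have bvE m : bmeas setT (fun w => v (X^~ w) ^+ 2 * \1_(cell_event iota m) w).
  by apply: bmeasM; [exact: bmeas_sqr|exact: bmeas_indic].
have bcE a m : bmeas setT (fun w => a * \1_(cell_event iota m) w : R).
  by apply: bmeasZ; exact: bmeas_indic.
have SS1 : S <= SP + 2 * K * e.
  rewrite /S (cell_sum mi (bmeas_sqr bv)) -[X in _ + X]mulr1 -[X in _ + _ * X](pr_cell_sum mi).
  rewrite mulr_sumr -big_split/=; apply: ler_sum => m _.
  rewrite -mulrDl -int_indic1//; apply: (le_bint measurableT PT) => // w _.
  rewrite cell_eventE; case: eqP => [wm|_]; last by rewrite !mulr0.
  rewrite !mulr1; have := osc _ (X_in_cube w); rewrite wm ler_norml => /andP[_ h].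
  by lra.
have SS2 : SP - 2 * K * e <= S.
  rewrite /S (cell_sum mi (bmeas_sqr bv)) -[X in _ - X]mulr1 -[X in _ - _ * X](pr_cell_sum mi).
  rewrite mulr_sumr -sumrB; apply: ler_sum => m _.
  rewrite -mulrBl -int_indic1//; apply: (le_bint measurableT PT) => // w _.
  rewrite cell_eventE; case: eqP => [wm|_]; last by rewrite !mulr0.
  rewrite !mulr1; have := osc _ (X_in_cube w); rewrite wm ler_norml => /andP[h _].
  by lra.
have JJ1 : J <= SV + 2 * K * e.
  have -> : SV + 2 * K * e = \sum_m (vm m ^+ 2 + 2 * K * e) * vol (cell_box iota m).
    under [RHS]eq_bigr do rewrite mulrDl.
    by rewrite big_split/= -mulr_sumr (cell_vol_sum mi) mulr1.
  rewrite -lee_fin -(cube_int_simple (measurable_cell_box mi)); last first.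
    by move=> m; rewrite addr_ge0 ?sqr_ge0.
  rewrite -vJ; apply: le_cube_int => x xc; rewrite lee_fin ?sqr_ge0//.
  rewrite (cell_simple iota (fun m => vm m ^+ 2 + 2 * K * e) xc).
  by have := osc x xc; rewrite ler_norml => /andP[_ h]; lra.
have JJ2 : SV - 2 * K * e <= J.
  (* The minorant is truncated at 0 because the iterated integral of a step function was computed
     for nonnegative weights. *)
  apply: (@le_trans _ _ (\sum_m Num.max 0 (vm m ^+ 2 - 2 * K * e) * vol (cell_box iota m))).
    have -> : SV - 2 * K * e = \sum_m (vm m ^+ 2 - 2 * K * e) * vol (cell_box iota m).
      under [RHS]eq_bigr do rewrite mulrBl.
      by rewrite sumrB -mulr_sumr (cell_vol_sum mi) mulr1.
    by apply: ler_sum => m _; rewrite ler_wpM2r ?vol_ge0// le_max lexx orbT.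
  have mx0 m : 0 <= Num.max 0 (vm m ^+ 2 - 2 * K * e) by rewrite le_max lexx.
  rewrite -lee_fin -(cube_int_simple (measurable_cell_box mi) mx0).
  rewrite -vJ; apply: le_cube_int => x xc;
    rewrite (cell_simple iota (fun m => Num.max 0 (vm m ^+ 2 - 2 * K * e)) xc) lee_fin//.
  rewrite ge_max sqr_ge0/=.
  by have := osc x xc; rewrite ler_norml => /andP[h _]; lra.
have : C2 * SV <= C2 * (J + 2 * K * e) by rewrite ler_wpM2l ?(ltW C20)//; lra.
have : C1 * (J - 2 * K * e) <= C1 * SV by rewrite ler_wpM2l ?(ltW C10)//; lra.
by split; lra.
Qed.


(** The largest value of [- c * z] over slopes [c] in [[c1, c2]]. With [z = (u - q) * v] it bounds
    the conditional mean of [(tau - (Y <= u)) * v], whose slope is known only up to this range. *)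
Definition gmax (z : R) : R := Num.max (- c1 * z) (- c2 * z).

Lemma gmax_lip z z' : gmax z <= gmax z' + c2 * `|z - z'|.
Proof.
have c1c2 := c12; have zz : 0 <= `|z - z'| by [].
have l1 := ler_norm (z' - z); rewrite distrC in l1.
have h c : 0 < c -> c <= c2 -> - c * z <= - c * z' + c2 * `|z - z'|.
  move=> c0 cc; have : c * `|z - z'| <= c2 * `|z - z'| by rewrite ler_wpM2r.
  have : c * (z' - z) <= c * `|z - z'| by rewrite ler_wpM2l// ltW.
  lra.
rewrite /gmax ge_max; apply/andP; split.
  by apply: le_trans (h _ c10 c1c2) _; rewrite lerD2r le_max lexx.
by apply: le_trans (h _ c20 (lexx _)) _; rewrite lerD2r le_max lexx orbT.
Qed.

(** Multiplying by a negative [v] reverses inequalities, so the lower bound on [P1] serves for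
    [v >= 0] and the upper bound for [v < 0]; both lead to [gmax]. *)
Lemma gradient_cell (v z P0 P1 e K : R) : 0 <= P0 -> 0 <= e -> `|v| <= K ->
  (tau + Num.min (c1 * z) (c2 * z) - c2 * e) * P0 <= P1 ->
  P1 <= (tau + Num.max (c1 * z) (c2 * z) + c2 * e) * P0 ->
  v * tau * P0 - v * P1 <= (gmax (z * v) + K * c2 * e) * P0.
Proof.
move=> P00 e0 vK h1 h2; have ce : 0 <= c2 * e by rewrite mulr_ge0// ltW.
have [v0|v0] := leP 0 v.
  rewrite (ger0_norm v0) in vK.
  have gE : gmax (z * v) = - (v * Num.min (c1 * z) (c2 * z)).
    rewrite /gmax minr_pMr// oppr_min; congr Num.max; ring.
  rewrite gE.
  have := ler_wpM2l v0 h1.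
  have : v * (c2 * e) * P0 <= K * (c2 * e) * P0 by rewrite ler_wpM2r// ler_wpM2r.
  lra.
rewrite (ltr0_norm v0) in vK.
have gE : gmax (z * v) = (- v) * Num.max (c1 * z) (c2 * z).
  by rewrite /gmax maxr_pMr ?oppr_ge0 ?(ltW v0)//; congr Num.max; ring.
rewrite gE; have nv0 : 0 <= - v by rewrite oppr_ge0 ltW.
have := ler_wpM2l nv0 h2.
have : (- v) * (c2 * e) * P0 <= K * (c2 * e) * P0 by rewrite ler_wpM2r// ler_wpM2r.
lra.
Qed.

Lemma gradient_le (u v : ('I_p -> R) -> R) K :
  cell_approx (fun i : 'I_3 => nth u [:: u; q; v] i) ->
  (forall x, in_cube x -> - B <= u x <= B) ->
  (forall x, in_cube x -> - B <= q x <= B) ->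
  (forall x, in_cube x -> `|v x| <= K) ->
  bmeas setT (fun w => u (X^~ w)) -> bmeas setT (fun w => q (X^~ w)) ->
  bmeas setT (fun w => v (X^~ w)) ->
  \int[P]_w ((tau - (Y w <= u (X^~ w))%R%:R) * v (X^~ w)) <=
  \int[P]_w gmax ((u (X^~ w) - q (X^~ w)) * v (X^~ w)).
Proof.
move=> ap uB qB vK bu bq bv.
have K0 : 0 <= K by apply: le_trans (vK _ cube0).
pose f w := (tau - (Y w <= u (X^~ w))%R%:R) * v (X^~ w).
pose G w := gmax ((u (X^~ w) - q (X^~ w)) * v (X^~ w)).
have bf : bmeas setT f.
  apply: bmeasM => //; apply: bmeasB; first exact: bmeas_cst.
  by apply: bmeas_bool; apply: measurable_fun_ler => //; case: bu.
have bG : bmeas setT G.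
  by apply: bmeas_max; apply: bmeasZ; apply: bmeasM => //; exact: bmeasB.
rewrite -/(\int[P]_w f w) -/(\int[P]_w G w).
(* The four terms are the costs of freezing [v], of moving [q] inside the cdf bounds, of the window
   where the test may change, and of the oscillation of [gmax]. *)
pose D := 1 + K * c2 + K * (c2 * 2) + c2 * (2 * K + 2 * B).
have D0 : 0 < D.
  have := mulr_ge0 K0 (ltW c20); have := mulr_ge0 B0 (ltW c20); rewrite /D; lra.
suff h e : 0 < e -> \int[P]_w f w <= \int[P]_w G w + D * e.
  apply/ler_addgt0Pr => e e0; have := h (e / D) (divr_gt0 e0 D0).
  by rewrite mulrC divfK ?gt_eqF.
move=> e0; have [T [iota [r [mi r01 hap]]]] := ap e e0.
pose um m := u (cell_rep r m); pose qm m := q (cell_rep r m).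
pose vm m := v (cell_rep r m).
have repE x : (fun k => r k (iota k (x k))) = cell_rep r (cell_of iota x).
  by apply/funext => k; rewrite /cell_rep ffunE.
have uo x : in_cube x -> `|um (cell_of iota x) - u x| <= e.
  by move=> xc; have := hap x xc (@Ordinal 3 0 isT); rewrite /= repE.
have qo x : in_cube x -> `|qm (cell_of iota x) - q x| <= e.
  by move=> xc; have := hap x xc (@Ordinal 3 1 isT); rewrite /= repE.
have vo x : in_cube x -> `|vm (cell_of iota x) - v x| <= e.
  by move=> xc; have := hap x xc (@Ordinal 3 2 isT); rewrite /= repE.
have mc m : in_cube (cell_rep r m) by exact: cell_rep_cube.
have mb m := measurable_cell_box mi m.
have mE m : measurable (cell_event iota m) := measurable_cell_event mi m.
rewrite (cell_sum mi bf) (cell_sum mi bG) -[X in _ + X]mulr1.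
rewrite -[X in _ + _ * X](pr_cell_sum mi) mulr_sumr -big_split/=.
apply: ler_sum => m _.
have /andP[umB1 umB2] := uB _ (mc m); rewrite -/(um m) in umB1 umB2.
have qmB := qB _ (mc m); rewrite -/(qm m) in qmB.
have vmK := vK _ (mc m); rewrite -/(vm m) in vmK.
(* The window around [um m] is clipped to [[- B, B]], where the density is at most [c2]. Nothing is
   lost, since [u] and [um m] both lie there and a [Y] on which the tests disagree lies between
   them. *)
pose a := Num.max (- B) (um m - e); pose b := Num.min B (um m + e).
have ab : a <= b.
  by rewrite /a /b ge_max !le_min; apply/andP; split; apply/andP; split; lra.
have a1 : - B <= a by rewrite le_max lexx.
have a2 : um m - e <= a by rewrite le_max lexx orbT.
have b1 : b <= B by rewrite ge_min lexx.
have b2 : b <= um m + e by rewrite ge_min lexx orbT.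
pose Ele := rect_event X Y (cell_box iota m) `]-oo, um m].
pose Eb := rect_event X Y (cell_box iota m) `[a, b].
have mEle : measurable Ele by exact: measurable_rect.
have mEb : measurable Eb by exact: measurable_rect.
have prEb : pr Eb <= c2 * 2 * e * pr (cell_event iota m).
  apply: rect_mass_le => //; first by rewrite !mulr_ge0 ?(ltW c20) ?(ltW e0).
  move=> x xc _; have [mf f0 f1] := dens xc.
  apply: (@le_trans _ _ (c2 * (b - a))%:E).
    apply: (mass_ub f0 ab (ltW c20)) => // y /andP[y1 y2].
    have yB : - B <= y <= B by apply/andP; split; lra.
    by have /andP[] := densb xc yB.
  by rewrite lee_fin -mulrA ler_wpM2l ?(ltW c20)//; lra.
have boxq x : in_cube x -> (forall k, cell_box iota m k (x k)) -> `|qm m - q x| <= e.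
  by move=> xc /(cell_boxP _ _ xc) <-; exact: qo.
have cq c x : 0 < c -> c <= c2 -> `|qm m - q x| <= e ->
    `|c * (um m - q x) - c * (um m - qm m)| <= c2 * e.
  move=> c0 cc h; rewrite -mulrBr normrM (gtr0_norm c0).
  rewrite (_ : um m - q x - (um m - qm m) = qm m - q x); last by ring.
  by apply: ler_pM => //; exact: ltW.
have umB : - B <= um m <= B by apply/andP.
have prEle1 : (tau + Num.min (c1 * (um m - qm m)) (c2 * (um m - qm m)) - c2 * e) *
    pr (cell_event iota m) <= pr Ele.
  apply: rect_mass_ge => // x xc xb.
  have [+ _] := cdf_bounds xc (qB _ xc) umB; apply: le_trans.
  rewrite lee_fin; have qe := boxq x xc xb.
  have := cq c1 x c10 c12 qe; have := cq c2 x c20 (lexx _) qe.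
  rewrite !ler_norml => /andP[h1 h2] /andP[h3 h4].
  rewrite -addrA lerD2l le_min; apply/andP; split; rewrite lerBlDr ge_min; apply/orP.
    by left; lra.
  by right; lra.
have prEle2 : pr Ele <= (tau + Num.max (c1 * (um m - qm m)) (c2 * (um m - qm m)) + c2 * e) *
    pr (cell_event iota m).
  apply: rect_mass_le => //.
    have [_ ub] := cdf_bounds (mc m) (qB _ (mc m)) umB.
    apply: addr_ge0; last by rewrite mulr_ge0 ?(ltW c20) ?(ltW e0).
    rewrite -lee_fin; apply: le_trans ub.
    by apply: integral_ge0 => y _; rewrite lee_fin; case: (dens (mc m)).
  move=> x xc xb; have [_ ub] := cdf_bounds xc (qB _ xc) umB; apply: le_trans ub _.
  rewrite lee_fin; have qe := boxq x xc xb.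
  have := cq c1 x c10 c12 qe; have := cq c2 x c20 (lexx _) qe.
  rewrite !ler_norml => /andP[h1 h2] /andP[h3 h4].
  rewrite -addrA lerD2l ge_max; apply/andP; split; rewrite -lerBlDr le_max; apply/orP.
    by left; lra.
  by right; lra.
(* The residual has modulus at most 1, so replacing [v] by [vm m] costs at most [e]; replacing the
   test costs at most [K], and only on [Eb]. *)
have IF : \int[P]_w (f w * \1_(cell_event iota m) w) <=
    vm m * tau * pr (cell_event iota m) + (- vm m) * pr Ele +
    e * pr (cell_event iota m) + K * pr Eb.
  rewrite -int_indic4//; apply: (le_bint measurableT PT).
  - by apply: bmeasM => //; exact: bmeas_indic.
  - by do !apply: bmeasD; apply: bmeasZ; exact: bmeas_indic.
  move=> w _; rewrite cell_eventE.
  have -> : \1_Ele w = ((cell_of iota (X^~ w) == m) && (Y w <= um m))%:R :> R.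
    rewrite indicE; congr (_%:R); congr nat_of_bool; apply/idP/andP.
      by rewrite inE => /cell_eventP[/eqP ? /=]; rewrite in_itv.
    by move=> [/eqP h1 h2]; rewrite inE; apply/cell_eventP; split => //=; rewrite in_itv.
  have -> : \1_Eb w = ((cell_of iota (X^~ w) == m) && (a <= Y w <= b))%:R :> R.
    rewrite indicE; congr (_%:R); congr nat_of_bool; apply/idP/andP.
      by rewrite inE => /cell_eventP[/eqP ? /=]; rewrite in_itv.
    by move=> [/eqP h1 h2]; rewrite inE; apply/cell_eventP; split => //=; rewrite in_itv.
  case: eqP => [wm|_] /=; last by rewrite !mulr0 !addr0.
  rewrite !mulr1 /f; have wc := X_in_cube w.
  have := uo _ wc; have := vo _ wc; rewrite wm !ler_norml => /andP[v1 v2] /andP[u1 u2].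
  have /andP[uw1 uw2] := uB _ wc; have /andP[t0 t1] := tau01.
  have /andP[k1 k2] : - K <= vm m <= K by rewrite -ler_norml.
  have K0' := K0.
  case: (leP (Y w) (u (X^~ w))) => Yu; case: (leP (Y w) (um m)) => Yum;
    rewrite /= ?mulr1 ?mulr0.
  - case: (_ && _) => /=; nra.
  - have -> : a <= Y w <= b.
      by rewrite /a /b ge_max le_min; apply/andP; split; apply/andP; split; lra.
    by rewrite /=; nra.
  - have -> : a <= Y w <= b.
      by rewrite /a /b ge_max le_min; apply/andP; split; apply/andP; split; lra.
    by rewrite /=; nra.
  - case: (_ && _) => /=; nra.
have IG : (gmax ((um m - qm m) * vm m) - c2 * (2 * K + 2 * B) * e) *
    pr (cell_event iota m) <= \int[P]_w (G w * \1_(cell_event iota m) w).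
  rewrite -int_indic1//; apply: (le_bint measurableT PT).
  - by apply: bmeasZ; exact: bmeas_indic.
  - by apply: bmeasM => //; exact: bmeas_indic.
  move=> w _; rewrite cell_eventE; case: eqP => [wm|_]; last by rewrite !mulr0.
  rewrite !mulr1 lerBlDr; have wc := X_in_cube w.
  apply: le_trans (gmax_lip _ ((u (X^~ w) - q (X^~ w)) * v (X^~ w))) _.
  rewrite lerD2l -mulrA ler_wpM2l ?(ltW c20)//.
  have := uo _ wc; have := vo _ wc; have := qo _ wc; rewrite wm => h1 h2 h3.
  set z := u _ - q _; set vw := v (X^~ w).
  rewrite (_ : _ - _ = (um m - qm m - z) * vw + (um m - qm m) * (vm m - vw)); last by ring.
  apply: le_trans (ler_normD _ _) _; rewrite !normrM mulrDl.
  apply: lerD.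
    rewrite (_ : 2 * K * e = (2 * e) * K); last by ring.
    apply: ler_pM => //; last exact: vK.
    rewrite (_ : um m - qm m - z = (um m - u (X^~ w)) - (qm m - q (X^~ w))); last first.
      by rewrite /z; ring.
    apply: le_trans (ler_normB _ _) _; rewrite (_ : 2 * e = e + e); last by ring.
    exact: lerD.
  apply: ler_pM => //.
  move: qmB => /andP[q1 q2]; rewrite ler_norml; apply/andP; split; lra.
have := gradient_cell (pr_ge0 (cell_event iota m)) (ltW e0) vmK prEle1 prEle2.
have := ler_wpM2l K0 prEb.
move: IF IG; rewrite /D.
set P0 := pr (cell_event iota m); set P1 := pr Ele; set P2 := pr Eb.
set IFF := \int[P]_w _; set IGG := \int[P]_w _; set gg := gmax _.
by lra.
Qed.

End one_sample.

Lemma cvgn_sum (R : realType) (I : Type) (r : seq I) (f : I -> nat -> R) (l : I -> R) :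
  (forall i, f i @ \oo --> l i) ->
  (fun n => \sum_(i <- r) f i n) @ \oo --> \sum_(i <- r) l i.
Proof.
move=> fl; elim: r => [|i r ih].
  rewrite big_nil (_ : (fun n => _) = (fun=> 0)); first exact: cvg_cst.
  by apply/funext => n; rewrite big_nil.
rewrite big_cons (_ : (fun n => _) = (fun n => f i n + \sum_(j <- r) f j n)).
  by apply: cvgD; [exact: fl|exact: ih].
by apply/funext => n; rewrite big_cons.
Qed.

(** * Coefficient vectors as finite families *)

Section coefficients.
Variables (R : realType) (p : nat).
Implicit Types (c : coef R p) (J : nat).

(** [None] is the intercept. Flattening the coefficients into one finite family turns [qhat],
    [l1norm] and [sqdist] into plain sums, to which the projection lemmas apply. *)
Definition idx J : finType := option ('I_p * 'I_J).

Definition cidx J c (i : idx J) : R :=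
  if i is Some kj then c.2 kj.1 (kj.2 : nat) else c.1.

Definition Psi (psi : 'I_p -> nat -> R -> R) J (x : 'I_p -> R) (i : idx J) : R :=
  if i is Some kj then psi kj.1 (kj.2 : nat) (x kj.1) else 1.

Definition subc c c' : coef R p :=
  (c.1 - c'.1, fun k j => c.2 k j - c'.2 k j).

Lemma sum_idx J (F : idx J -> R) :
  \sum_i F i = F None + \sum_(k < p) \sum_(j < J) F (Some (k, j)).
Proof.
rewrite (bigD1 None)//= pair_big/=; congr (_ + _).
rewrite (reindex_omap Some id)/=; last by case.
by apply: eq_big => [[k j]|[k j] _] //=; rewrite eqxx.
Qed.

Lemma qhatE psi J c x : qhat psi J c x = \sum_(i : idx J) cidx c i * Psi psi x i :> R.
Proof. by rewrite (sum_idx (J := J)) /= mulr1. Qed.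

Lemma qhat_subc psi J c c' x :
  qhat psi J (subc c c') x = qhat psi J c x - qhat psi J c' x.
Proof.
rewrite !qhatE -sumrB; apply: eq_bigr => -[kj|] _ /=; rewrite ?mulr1//.
by rewrite mulrBl.
Qed.

Lemma l1normE J c : l1norm J c = \sum_i `|cidx (J := J) c i|.
Proof. by rewrite sum_idx. Qed.

Lemma sqdistE J c c' :
  sqdist J c c' = \sum_i (cidx (J := J) c i - cidx c' i) ^+ 2.
Proof. by rewrite sum_idx. Qed.

Definition of_idx J (u : idx J -> R) : coef R p :=
  (u None, fun k j => if insub j is Some j' then u (Some (k, j')) else 0).

Lemma of_idxK J (u : idx J -> R) i : cidx (of_idx u) i = u i.
Proof. by case: i => [[k j]|]//=; rewrite valK. Qed.

Lemma of_idx_supported J (u : idx J -> R) : supported J (of_idx u).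
Proof.
by move=> k j Jj /=; case: insubP => //= j' jJ _; rewrite ltnNge Jj in jJ.
Qed.

Lemma is_l1ball_proj_l1proj J Rad v w : is_l1ball_proj J Rad v w ->
  l1proj Rad (cidx (J := J) v) (cidx w).
Proof.
move=> [_ wR wmin]; split; first by rewrite -l1normE.
move=> u uR; rewrite -sqdistE.
have -> : \sum_i (cidx v i - u i) ^+ 2 = sqdist J v (of_idx u).
  by rewrite sqdistE; apply: eq_bigr => i _; rewrite of_idxK.
apply: wmin; first exact: of_idx_supported.
by rewrite l1normE; under eq_bigr do rewrite of_idxK.
Qed.

Lemma cidx_tilde psi tau J nt gam X Y th (i : idx J) :
  cidx (pfgd_tilde psi tau J nt gam X Y th) i = cidx th i +
  gam * ((nt%:R)^-1 * \sum_(l < nt)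
    (tau - (Y l <= qhat psi J th (X l))%R%:R) * Psi psi (X l) i).
Proof.
case: i => [[k j]|] /=; first by rewrite ltn_ord.
by congr (_ + _ * (_ * _)); apply: eq_bigr => l _; rewrite mulr1.
Qed.

Lemma cidx_le J c Rad (i : idx J) : l1norm J c <= Rad -> `|cidx c i| <= Rad.
Proof.
rewrite l1normE; apply: le_trans.
by rewrite (bigD1 i)//= lerDl sumr_ge0.
Qed.

(** Non-expansiveness removes the projection and the remaining square is expanded exactly. The last
    term stays a double sum over the batch because diagonal and off-diagonal pairs are bounded
    differently. *)
Lemma projection_step psi tau J nt gam X Y th w Rad ths :
  is_l1ball_proj J Rad (pfgd_tilde psi tau J nt gam X Y th) w ->
  l1norm J ths <= Rad ->
  \sum_i (cidx (J := J) w i - cidx ths i) ^+ 2 <=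
  \sum_i (cidx (J := J) th i - cidx ths i) ^+ 2 +
  2 * gam * (nt%:R^-1 * \sum_(l < nt)
    (tau - (Y l <= qhat psi J th (X l))%R%:R) * qhat psi J (subc th ths) (X l)) +
  gam ^+ 2 * (nt%:R^-1 ^+ 2 * \sum_(l < nt) \sum_(l' < nt) \sum_(i : idx J)
    ((tau - (Y l <= qhat psi J th (X l))%R%:R) * Psi psi (X l) i) *
    ((tau - (Y l' <= qhat psi J th (X l'))%R%:R) * Psi psi (X l') i)).
Proof.
move=> pr tR; rewrite l1normE in tR.
apply: le_trans (l1proj_nonexp (is_l1ball_proj_l1proj pr) tR) _.
under eq_bigr do rewrite cidx_tilde.
pose r l := tau - (Y l <= qhat psi J th (X l))%R%:R : R.
have E1 : \sum_(l < nt) r l * qhat psi J (subc th ths) (X l) =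
    \sum_i (cidx (J := J) th i - cidx ths i) * \sum_(l < nt) r l * Psi psi (X l) i.
  under [RHS]eq_bigr do rewrite mulr_sumr.
  rewrite [RHS]exchange_big/=; apply: eq_bigr => l _.
  rewrite qhatE mulr_sumr; apply: eq_bigr => i _.
  by rewrite mulrCA; congr (_ * _); case: i.
have E2 : \sum_(l < nt) \sum_(l' < nt) \sum_(i : idx J)
    (r l * Psi psi (X l) i) * (r l' * Psi psi (X l') i) =
    \sum_(i : idx J) (\sum_(l < nt) r l * Psi psi (X l) i) ^+ 2.
  under [RHS]eq_bigr do rewrite expr2 big_distrl/=.
  rewrite [RHS]exchange_big/=; apply: eq_bigr => l _.
  under [RHS]eq_bigr do rewrite big_distrr/=.
  by rewrite [RHS]exchange_big.
rewrite [X in 2 * gam * (_ * X)]E1 [X in gam ^+ 2 * (_ * X)]E2.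
rewrite le_eqVlt; apply/orP; left; apply/eqP.
rewrite !mulr_sumr -!big_split/=; apply: eq_bigr => i _.
by rewrite /r; ring.
Qed.

End coefficients.

(** * The target quantile function and the error in coefficient form *)

Section population.
Variables (R : realType) (p : nat) (psi : 'I_p -> nat -> R -> R) (M Rad alpha tau : R).
Variables (theta_star : 'I_p -> nat -> R) (pYX : ('I_p -> R) -> R -> R).
Notation leb := (@lebesgue_measure R).
Notation I01 := [set` `[0%R : R, 1%R]].
Hypothesis onb : centered_onb_bounded psi M.
Hypothesis M1 : 1 <= M.
Hypothesis l1star : forall n, `|alpha| + \sum_(k < p) \sum_(j < n) `|theta_star k j| <= Rad.
Notation q := (cond_quantile pYX tau).
Hypothesis qE : forall x, in_cube x ->
  q x = alpha + \sum_(k < p) limn (series (fun j => theta_star k j * psi k j (x k))).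
Implicit Types (th : coef R p) (J : nat).

Lemma psi_meas k j : measurable_fun I01 (psi k j).
Proof. by case: (onb k). Qed.

Lemma psi_bound k j x : I01 x -> `|psi k j x| <= M.
Proof. by rewrite /= in_itv/= => x01; case: (onb k) => _ _ _ _; exact. Qed.

Lemma psi_int0 k j : \int[leb]_(x in I01) psi k j x = 0.
Proof. by rewrite /Rintegral; case: (onb k) => _ -> _ _ _. Qed.

Lemma psi_orth k j l : \int[leb]_(x in I01) (psi k j x * psi k l x) = (j == l)%:R.
Proof. by rewrite /Rintegral; case: (onb k) => _ _ -> _ _. Qed.

Lemma psi_bmeas k j : bmeas I01 (psi k j).
Proof. by split; [exact: psi_meas|exists M => x; exact: psi_bound]. Qed.

Let M0 : 0 <= M. Proof. exact: le_trans M1. Qed.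

Lemma Rad0 : 0 <= Rad.
Proof.
by have := l1star 0; apply: le_trans; rewrite addr_ge0// sumr_ge0// => k _; rewrite big_ord0.
Qed.

Definition ths : coef R p := (alpha, theta_star).

Lemma ths_l1norm J : l1norm J ths <= Rad.
Proof. exact: l1star. Qed.

Lemma star_l1bound k : l1bound (theta_star k) Rad.
Proof.
move=> n; apply: le_trans (l1star n); rewrite (bigD1 k)//=.
by rewrite addrCA lerDl addr_ge0// sumr_ge0// => i _; rewrite sumr_ge0.
Qed.

Lemma qhat_bound J th x : l1norm J th <= Rad -> in_cube x ->
  - (M * Rad) <= qhat psi J th x <= M * Rad.
Proof.
move=> thR xc; rewrite -ler_norml qhatE.
apply: le_trans (ler_norm_sum _ _ _) _.
apply: (@le_trans _ _ (M * l1norm J th)); last by rewrite ler_wpM2l.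
rewrite l1normE mulr_sumr; apply: ler_sum => i _.
rewrite normrM mulrC ler_wpM2r//; case: i => [[k j]|] /=; last by rewrite normr1.
by apply: psi_bound; rewrite /= in_itv/=; exact: xc.
Qed.

Definition gq k := serfun (psi k) (theta_star k).

Lemma q_addf x : in_cube x -> q x = addf alpha gq x.
Proof. exact: qE. Qed.

Lemma gq_bmeas k : bmeas I01 (gq k).
Proof. exact: (bmeas_serfun (psi_meas k) (@psi_bound k) (star_l1bound k)). Qed.

Definition qhat_part J th k (y : R) := \sum_(j < J) th.2 k j * psi k j y.

Lemma qhat_addf J th x : qhat psi J th x = addf th.1 (qhat_part J th) x.
Proof. by []. Qed.

Lemma qhat_part_bmeas J th k : bmeas I01 (qhat_part J th k).
Proof. by apply: bmeas_sum => j; apply: bmeasZ; exact: psi_bmeas. Qed.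

Lemma qhat_cvg_q x : in_cube x -> (fun n => qhat psi n ths x) @ \oo --> q x.
Proof.
move=> xc; rewrite q_addf// /qhat /=.
apply: cvgD; first exact: cvg_cst.
apply: cvgn_sum => k.
apply: (serfun_cvg (@psi_bound k) (star_l1bound k)).
by rewrite /= in_itv/=; exact: xc.
Qed.

(** The quantile is the pointwise limit of truncated expansions, each with coefficients in the l1
    ball. It therefore lies in the range where the conditional density is controlled. *)
Lemma q_bound x : in_cube x -> - (M * Rad) <= q x <= M * Rad.
Proof.
move=> xc; have h := qhat_cvg_q xc.
have hb n := andP (qhat_bound (ths_l1norm n) xc).
apply/andP; rewrite -(cvg_lim (@Rhausdorff R) h); split.
  by apply: limr_ge; [exact: cvgP h|apply: nearW => n; case: (hb n)].
by apply: limr_le; [exact: cvgP h|apply: nearW => n; case: (hb n)].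
Qed.

Definition tailc J k j : R := if (j < J)%N then 0 else theta_star k j.

Lemma tailc_l1bound J k : l1bound (tailc J k) Rad.
Proof.
move=> n; apply: le_trans (star_l1bound k n); apply: ler_sum => j _.
by rewrite /tailc; case: ifP => // _; rewrite normr0.
Qed.

Definition tail J : R := \sum_(k < p) sqsum (tailc J k).

Lemma tail_ge0 J : 0 <= tail J.
Proof. by apply: sumr_ge0 => k _; exact: (sqsum_ge0 (tailc_l1bound J k)). Qed.

(** The squared L2 distance to the quantile function, by Parseval. It does not refer to a truncation
    dimension, so padding the iterate with zeros leaves it unchanged. *)
Definition err th : R := (th.1 - alpha) ^+ 2 +
  \sum_(k < p) sqsum (fun j => th.2 k j - theta_star k j).

Lemma th_l1bound J th k : supported J th ->
  l1bound (th.2 k) (\sum_(j < J) `|th.2 k j|).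
Proof. by move=> sJ; apply: l1bound_fin => j; exact: sJ. Qed.

Let dbound J th k (sJ : supported J th) :=
  l1boundB (th_l1bound k sJ) (star_l1bound k).

(** Beyond [J] the coefficients of [th] vanish and only those of [theta_star] remain. The algorithm
    acts on the finite part alone. *)
Lemma err_split J th : supported J th ->
  err th = \sum_i (cidx (J := J) th i - cidx ths i) ^+ 2 + tail J.
Proof.
move=> sJ; rewrite sum_idx/= /err /tail -addrA; congr (_ + _).
rewrite -big_split/=; apply: eq_bigr => k _.
rewrite (sqsum_split J (dbound k sJ)); congr (_ + _).
rewrite /sqsum; congr (limn (series _)); apply/funext => j.
rewrite /tailc; case: ltnP => // Jj.
by rewrite sJ// sub0r sqrrN.
Qed.

Lemma err_ge0 J th : supported J th -> 0 <= err th.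
Proof.
move=> sJ; rewrite (err_split sJ) addr_ge0 ?tail_ge0//.
by apply: sumr_ge0 => i _; exact: sqr_ge0.
Qed.

Lemma qhat_sub_q J th x : supported J th -> in_cube x ->
  qhat psi J th x - q x =
  addf (th.1 - alpha) (fun k => serfun (psi k) (fun j => th.2 k j - theta_star k j)) x.
Proof.
move=> sJ xc; rewrite q_addf// /addf opprD addrACA; congr (_ + _).
rewrite -sumrB; apply: eq_bigr => k _.
have xk : I01 (x k) by rewrite /= in_itv/=; exact: xc.
rewrite (serfunB (@psi_bound k) (th_l1bound k sJ) (star_l1bound k) xk).
congr (_ - _); apply/esym; apply: (serfun_fin (@psi_bound k)) => // j.
exact: sJ.
Qed.

Lemma cube_int_err J th : supported J th ->
  cube_int (fun x => ((qhat psi J th x - q x) ^+ 2)%:E) = (err th)%:E.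
Proof.
move=> sJ; under eq_cube_int => x xc do rewrite (qhat_sub_q sJ xc).
rewrite cube_int_sqr.
- congr (_ + _)%:E; apply: eq_bigr => k _.
  exact: (int_serfun_sqr (psi_meas k) (@psi_bound k) (psi_orth k) (dbound k sJ)).
- by move=> k; exact: (bmeas_serfun (psi_meas k) (@psi_bound k) (dbound k sJ)).
- by move=> k; exact: (int_serfun (psi_meas k) (@psi_bound k) (psi_int0 k) (dbound k sJ)).
Qed.

Lemma q_sub_qhat J x : in_cube x ->
  q x - qhat psi J ths x = addf 0 (fun k => serfun (psi k) (tailc J k)) x.
Proof.
move=> xc; rewrite q_addf// /addf opprD addrACA subrr; congr (_ + _).
rewrite -sumrB; apply: eq_bigr => k _.
have xk : I01 (x k) by rewrite /= in_itv/=; exact: xc.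
have -> : tailc J k = (fun j => theta_star k j -
    (if (j < J)%N then theta_star k j else 0)).
  by apply/funext => j; rewrite /tailc; case: ifP; rewrite ?subrr ?subr0.
rewrite (serfunB (@psi_bound k) (star_l1bound k) (l1bound_trunc J (star_l1bound k)) xk).
congr (_ - _); rewrite (serfun_fin (@psi_bound k) (J := J))//.
  by apply: eq_bigr => j _; rewrite ltn_ord.
by move=> j Jj; rewrite ltnNge Jj.
Qed.

Lemma cube_int_tail J :
  cube_int (fun x => ((q x - qhat psi J ths x) ^+ 2)%:E) = (tail J)%:E.
Proof.
under eq_cube_int => x xc do rewrite (q_sub_qhat J xc).
rewrite cube_int_sqr.
- rewrite expr0n add0r; congr EFin; apply: eq_bigr => k _.
  exact: (int_serfun_sqr (psi_meas k) (@psi_bound k) (psi_orth k) (tailc_l1bound J k)).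
- by move=> k; exact: (bmeas_serfun (psi_meas k) (@psi_bound k) (tailc_l1bound J k)).
- by move=> k; exact: (int_serfun (psi_meas k) (@psi_bound k) (psi_int0 k) (tailc_l1bound J k)).
Qed.

Lemma cube_int_qhat_sqr J th :
  cube_int (fun x => (qhat psi J th x ^+ 2)%:E) = (\sum_i cidx (J := J) th i ^+ 2)%:E.
Proof.
rewrite sum_idx/=; under eq_cube_int => x xc do rewrite qhat_addf.
rewrite cube_int_sqr.
- congr (_ + _)%:E; apply: eq_bigr => k _.
  exact: (int_psum_sqr (psi_meas k) (@psi_bound k) (psi_orth k)).
- by move=> k; exact: qhat_part_bmeas.
- move=> k; rewrite /qhat_part I01_sum; last by move=> j; exact/bmeasZ/psi_bmeas.
  by rewrite big1// => j _; rewrite I01Z ?psi_int0 ?mulr0//; exact: psi_bmeas.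
Qed.

End population.

Lemma cell_approx_eq (R : realType) (p N : nat) (F G : 'I_N -> ('I_p -> R) -> R) :
  (forall i x, in_cube x -> F i x = G i x) -> cell_approx F -> cell_approx G.
Proof.
move=> FG aF e e0; have [T [iota [r [mi r01 h]]]] := aF e e0.
exists T, iota, r; split => // x xc i; rewrite -!FG//; first exact: h.
by move=> k; have := r01 k (iota k (x k)); rewrite /= in_itv.
Qed.

(** By polarisation [2 * z * (z + d) = z ^+ 2 + (z + d) ^+ 2 - d ^+ 2], where the middle square is
    dropped. *)
Lemma gmax_split (R : realType) (c1 c2 z d : R) : 0 < c1 -> c1 <= c2 ->
  gmax c1 c2 (z * (z + d)) <= - (c1 / 2) * z ^+ 2 + (c2 / 2) * d ^+ 2.
Proof.
move=> c10 c12; have h := sqr_ge0 (z + d); have z2 := sqr_ge0 z; have d2 := sqr_ge0 d.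
have h1 := mulr_ge0 (ltW c10) h; have c20 := lt_le_trans c10 c12.
have h2 := mulr_ge0 (ltW c20) h.
have h3 : c1 * z ^+ 2 <= c2 * z ^+ 2 by rewrite ler_wpM2r.
have h4 : c1 * d ^+ 2 <= c2 * d ^+ 2 by rewrite ler_wpM2r.
by rewrite /gmax ge_max; apply/andP; split; lra.
Qed.

(* AM-GM with the weight [C2] absorbing the factor lost in the second moment. *)
Lemma gmax_amgm (R : realType) (c1 c2 C2 z v : R) : 0 < c1 -> c1 <= c2 -> 0 < C2 ->
  2 * C2 * gmax c1 c2 (z * v) <= c2 ^+ 2 * C2 ^+ 2 * z ^+ 2 + v ^+ 2.
Proof.
move=> c10 c12 C20; have c20 := lt_le_trans c10 c12.
have gle : gmax c1 c2 (z * v) <= c2 * `|z * v|.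
  have n0 : 0 <= `|z * v| by []; have := ler_norm (- (z * v)); rewrite normrN => nl.
  have a1 : c1 * `|z * v| <= c2 * `|z * v| by rewrite ler_wpM2r.
  have a2 : c1 * - (z * v) <= c1 * `|z * v| by rewrite ler_wpM2l// ltW.
  have a3 : c2 * - (z * v) <= c2 * `|z * v| by rewrite ler_wpM2l// ltW.
  by rewrite /gmax ge_max; apply/andP; split; lra.
have C2' : 0 <= 2 * C2 by rewrite mulr_ge0// ltW.
apply: le_trans (ler_wpM2l C2' gle) _; rewrite normrM.
have h := sqr_ge0 (c2 * C2 * `|z| - `|v|).
rewrite -[z ^+ 2]real_normK ?num_real// -[v ^+ 2]real_normK ?num_real//.
by lra.
Qed.

Section residual.
Variables (R : realType) (p : nat) (psi : 'I_p -> nat -> R -> R) (M tau : R).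
Notation I01 := [set` `[0%R : R, 1%R]].
Hypothesis onb : centered_onb_bounded psi M.
Variables (d : measure_display) (T : measurableType d).
Variables (X : 'I_p -> T -> R) (Y : T -> R) (J : nat).
Hypothesis mX : forall k, measurable_fun setT (X k).
Hypothesis mY : measurable_fun setT Y.
Hypothesis X01 : forall k w, 0 <= X k w <= 1.

Lemma Psi_bmeas (i : idx p J) : bmeas setT (fun w => Psi psi (X^~ w) i).
Proof.
case: i => [[k j]|] /=; last exact: bmeas_cst.
have XI w : I01 (X k w) by rewrite /= in_itv/=; exact: X01.
split; last by exists M => w _; apply: (psi_bound onb).
apply: (@measurable_comp _ _ _ _ _ _ I01) => //.
- by move=> _ [w _ <-]; exact: XI.
- exact: (psi_meas onb).
Qed.

Lemma Psi_le w (i : idx p J) : 1 <= M -> `|Psi psi (X^~ w) i| <= M.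
Proof.
move=> M1; case: i => [[k j]|] /=; last by rewrite normr1.
by apply: (psi_bound onb); rewrite /= in_itv/=; exact: X01.
Qed.

Variable th : T -> coef R p.
Hypothesis mth : forall i : idx p J, measurable_fun setT (fun w => cidx (th w) i).

Lemma qhat_measurable : measurable_fun setT (fun w => qhat psi J (th w) (X^~ w)).
Proof.
rewrite (_ : (fun w => _) = (fun w => \sum_(i : idx p J) cidx (th w) i * Psi psi (X^~ w) i)).
  apply: measurable_sum => i; apply: measurable_funM; first exact: mth.
  by case: (Psi_bmeas i).
by apply/funext => w; rewrite qhatE.
Qed.

Lemma resid_bmeas :
  bmeas setT (fun w => tau - (Y w <= qhat psi J (th w) (X^~ w))%R%:R).
Proof.
apply: bmeasB; first exact: bmeas_cst.
by apply: bmeas_bool; apply: measurable_fun_ler => //; exact: qhat_measurable.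
Qed.

End residual.

(** * Drift and mean gradient for a frozen iterate *)

Section sample.
Variables (R : realType) (p : nat) (psi : 'I_p -> nat -> R -> R) (M Rad alpha tau : R).
Variables (theta_star : 'I_p -> nat -> R) (pYX : ('I_p -> R) -> R -> R).
Notation leb := (@lebesgue_measure R).
Notation I01 := [set` `[0%R : R, 1%R]].
Hypothesis onb : centered_onb_bounded psi M.
Hypothesis M1 : 1 <= M.
Hypothesis l1star : forall n, `|alpha| + \sum_(k < p) \sum_(j < n) `|theta_star k j| <= Rad.
Notation q := (cond_quantile pYX tau).
Hypothesis qE : forall x, in_cube x ->
  q x = alpha + \sum_(k < p) limn (series (fun j => theta_star k j * psi k j (x k))).
Variables (d : measure_display) (Omega : measurableType d).
Variable P : probability Omega R.
Variables (X : 'I_p -> Omega -> R) (Y : Omega -> R) (pX : ('I_p -> R) -> R).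
Variables (C1 C2 c1 c2 : R).
Hypothesis mX : forall k, measurable_fun setT (X k).
Hypothesis mY : measurable_fun setT Y.
Hypothesis X01 : forall k w, 0 <= X k w <= 1.
Hypothesis law : forall (A : 'I_p -> set R) (B : set R),
  (forall k, measurable (A k)) -> measurable B ->
  P (rect_event X Y A B) =
  cube_int (fun x => ((\prod_(k < p) \1_(A k) (x k)) * pX x)%:E *
                      \int[leb]_(y in B) (pYX x y)%:E)%E.
Hypothesis tau01 : 0 < tau < 1.
Hypothesis C10 : 0 < C1.
Hypothesis c10 : 0 < c1.
Hypothesis pXb : forall x, in_cube x -> C1 <= pX x <= C2.
Hypothesis dens : forall x, in_cube x ->
  [/\ measurable_fun setT (pYX x), (forall y, 0 <= pYX x y)
    & (\int[leb]_(y in setT) (pYX x y)%:E = 1)%E].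
Hypothesis densb : forall x y, in_cube x -> - (M * Rad) <= y <= M * Rad ->
  c1 <= pYX x y <= c2.

Let B0 : 0 <= M * Rad.
Proof. by rewrite mulr_ge0 ?(Rad0 l1star)//; exact: le_trans M1. Qed.
Let c1c2 : c1 <= c2 := c12 densb B0.
Let C1C2 : C1 <= C2 := C12 pXb.
Let C20 : 0 < C2 := lt_le_trans C10 C1C2.
Let PT := probT_fin P.

Variables (J : nat) (th : coef R p).
Hypothesis sJ : supported J th.
Hypothesis thR : l1norm J th <= Rad.

Let bq : bmeas setT (fun w => q (X^~ w)).
Proof.
apply: (bmeas_eq _ (bmeas_addf alpha mX X01 (gq_bmeas onb l1star))) => w _.
by rewrite (q_addf qE).
Qed.

Let bqh a : bmeas setT (fun w => qhat psi J a (X^~ w)).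
Proof. exact: (bmeas_addf a.1 mX X01 (qhat_part_bmeas onb J a)). Qed.

Let approx1 (v : ('I_p -> R) -> R) a h : (forall k, bmeas I01 (h k)) ->
  (forall x, in_cube x -> addf a h x = v x) -> cell_approx (fun _ : 'I_1 => v).
Proof.
move=> bh hv; apply: (@cell_approx_eq _ _ _ (fun _ : 'I_1 => addf a h)).
  by move=> i x; exact: hv.
by apply: (@addf_cell_approx _ _ 1 (fun=> a) (fun=> h)) => i k; exact: bh.
Qed.

Let approx3 a : cell_approx
  (fun i : 'I_3 => nth (qhat psi J th) [:: qhat psi J th; q; qhat psi J a] i).
Proof.
pose a3 (i : 'I_3) := nth 0 [:: th.1; alpha; a.1] i.
pose h3 (i : 'I_3) := nth (fun _ _ => 0)
  [:: qhat_part psi J th; gq psi theta_star; qhat_part psi J a] i.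
apply: (@cell_approx_eq _ _ _ (fun i => addf (a3 i) (h3 i))).
  by case=> [[|[|[|//]]] ?] x xc //=; rewrite (q_addf qE).
apply: addf_cell_approx; case=> [[|[|[|//]]] ?] k /=.
- exact: (qhat_part_bmeas onb).
- exact: (gq_bmeas onb l1star).
- exact: (qhat_part_bmeas onb).
Qed.

Let qhat_le a x : in_cube x -> `|qhat psi J a x| <= M * l1norm J a.
Proof. by move=> xc; rewrite ler_norml; exact: (qhat_bound onb M1 (lexx _) xc). Qed.

Let grad a : \int[P]_w ((tau - (Y w <= qhat psi J th (X^~ w))%R%:R) * qhat psi J a (X^~ w)) <=
  \int[P]_w gmax c1 c2 ((qhat psi J th (X^~ w) - q (X^~ w)) * qhat psi J a (X^~ w)).
Proof.
apply: (gradient_le mX mY X01 law tau01 C10 c10 pXb dens densb B0 (approx3 a)) => //.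
- by move=> x xc; exact: (qhat_bound onb M1 thR xc).
- by move=> x xc; exact: (q_bound onb M1 l1star qE xc).
- by move=> x; exact: qhat_le.
Qed.

Let bz : bmeas setT (fun w => qhat psi J th (X^~ w) - q (X^~ w)).
Proof. exact: bmeasB. Qed.

Let qle x : in_cube x -> `|q x| <= M * Rad.
Proof. by move=> xc; rewrite ler_norml; exact: (q_bound onb M1 l1star qE xc). Qed.

Let Ez : C1 * err alpha theta_star th <=
  \int[P]_w ((qhat psi J th (X^~ w) - q (X^~ w)) ^+ 2) <= C2 * err alpha theta_star th.
Proof.
apply: (@second_moment_bounds _ _ _ _ P X Y pX pYX C1 C2 mX mY X01 law C10 pXb dens
  (fun x => qhat psi J th x - q x) (M * l1norm J th + M * Rad)) => //.
- apply: (@approx1 _ (th.1 - alpha)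
    (fun k y => qhat_part psi J th k y - gq psi theta_star k y)).
    move=> k; apply: bmeasB; first exact: (qhat_part_bmeas onb).
    exact: (gq_bmeas onb l1star).
  move=> x xc; rewrite (q_addf qE)// qhat_addf /addf opprD addrACA; congr (_ + _).
  by rewrite -sumrB.
- move=> x xc; apply: le_trans (ler_normB _ _) _.
  by apply: lerD; [exact: qhat_le|exact: qle].
- exact: (cube_int_err onb l1star qE sJ).
Qed.

Let bd : bmeas setT (fun w => q (X^~ w) - qhat psi J (ths alpha theta_star) (X^~ w)).
Proof. exact: bmeasB. Qed.

Let Ed : \int[P]_w ((q (X^~ w) - qhat psi J (ths alpha theta_star) (X^~ w)) ^+ 2) <=
  C2 * tail theta_star J.
Proof.
suff /andP[] : C1 * tail theta_star J <=
  \int[P]_w ((q (X^~ w) - qhat psi J (ths alpha theta_star) (X^~ w)) ^+ 2) <=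
  C2 * tail theta_star J by [].
apply: (@second_moment_bounds _ _ _ _ P X Y pX pYX C1 C2 mX mY X01 law C10 pXb dens
  (fun x => q x - qhat psi J (ths alpha theta_star) x)
  (M * Rad + M * l1norm J (ths alpha theta_star))) => //.
- apply: (@approx1 _ 0
    (fun k y => gq psi theta_star k y - qhat_part psi J (ths alpha theta_star) k y)).
    move=> k; apply: bmeasB; first exact: (gq_bmeas onb l1star).
    exact: (qhat_part_bmeas onb).
  move=> x xc; rewrite (q_addf qE)// qhat_addf /addf opprD addrACA subrr; congr (_ + _).
  by rewrite -sumrB.
- move=> x xc; apply: le_trans (ler_normB _ _) _.
  by apply: lerD; [exact: qle|exact: qhat_le].
- exact: (cube_int_tail onb l1star qE).
Qed.

Lemma drift : \int[P]_w ((tau - (Y w <= qhat psi J th (X^~ w))%R%:R) *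
    qhat psi J (subc th (ths alpha theta_star)) (X^~ w)) <=
  - (c1 / 2) * (C1 * err alpha theta_star th) + (c2 / 2) * (C2 * tail theta_star J).
Proof.
apply: le_trans (grad _) _.
(* The test direction is [qhat] minus the truncated quantile, that is the error [z] plus the
   truncation remainder [d], as [gmax_split] expects. *)
have -> : (fun w => gmax c1 c2 ((qhat psi J th (X^~ w) - q (X^~ w)) *
     qhat psi J (subc th (ths alpha theta_star)) (X^~ w))) =
  (fun w => gmax c1 c2 ((qhat psi J th (X^~ w) - q (X^~ w)) *
     ((qhat psi J th (X^~ w) - q (X^~ w)) +
      (q (X^~ w) - qhat psi J (ths alpha theta_star) (X^~ w))))).
  by apply/funext => w; congr (gmax _ _ (_ * _)); rewrite qhat_subc; ring.
have bG : bmeas setT (fun w => gmax c1 c2 ((qhat psi J th (X^~ w) - q (X^~ w)) *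
     ((qhat psi J th (X^~ w) - q (X^~ w)) +
      (q (X^~ w) - qhat psi J (ths alpha theta_star) (X^~ w))))).
  by apply: bmeas_max; apply: bmeasZ; apply: bmeasM => //; exact: bmeasD.
have b1 := bmeasZ (- (c1 / 2)) (bmeas_sqr bz); have b2 := bmeasZ (c2 / 2) (bmeas_sqr bd).
apply: le_trans (le_bint measurableT PT bG (bmeasD b1 b2) _) _.
  by move=> w _; exact: gmax_split.
rewrite (bintD measurableT PT b1 b2) (bintZ measurableT PT _ (bmeas_sqr bz)).
rewrite (bintZ measurableT PT _ (bmeas_sqr bd)); apply: lerD.
  by rewrite !mulNr lerN2 ler_wpM2l ?divr_ge0 ?(ltW c10)//; case/andP: Ez.
by rewrite ler_wpM2l ?divr_ge0 ?(le_trans (ltW c10) c1c2)//; exact: Ed.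
Qed.

Definition mean_grad (i : idx p J) : R :=
  \int[P]_w ((tau - (Y w <= qhat psi J th (X^~ w))%R%:R) * Psi psi (X^~ w) i).

(* Bessel's inequality by duality: the mean gradient is tested against itself. *)
Lemma mean_grad_le : \sum_i mean_grad i ^+ 2 <= c2 ^+ 2 * C2 ^+ 2 * err alpha theta_star th.
Proof.
pose a := of_idx mean_grad; pose G := \sum_i mean_grad i ^+ 2.
have br : bmeas setT (fun w => tau - (Y w <= qhat psi J th (X^~ w))%R%:R).
  apply: (@resid_bmeas R p psi M tau onb _ _ X Y J mX mY X01 (fun=> th)).
  by move=> i; exact: measurable_cst.
have bP i := Psi_bmeas onb mX X01 (J := J) i.
have GE : \int[P]_w ((tau - (Y w <= qhat psi J th (X^~ w))%R%:R) *
    qhat psi J a (X^~ w)) = G.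
  under eq_Rintegral => w _.
    rewrite [X in _ * X]qhatE mulr_sumr; under eq_bigr do rewrite of_idxK mulrCA.
    over.
  rewrite (bint_sum measurableT PT).
    by apply: eq_bigr => i _; rewrite (bintZ measurableT PT) ?expr2//; exact: bmeasM.
  by move=> i; apply: bmeasZ; exact: bmeasM.
have g1 := grad a; rewrite GE in g1.
have Ev : \int[P]_w (qhat psi J a (X^~ w) ^+ 2) <= C2 * G.
  suff /andP[] : C1 * G <= \int[P]_w (qhat psi J a (X^~ w) ^+ 2) <= C2 * G by [].
  apply: (@second_moment_bounds _ _ _ _ P X Y pX pYX C1 C2 mX mY X01 law C10 pXb dens
    (qhat psi J a) (M * l1norm J a)) => //.
  - by apply: (@approx1 _ a.1 (qhat_part psi J a)) => // k; exact: (qhat_part_bmeas onb).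
  - by move=> x; exact: qhat_le.
  - rewrite (cube_int_qhat_sqr onb); congr EFin; apply: eq_bigr => i _.
    by rewrite of_idxK.
have bG : bmeas setT (fun w => gmax c1 c2 ((qhat psi J th (X^~ w) - q (X^~ w)) *
     qhat psi J a (X^~ w))).
  by apply: bmeas_max; apply: bmeasZ; exact: bmeasM.
have b1 := bmeasZ (c2 ^+ 2 * C2 ^+ 2) (bmeas_sqr bz); have b2 := bmeas_sqr (bqh a).
(* With this weight [C2 * G] appears on the right, half of the [2 * C2 * G] that bounds the left
   side from below, and is absorbed. *)
have h : 2 * C2 * \int[P]_w gmax c1 c2 ((qhat psi J th (X^~ w) - q (X^~ w)) *
     qhat psi J a (X^~ w)) <= c2 ^+ 2 * C2 ^+ 2 * (C2 * err alpha theta_star th) + C2 * G.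
  rewrite -(bintZ measurableT PT _ bG).
  apply: le_trans (le_bint measurableT PT (bmeasZ _ bG) (bmeasD b1 b2) _) _.
    by move=> w _; exact: gmax_amgm.
  rewrite (bintD measurableT PT b1 b2) (bintZ measurableT PT _ (bmeas_sqr bz)).
  have /andP[_ Ez2] := Ez; apply: lerD; last exact: Ev.
  by apply: ler_wpM2l => //; rewrite mulr_ge0 ?sqr_ge0.
have C2' : 0 <= 2 * C2 by rewrite mulr_ge0// ltW.
have := le_trans (ler_wpM2l C2' g1) h.
rewrite -/G => h2; rewrite -(ler_pM2l C20); lra.
Qed.

End sample.

(** * Sigma-algebras generated by finitely many samples *)

Section sample_sigma_algebra.
Variables (R : realType) (p : nat) (d : measure_display) (Omega : measurableType d).
Variable P : probability Omega R.
Variables (n : nat -> nat).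
Variables (X : nat -> nat -> 'I_p -> Omega -> R) (Y : nat -> nat -> Omega -> R).
Hypothesis mX : forall t i k, measurable_fun setT (X t i k).
Hypothesis mY : forall t i, measurable_fun setT (Y t i).
Definition validx (ti : nat * nat) := (0 < ti.1)%N && (ti.2 < n ti.1)%N.
Implicit Types (S : seq (nat * nat)).

Definition rect_cap S (A : nat * nat -> 'I_p -> set R) (B : nat * nat -> set R) :=
  \bigcap_(ti in [set` S]) rect_event (X ti.1 ti.2) (Y ti.1 ti.2) (A ti) (B ti).

Hypothesis indep : forall S, uniq S -> all validx S -> forall A B,
  (forall ti k, measurable (A ti k)) -> (forall ti, measurable (B ti)) ->
  P (rect_cap S A B)
  = (\prod_(ti <- S) P (rect_event (X ti.1 ti.2) (Y ti.1 ti.2) (A ti) (B ti)))%E.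

Definition gen S : set (set Omega) := [set E | exists A B,
  [/\ forall ti k, measurable (A ti k), forall ti, measurable (B ti) &
      E = rect_cap S A B]].

Lemma gen_measurable S : gen S `<=` measurable.
Proof.
move=> _ [A [B [mA mB ->]]]; apply: fin_bigcap_measurable; first exact: finite_seq.
by move=> ti _; apply: measurable_rect.
Qed.

Lemma gen_setI S : setI_closed (gen S).
Proof.
move=> _ _ [A [B [mA mB ->]]] [A' [B' [mA' mB' ->]]].
exists (fun ti k => A ti k `&` A' ti k), (fun ti => B ti `&` B' ti); split.
- by move=> ti k; exact: measurableI.
- by move=> ti; exact: measurableI.
- apply/seteqP; split => w.
    move=> [h h'] ti tiS; have [a b] := h ti tiS; have [a' b'] := h' ti tiS.
    by split => // k; split.
  by move=> h; split => ti tiS; have [a [b b']] := h ti tiS; split => // k; have [] := a k.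
Qed.

Lemma gen_mono S S' : {subset S <= S'} -> gen S `<=` gen S'.
Proof.
move=> SS' _ [A [B [mA mB ->]]].
exists (fun ti k => if ti \in S then A ti k else setT),
  (fun ti => if ti \in S then B ti else setT); split.
- by move=> ti k; case: ifP.
- by move=> ti; case: ifP.
- apply/seteqP; split => w h ti /= tiS.
    have [tS|tS] := boolP (ti \in S); last by split.
    by have [a b] := h ti tS; split.
  by have := h ti (SS' _ tiS); rewrite tiS.
Qed.

(** [Omega] itself with the sigma-algebra of the samples in [S]: measurability on [TS S] says that a
    quantity depends on these samples only, and no product space has to be built. *)
Definition TS S : measurableType _ := g_sigma_algebraType (gen S).

Lemma TS_measurable S (A : set Omega) : measurable (A : set (TS S)) -> measurable A.
Proof.
move: A; apply: smallest_sub; first exact: sigma_algebra_measurable.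
exact: gen_measurable.
Qed.

Lemma idS_measurable S : measurable_fun setT (id : Omega -> TS S).
Proof. by move=> _ A mA; rewrite setTI; exact: TS_measurable mA. Qed.

Definition idS S : {mfun Omega >-> TS S} :=
  HB.pack (id : Omega -> TS S) (isMeasurableFun.Build _ _ _ _ _ (@idS_measurable S)).

Lemma bmeas_TS S (f : Omega -> R) : bmeas setT (f : TS S -> R) -> bmeas setT f.
Proof.
move=> [mf [K fK]]; split; last by exists K => w _; exact: fK.
exact: (measurableT_comp mf (@idS_measurable S)).
Qed.

Lemma measurable_TS_mono S S' (f : Omega -> R) : {subset S <= S'} ->
  measurable_fun setT (f : TS S -> R) -> measurable_fun setT (f : TS S' -> R).
Proof.
move=> SS' mf _ B mB; have := mf measurableT B mB.
rewrite !setTI; apply: sub_sigma_algebra2; exact: gen_mono.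
Qed.

Lemma measurable_X_TS S ti k : ti \in S ->
  measurable_fun setT (X ti.1 ti.2 k : TS S -> R).
Proof.
move=> tiS _ A mA; rewrite setTI; apply: sub_sigma_algebra.
exists (fun ti' k' => if (ti' == ti) && (k' == k) then A else setT), (fun=> setT).
split => //; first by move=> ti' k'; case: ifP.
apply/seteqP; split => w.
  move=> wA ti' _; split => // k'; case: ifP => // /andP[/eqP-> /eqP->].
  exact: wA.
by move=> /(_ ti tiS)[/(_ k)]; rewrite !eqxx.
Qed.

Lemma measurable_Y_TS S ti : ti \in S ->
  measurable_fun setT (Y ti.1 ti.2 : TS S -> R).
Proof.
move=> tiS _ A mA; rewrite setTI; apply: sub_sigma_algebra.
exists (fun _ _ => setT), (fun ti' => if ti' == ti then A else setT).
split => //; first by move=> ti'; case: ifP.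
apply/seteqP; split => w.
  by move=> wA ti' _; split => //; case: ifP => // /eqP->.
by move=> /(_ ti tiS)[_]; rewrite eqxx.
Qed.

(** As [z] is not in [S], a rectangle over [S] and one over [z] merge into a single rectangle over
    [z :: S], whose probability factorises; the rest is the extension from generators. *)
Lemma indep_TS S z : uniq (z :: S) -> all validx (z :: S) ->
  forall A B, measurable A -> measurable B ->
  (P (idS S @^-1` A `&` idS [:: z] @^-1` B) =
   P (idS S @^-1` A) * P (idS [:: z] @^-1` B))%E.
Proof.
move=> uS vS A B mA mB.
apply: (indep_sigma (@gen_setI S) (@gen_setI [:: z]) (@gen_measurable S)
  (@gen_measurable [:: z])) => //.
move=> _ _ [A1 [B1 [mA1 mB1 ->]]] [A2 [B2 [mA2 mB2 ->]]].
have /andP[zS uS'] := uS; have /andP[vz vS'] := vS.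
pose A3 ti := if ti == z then A2 ti else A1 ti.
pose B3 ti := if ti == z then B2 ti else B1 ti.
have mA3 ti k : measurable (A3 ti k) by rewrite /A3; case: ifP.
have mB3 ti : measurable (B3 ti) by rewrite /B3; case: ifP.
have neqz ti : ti \in S -> (ti == z) = false.
  by move=> tiS; apply: contraNF zS => /eqP <-.
have -> : rect_cap S A1 B1 `&` rect_cap [:: z] A2 B2 = rect_cap (z :: S) A3 B3.
  apply/seteqP; split => w.
    move=> [h1 h2] ti /=; rewrite inE => /predU1P[->|tiS].
      by rewrite /A3 /B3 eqxx; apply: h2; rewrite /= inE.
    by rewrite /A3 /B3 neqz//; exact: h1.
  move=> h; split => ti /=.
    move=> tiS; have := h ti; rewrite /= inE tiS orbT => /(_ isT).
    by rewrite /A3 /B3 neqz.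
  rewrite inE => /eqP ->; have := h z; rewrite /= inE eqxx => /(_ isT).
  by rewrite /A3 /B3 eqxx.
rewrite (indep uS vS mA3 mB3) (indep uS' vS' mA1 mB1).
rewrite (@indep [:: z] _ _ A2 B2)//; last by rewrite /= vz.
rewrite big_cons big_seq1 muleC /A3 /B3 eqxx; congr (_ * _)%E.
by apply: eq_big_seq => ti tiS; rewrite neqz.
Qed.

(** The two arguments of [f] separate the dependence on [S] from that on the fresh sample [z], which
    is then integrated out. The second conclusion provides the measurability needed to integrate out
    further samples. *)
Lemma fubini_TS S z (f : Omega -> Omega -> R) :
  uniq (z :: S) -> all validx (z :: S) ->
  bmeas setT (fun ww : TS S * TS [:: z] => f ww.1 ww.2) ->
  \int[P]_w f w w = \int[P]_w \int[P]_w' f w w' /\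
  bmeas setT ((fun w => \int[P]_w' f w w') : TS S -> R).
Proof.
move=> uS vS bf; split.
  exact: (indep_fubini (indep_TS uS vS) bf).
exact: (bmeas_indep_int P (idS [:: z]) bf).
Qed.

End sample_sigma_algebra.

(** * The one-step inequality for the expected error *)

Section expectation_step.
Variables (R : realType) (p : nat) (psi : 'I_p -> nat -> R -> R) (M Rad alpha tau : R).
Variables (theta_star : 'I_p -> nat -> R) (pYX : ('I_p -> R) -> R -> R).
Notation leb := (@lebesgue_measure R).
Hypothesis onb : centered_onb_bounded psi M.
Hypothesis M1 : 1 <= M.
Hypothesis l1star : forall n, `|alpha| + \sum_(k < p) \sum_(j < n) `|theta_star k j| <= Rad.
Hypothesis qE : forall x, in_cube x -> cond_quantile pYX tau x =
  alpha + \sum_(k < p) limn (series (fun j => theta_star k j * psi k j (x k))).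
Variables (d : measure_display) (Omega : measurableType d).
Variable P : probability Omega R.
Variables (n : nat -> nat) (X : nat -> nat -> 'I_p -> Omega -> R).
Variables (Y : nat -> nat -> Omega -> R) (pX : ('I_p -> R) -> R).
Variables (C1 C2 c1 c2 : R).
Hypothesis mX : forall t i k, measurable_fun setT (X t i k).
Hypothesis mY : forall t i, measurable_fun setT (Y t i).
Hypothesis X01 : forall ti, validx n ti -> forall k w, 0 <= X ti.1 ti.2 k w <= 1.
Hypothesis law : forall ti, validx n ti -> forall (A : 'I_p -> set R) (B : set R),
  (forall k, measurable (A k)) -> measurable B ->
  P (rect_event (X ti.1 ti.2) (Y ti.1 ti.2) A B) =
  cube_int (fun x => ((\prod_(k < p) \1_(A k) (x k)) * pX x)%:E *
                      \int[leb]_(y in B) (pYX x y)%:E)%E.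
Hypothesis indep : forall S, uniq S -> all (validx n) S -> forall A B,
  (forall ti k, measurable (A ti k)) -> (forall ti, measurable (B ti)) ->
  P (rect_cap X Y S A B)
  = (\prod_(ti <- S) P (rect_event (X ti.1 ti.2) (Y ti.1 ti.2) (A ti) (B ti)))%E.
Hypothesis tau01 : 0 < tau < 1.
Hypothesis C10 : 0 < C1.
Hypothesis c10 : 0 < c1.
Hypothesis pXb : forall x, in_cube x -> C1 <= pX x <= C2.
Hypothesis dens : forall x, in_cube x ->
  [/\ measurable_fun setT (pYX x), (forall y, 0 <= pYX x y)
    & (\int[leb]_(y in setT) (pYX x y)%:E = 1)%E].
Hypothesis densb : forall x y, in_cube x -> - (M * Rad) <= y <= M * Rad ->
  c1 <= pYX x y <= c2.
Variables (J : nat -> nat) (gam : nat -> R) (theta : nat -> Omega -> coef R p).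
Hypothesis Jmono : forall t, (J t <= J t.+1)%N.
Hypothesis theta0 : forall w, theta 0 w = (0, fun _ _ => 0).
Hypothesis run : forall t w, is_l1ball_proj (J t.+1) Rad
  (pfgd_tilde psi tau (J t.+1) (n t.+1) (gam t.+1) (fun i k => X t.+1 i k w)
     (fun i => Y t.+1 i w) (theta t w)) (theta t.+1 w).

Notation TS S := (TS X Y S).
Notation err := (err alpha theta_star).
Notation ths := (ths alpha theta_star).
Let PT := probT_fin P.

Lemma theta_supported t w : supported (J t) (theta t w).
Proof. by case: t => [|t]; [rewrite theta0|case: (run t w)]. Qed.

Lemma theta_l1norm t w : l1norm (J t) (theta t w) <= Rad.
Proof.
case: t => [|t]; last by case: (run t w).
rewrite theta0 /l1norm/= normr0 add0r big1 ?(Rad0 l1star)// => k _.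
by rewrite big1// => j _; rewrite normr0.
Qed.

Lemma theta_supportedS t w : supported (J t.+1) (theta t w).
Proof. by move=> k j Jj; apply: (@theta_supported t w); exact: leq_trans Jj. Qed.

Lemma theta_l1normS t w : l1norm (J t.+1) (theta t w) <= Rad.
Proof.
apply: le_trans (theta_l1norm t w); rewrite /l1norm lerD2l.
by apply: ler_sum => k _; apply: (l1bound_fin (@theta_supported t w k)).
Qed.

Definition past t : seq (nat * nat) :=
  undup [seq (a, i) | a <- iota 1 t, i <- iota 0 (n a)].

Lemma mem_past t a i : ((a, i) \in past t) = (0 < a <= t)%N && (i < n a)%N.
Proof.
rewrite mem_undup; apply/allpairsPdep/andP.
  by move=> [a' [i' [+ + [-> ->]]]]; rewrite !mem_iota add0n add1n ltnS leq0n /= => -> ->.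
move=> [/andP[a0 at_] ilt]; exists a, i; split => //; rewrite mem_iota ?add0n//.
by rewrite a0 add1n ltnS.
Qed.

Lemma past_valid t : all (validx n) (past t).
Proof.
by apply/allP => -[a i]; rewrite mem_past => /andP[/andP[a0 _] ia]; rewrite /validx /= a0 ia.
Qed.

Lemma past_sub t : {subset past t <= past t.+1}.
Proof.
move=> [a i]; rewrite !mem_past => /andP[/andP[-> at_] ->].
by rewrite (leq_trans at_).
Qed.

Lemma past_last t l : (l < n t.+1)%N -> (t.+1, l) \in past t.+1.
Proof. by move=> ln; rewrite mem_past ln ltnSn. Qed.

Lemma past_notin t l : (t.+1, l) \notin past t.
Proof. by rewrite mem_past ltnn andbF. Qed.

Lemma last_valid t l : (l < n t.+1)%N -> validx n (t.+1, l).
Proof. by []. Qed.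

(** By induction the unprojected point is measurable in the samples up to [t.+1], and each
    coordinate of its projection is Lipschitz in that point. *)
Lemma theta_measurable t :
  measurable_fun setT ((fun w => (theta t w).1) : TS (past t) -> R) /\
  forall k j, measurable_fun setT ((fun w => (theta t w).2 k j) : TS (past t) -> R).
Proof.
elim: t => [|t [ih1 ih2]].
  split => [|k j]; under eq_fun do rewrite theta0; exact: measurable_cst.
have mphi (i : idx p (J t.+1)) : measurable_fun setT
    ((fun w => cidx (theta t.+1 w) i) : TS (past t.+1) -> R).
  pose v (i : idx p (J t.+1)) : TS (past t.+1) -> R := fun w =>
    cidx (pfgd_tilde psi tau (J t.+1) (n t.+1) (gam t.+1) (fun i k => X t.+1 i k w)
     (fun i => Y t.+1 i w) (theta t w)) i.
  apply: (@lipschitz_measurable _ (TS (past t.+1)) R _ v); last first.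
    move=> w w'; apply: l1proj_coord_lip; exact: is_l1ball_proj_l1proj (run t _).
  move=> i'; rewrite /v; under eq_fun do rewrite cidx_tilde.
  have mth (i1 : idx p (J t.+1)) : measurable_fun setT
      ((fun w => cidx (theta t w) i1) : TS (past t.+1) -> R).
    apply: (measurable_TS_mono (@past_sub t)).
    by case: i1 => [[k j]|] /=; [exact: ih2|exact: ih1].
  apply: measurable_funD; first exact: mth.
  apply: measurable_funM; first exact: measurable_cst.
  apply: measurable_funM; first exact: measurable_cst.
  apply: measurable_sum => l; have lp := past_last (ltn_ord l).
  have mXl k := @measurable_X_TS R p d Omega X Y (past t.+1) (t.+1, l : nat) k lp.
  have mYl := @measurable_Y_TS R p d Omega X Y (past t.+1) (t.+1, l : nat) lp.
  have Xl := X01 (last_valid (ltn_ord l)).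
  apply: measurable_funM.
    by case: (resid_bmeas (T := TS (past t.+1)) tau onb mXl mYl Xl mth).
  by case: (Psi_bmeas (T := TS (past t.+1)) onb mXl Xl i').
split; first exact: (mphi None).
move=> k j; have [jJ|Jj] := ltnP j (J t.+1).
  exact: (mphi (Some (k, Ordinal jJ))).
under eq_fun do rewrite theta_supported//.
exact: measurable_cst.
Qed.

Lemma cidx_bmeas t (i : idx p (J t.+1)) :
  bmeas setT ((fun w => cidx (theta t w) i) : TS (past t) -> R).
Proof.
have [m1 m2] := theta_measurable t; split.
  by case: i => [[k j]|] /=; [exact: m2|exact: m1].
by exists Rad => w _; apply: cidx_le; exact: theta_l1normS.
Qed.

Lemma err_bmeas t : bmeas setT ((fun w => err (theta t w)) : TS (past t) -> R).
Proof.
rewrite (_ : (fun w => _) = (fun w : TS (past t) =>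
  \sum_(i : idx p (J t.+1)) (cidx (theta t w) i - cidx ths i) ^+ 2 +
  tail theta_star (J t.+1))).
  apply: bmeasD; last exact: bmeas_cst.
  apply: bmeas_sum => i; apply: bmeas_sqr; apply: bmeasB; last exact: bmeas_cst.
  exact: cidx_bmeas.
by apply/funext => w; rewrite (err_split l1star (@theta_supportedS t w)).
Qed.

Definition mean_err t : R := \int[P]_w err (theta t w).

Let err_b t : bmeas setT (fun w => err (theta t w)).
Proof. exact: (bmeas_TS mX mY (err_bmeas t)). Qed.

Lemma mean_err_ge0 t : 0 <= mean_err t.
Proof.
by apply: prob_int_ge => // w; exact: (err_ge0 l1star (@theta_supported t w)).
Qed.

Section one_step.
Variable t : nat.
Let L := J t.+1.

(** The iterate is read at [w] and the fresh sample at [w'], so that Fubini can decouple them; the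
    algorithm itself uses the diagonal [w = w']. *)
Definition rr l w w' : R :=
  tau - (Y t.+1 l w' <= qhat psi L (theta t w) ((X t.+1 l)^~ w'))%R%:R.

Definition PS l w' (i : idx p L) : R := Psi psi ((X t.+1 l)^~ w') i.

Let rr_le l w w' : `|rr l w w'| <= 1.
Proof.
have /andP[t0 t1] := tau01.
by rewrite /rr ler_norml; case: (Y _ _ _ <= _)%R => /=; apply/andP; split; lra.
Qed.

Let z l : nat * nat := (t.+1, l).

Section joint.
Variables (S : seq (nat * nat)) (l : nat).
Hypothesis pS : {subset past t <= S}.
Hypothesis ln : (l < n t.+1)%N.

Let mthS (i : idx p L) : measurable_fun setT ((fun w => cidx (theta t w) i) : TS S -> R).
Proof. by apply: (measurable_TS_mono pS); case: (cidx_bmeas i). Qed.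

Let zin : z l \in [:: z l]. Proof. by rewrite inE. Qed.

Let mX2 k : measurable_fun setT
  ((fun ww => X t.+1 l k ww.2) : (TS S * TS [:: z l])%type -> R).
Proof.
have := @measurable_X_TS R p d Omega X Y [:: z l] (z l) k zin.
by move=> h; exact: (measurableT_comp h measurable_snd).
Qed.

Let mY2 : measurable_fun setT
  ((fun ww => Y t.+1 l ww.2) : (TS S * TS [:: z l])%type -> R).
Proof.
have := @measurable_Y_TS R p d Omega X Y [:: z l] (z l) zin.
by move=> h; exact: (measurableT_comp h measurable_snd).
Qed.

Let X2 k (ww : Omega * Omega) : 0 <= X t.+1 l k ww.2 <= 1.
Proof. exact: (X01 (last_valid ln)). Qed.

Lemma rr_joint : bmeas setT
  ((fun ww => rr l ww.1 ww.2) : (TS S * TS [:: z l])%type -> R).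
Proof.
apply: (@resid_bmeas R p psi M tau onb _ (TS S * TS [:: z l])%type
  (fun k ww => X t.+1 l k ww.2) (fun ww => Y t.+1 l ww.2) L mX2 mY2 X2
  (fun ww => theta t ww.1)).
by move=> i; exact: (measurableT_comp (mthS i) measurable_fst).
Qed.

Lemma PS_joint i : bmeas setT
  ((fun ww => PS l ww.2 i) : (TS S * TS [:: z l])%type -> R).
Proof.
exact: (@Psi_bmeas R p psi M onb _ (TS S * TS [:: z l])%type
  (fun k ww => X t.+1 l k ww.2) L mX2 X2 i).
Qed.

Lemma joint_fst (f : Omega -> R) : bmeas setT (f : TS S -> R) ->
  bmeas setT ((fun ww => f ww.1) : (TS S * TS [:: z l])%type -> R).
Proof.
move=> [mf [K fK]]; split; last by exists K => ww _; exact: fK.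
exact: (measurableT_comp mf measurable_fst).
Qed.

Lemma rr_diag : z l \in S -> bmeas setT ((fun w => rr l w w) : TS S -> R).
Proof.
move=> zS; apply: (@resid_bmeas R p psi M tau onb _ (TS S) (X t.+1 l) (Y t.+1 l) L
  _ _ (X01 (last_valid ln)) (theta t)) => //.
- by move=> k; exact: (@measurable_X_TS R p d Omega X Y S (z l) k zS).
- exact: (@measurable_Y_TS R p d Omega X Y S (z l) zS).
Qed.

Lemma PS_diag i : z l \in S -> bmeas setT ((fun w => PS l w i) : TS S -> R).
Proof.
move=> zS; apply: (@Psi_bmeas R p psi M onb _ (TS S) (X t.+1 l) L
  _ (X01 (last_valid ln))).
by move=> k; exact: (@measurable_X_TS R p d Omega X Y S (z l) k zS).
Qed.

End joint.

Let sub0 : {subset past t <= past t}. Proof. by []. Qed.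

Let uz l : uniq (z l :: past t).
Proof. by rewrite /= past_notin undup_uniq. Qed.

Let vz l : (l < n t.+1)%N -> all (validx n) (z l :: past t).
Proof. by move=> ln; rewrite /= past_valid andbT; exact: last_valid. Qed.

(** Fubini freezes the iterate, so the one-sample drift bound applies for every fixed past and is
    then averaged. *)
Lemma step_drift l : (l < n t.+1)%N ->
  \int[P]_w (rr l w w * qhat psi L (subc (theta t w) ths) ((X t.+1 l)^~ w)) <=
  - (c1 / 2) * (C1 * mean_err t) + (c2 / 2) * (C2 * tail theta_star L).
Proof.
move=> ln.
have bf : bmeas setT ((fun ww => rr l ww.1 ww.2 *
    qhat psi L (subc (theta t ww.1) ths) ((X t.+1 l)^~ ww.2))
    : (TS (past t) * TS [:: z l])%type -> R).
  apply: bmeasM; first exact: rr_joint.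
  rewrite (_ : (fun ww => _) = (fun ww : (TS (past t) * TS [:: z l])%type =>
    \sum_(i : idx p L) (cidx (theta t ww.1) i - cidx ths i) * PS l ww.2 i)).
    apply: bmeas_sum => i; apply: bmeasM; last exact: PS_joint.
    apply: bmeasB; last exact: bmeas_cst.
    apply: (@joint_fst _ l (fun w => cidx (theta t w) i)); exact: cidx_bmeas.
  apply/funext => ww; rewrite qhatE; apply: eq_bigr => i _.
  by congr (_ * _); case: i.
have [-> bI] := @fubini_TS R p d Omega P n X Y mX mY indep (past t) (z l)
  (fun w w' => rr l w w' * qhat psi L (subc (theta t w) ths) ((X t.+1 l)^~ w'))
  (uz l) (vz ln) bf.
have b1 := bmeasZ (- (c1 / 2) * C1) (err_b t).
have b2 := bmeas_cst (T := Omega) setT ((c2 / 2) * (C2 * tail theta_star L)).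
apply: le_trans (le_bint measurableT PT (bmeas_TS mX mY bI) (bmeasD b1 b2) _) _.
  move=> w _ /=.
  have := drift onb M1 l1star qE (mX t.+1 l) (mY t.+1 l) (X01 (last_valid ln))
    (law (last_valid ln)) tau01 C10 c10 pXb dens densb
    (@theta_supportedS t w) (theta_l1normS t w).
  by rewrite [- (c1 / 2) * (C1 * _)]mulrA.
by rewrite (prob_int_shift P _ b1) (bintZ measurableT PT _ (err_b t)) -[_ * C1 * _]mulrA.
Qed.

(** The conditional mean gradient given the past, as a function of the outcome [w] that fixes the
    iterate. *)
Definition gg l i w : R := \int[P]_w' (rr l w w' * PS l w' i).

Let rP_joint S l i : {subset past t <= S} -> (l < n t.+1)%N -> bmeas setT
  ((fun ww => rr l ww.1 ww.2 * PS l ww.2 i) : (TS S * TS [:: z l])%type -> R).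
Proof. by move=> pS ln; apply: bmeasM; [exact: rr_joint|exact: PS_joint]. Qed.

Lemma gg_bmeas l i : (l < n t.+1)%N ->
  bmeas setT ((fun w => gg l i w) : TS (past t) -> R).
Proof.
move=> ln; have [_ h] := @fubini_TS R p d Omega P n X Y mX mY indep (past t) (z l)
  (fun w w' => rr l w w' * PS l w' i) (uz l) (vz ln) (rP_joint i sub0 ln).
exact: h.
Qed.

Lemma gg_le l w : (l < n t.+1)%N ->
  \sum_i gg l i w ^+ 2 <= c2 ^+ 2 * C2 ^+ 2 * err (theta t w).
Proof.
move=> ln; exact: (mean_grad_le onb M1 l1star qE (mX t.+1 l) (mY t.+1 l)
  (X01 (last_valid ln)) (law (last_valid ln)) tau01 C10 c10 pXb dens densb
  (@theta_supportedS t w) (theta_l1normS t w)).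
Qed.

(* Distinct samples of the batch are integrated out one after the other. *)
Lemma step_cross l l' : (l < n t.+1)%N -> (l' < n t.+1)%N -> l != l' ->
  \int[P]_w (\sum_i (rr l w w * PS l w i) * (rr l' w w * PS l' w i)) <=
  c2 ^+ 2 * C2 ^+ 2 * mean_err t.
Proof.
move=> ln ln' ll'.
(* Sample [l'] is integrated out first, with the past and sample [l] held fixed. What remains
   involves [gg l'], which depends on the past alone, so [l] can be integrated out next. *)
pose S' := z l :: past t.
have pS' : {subset past t <= S'} by move=> x xp; rewrite inE xp orbT.
have zS' : z l \in S' by rewrite inE eqxx.
have uS' : uniq (z l' :: S').
  rewrite cons_uniq uz andbT inE negb_or past_notin andbT.
  by apply: contraNneq ll' => -[] ->.
have vS' : all (validx n) (z l' :: S').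
  by rewrite /S' -[all _ _]/(_ && all _ (z l :: past t)) (vz ln) andbT; exact: last_valid.
have b1 : bmeas setT ((fun ww => \sum_i (rr l ww.1 ww.1 * PS l ww.1 i) *
    (rr l' ww.1 ww.2 * PS l' ww.2 i)) : (TS S' * TS [:: z l'])%type -> R).
  apply: bmeas_sum => i; apply: bmeasM; last exact: rP_joint.
  apply: (@joint_fst _ l' (fun w => rr l w w * PS l w i)).
  by apply: bmeasM; [exact: rr_diag|exact: PS_diag].
have [-> _] := @fubini_TS R p d Omega P n X Y mX mY indep S' (z l')
  (fun w w' => \sum_i (rr l w w * PS l w i) * (rr l' w w' * PS l' w' i)) uS' vS' b1.
have sec l0 w i (l0n : (l0 < n t.+1)%N) :
    bmeas setT (fun w' => rr l0 w w' * PS l0 w' i).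
  exact: (@bmeas_indep_section d Omega R _ _ _ _ (idS mX mY [:: z l0]) _ (w : TS (past t))
    (rP_joint i sub0 l0n)).
have -> : (fun w => \int[P]_w' \sum_i (rr l w w * PS l w i) * (rr l' w w' * PS l' w' i)) =
    (fun w => \sum_i gg l' i w * (rr l w w * PS l w i)).
  apply/funext => w; rewrite (bint_sum measurableT PT).
    apply: eq_bigr => i _; rewrite (bintZ measurableT PT _ (sec l' w i ln')).
    exact: mulrC.
  by move=> i; apply: bmeasZ; exact: sec.
have b2 : bmeas setT ((fun ww => \sum_i gg l' i ww.1 *
    (rr l ww.1 ww.2 * PS l ww.2 i)) : (TS (past t) * TS [:: z l])%type -> R).
  apply: bmeas_sum => i; apply: bmeasM; last exact: rP_joint.
  by apply: (@joint_fst _ l (gg l' i)); exact: gg_bmeas.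
have [-> bI] := @fubini_TS R p d Omega P n X Y mX mY indep (past t) (z l)
  (fun w w' => \sum_i gg l' i w * (rr l w w' * PS l w' i)) (uz l) (vz ln) b2.
rewrite -(bintZ measurableT PT _ (err_b t)).
apply: (le_bint measurableT PT (bmeas_TS mX mY bI) (bmeasZ _ (err_b t))) => w _ /=.
have -> : \int[P]_w' \sum_i gg l' i w * (rr l w w' * PS l w' i) =
    \sum_i gg l' i w * gg l i w.
  rewrite (bint_sum measurableT PT); last by move=> i; apply: bmeasZ; exact: sec.
  by apply: eq_bigr => i _; rewrite (bintZ measurableT PT _ (sec l w i ln)).
have h1 := gg_le w ln; have h2 := gg_le w ln'.
apply: (@le_trans _ _ (\sum_i (gg l' i w ^+ 2 / 2 + gg l i w ^+ 2 / 2))).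
  apply: ler_sum => i _; have := sqr_ge0 (gg l' i w - gg l i w); lra.
by rewrite big_split/= -!mulr_suml; lra.
Qed.

(** Bounds the squared Euclidean norm of the feature vector: 1 from the intercept, at most [M ^+ 2]
    from each basis function. *)
Definition Wd : R := 1 + p%:R * L%:R * M ^+ 2.

Lemma step_diag l w : (l < n t.+1)%N ->
  \sum_i (rr l w w * PS l w i) * (rr l w w * PS l w i) <= Wd.
Proof.
move=> ln.
have r2 : rr l w w ^+ 2 <= 1.
  by rewrite -real_normK ?num_real// expr_le1// rr_le.
apply: (@le_trans _ _ (\sum_i PS l w i ^+ 2)).
  by apply: ler_sum => i _; rewrite -expr2 exprMn -[leRHS]mul1r ler_wpM2r// sqr_ge0.
have pm i : PS l w i ^+ 2 <= M ^+ 2.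
  have := Psi_le onb (X01 (last_valid ln)) w i M1 => h.
  by rewrite -[leLHS]real_normK ?num_real// lerXn2r ?nnegrE//; exact: le_trans M1.
rewrite sum_idx /Wd; apply: lerD; first by rewrite /PS/= expr1n.
apply: (@le_trans _ _ (\sum_(k < p) \sum_(j < L) M ^+ 2)).
  by apply: ler_sum => k _; apply: ler_sum => j _; exact: pm.
by rewrite !sumr_const !card_ord -mulrnA mulnC -[_ *+ _]mulr_natl natrM.
Qed.

(** In the averaged double sum the [N] diagonal terms contribute [Wd / N], while the roughly
    [N ^+ 2] remaining pairs leave one copy of the squared mean gradient bound. *)
Lemma mean_err_step : (0 < n t.+1)%N -> 0 <= gam t.+1 ->
  mean_err t.+1 <= mean_err t +
  2 * gam t.+1 * (- (c1 / 2) * (C1 * mean_err t) + (c2 / 2) * (C2 * tail theta_star L)) +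
  gam t.+1 ^+ 2 * ((n t.+1)%:R^-1 * Wd + c2 ^+ 2 * C2 ^+ 2 * mean_err t).
Proof.
move=> n0 g0; set N := n t.+1; set g := gam t.+1.
have NR : 0 < N%:R :> R by rewrite ltr0n.
pose Q l w := rr l w w * qhat psi L (subc (theta t w) ths) ((X t.+1 l)^~ w).
pose W l l' w := \sum_i (rr l w w * PS l w i) * (rr l' w w * PS l' w i).
have bth i : bmeas setT (fun w => cidx (J := L) (theta t w) i).
  exact: (bmeas_TS mX mY (cidx_bmeas i)).
have brr (l : 'I_N) : bmeas setT (fun w => rr l w w).
  apply: (bmeas_TS mX mY (S := past t.+1)); apply: rr_diag => //; first exact: past_sub.
  exact: past_last.
have bPS (l : 'I_N) i : bmeas setT (fun w => PS l w i).
  apply: (bmeas_TS mX mY (S := past t.+1)); apply: PS_diag => //.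
  exact: past_last.
have bQ (l : 'I_N) : bmeas setT (Q l).
  apply: bmeasM; first exact: brr.
  rewrite (_ : (fun w => _) = (fun w =>
    \sum_(i : idx p L) (cidx (theta t w) i - cidx ths i) * PS l w i)).
    apply: bmeas_sum => i; apply: bmeasM; last exact: bPS.
    by apply: bmeasB; [exact: bth|exact: bmeas_cst].
  apply/funext => w; rewrite qhatE; apply: eq_bigr => i _.
  by congr (_ * _); case: i.
have bW (l l' : 'I_N) : bmeas setT (W l l').
  by apply: bmeas_sum => i; apply: bmeasM; apply: bmeasM.
have pw w : err (theta t.+1 w) <= err (theta t w) +
    2 * g * (N%:R^-1 * \sum_(l < N) Q l w) +
    g ^+ 2 * (N%:R^-1 ^+ 2 * \sum_(l < N) \sum_(l' < N) W l l' w).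
  rewrite (err_split l1star (@theta_supported t.+1 w)).
  rewrite (err_split l1star (@theta_supportedS t w)).
  have := projection_step (run t w) (ths_l1norm l1star (J t.+1)).
  rewrite -/L -/N -/g => h.
  rewrite [in leRHS]addrAC -[leRHS]addrA; apply: le_trans (lerD h (lexx _)) _.
  rewrite le_eqVlt; apply/orP; left; apply/eqP.
  by rewrite /Q /W /rr /PS; ring.
have bQs : bmeas setT (fun w => 2 * g * (N%:R^-1 * \sum_(l < N) Q l w)).
  by do 2 apply: bmeasZ; apply: bmeas_sum => l.
have bWs : bmeas setT (fun w =>
    g ^+ 2 * (N%:R^-1 ^+ 2 * \sum_(l < N) \sum_(l' < N) W l l' w)).
  by do 2 apply: bmeasZ; apply: bmeas_sum => l; apply: bmeas_sum => l'.
have b12 := bmeasD (err_b t) bQs.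
apply: le_trans (le_bint measurableT PT (err_b t.+1) (bmeasD b12 bWs) (fun w _ => pw w)) _.
rewrite (bintD measurableT PT b12 bWs) (bintD measurableT PT (err_b t) bQs).
have bQs' : bmeas setT (fun w => \sum_(l < N) Q l w) by apply: bmeas_sum => l.
have bW' (l : 'I_N) : bmeas setT (fun w => \sum_(l' < N) W l l' w).
  by apply: bmeas_sum => l'.
have bWs' : bmeas setT (fun w => \sum_(l < N) \sum_(l' < N) W l l' w).
  by apply: bmeas_sum => l; exact: bW'.
apply: lerD; first apply: lerD => //.
- rewrite (bintZ measurableT PT _ (bmeasZ _ bQs')) (bintZ measurableT PT _ bQs').
  rewrite (bint_sum measurableT PT _ _ bQ) ler_wpM2l ?mulr_ge0//.
  rewrite ler_pdivrMl//; set D := _ + _.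
  apply: (@le_trans _ _ (\sum_(l < N) D)).
    by apply: ler_sum => l _; exact: step_drift.
  by rewrite sumr_const card_ord mulr_natl.
- rewrite (bintZ measurableT PT _ (bmeasZ _ bWs')) (bintZ measurableT PT _ bWs').
  rewrite ler_wpM2l ?sqr_ge0//.
  rewrite (bint_sum measurableT PT _ _ bW').
  under eq_bigr do rewrite (bint_sum measurableT PT _ _ (bW _)).
  set K2 := c2 ^+ 2 * C2 ^+ 2 * mean_err t.
  have K20 : 0 <= K2 by rewrite mulr_ge0 ?mean_err_ge0// mulr_ge0 ?sqr_ge0.
  (* Each row has one diagonal entry; nonnegativity of [K2] lets the other [N - 1] entries be
     counted as [N]. *)
  have row (l : 'I_N) : \sum_(l' < N) \int[P]_w W l l' w <= Wd + N%:R * K2.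
    rewrite (bigD1 l)//=; apply: lerD.
      by apply: prob_int_le => // w; exact: step_diag.
    apply: (@le_trans _ _ (\sum_(l' < N) K2)); last first.
      by rewrite sumr_const card_ord mulr_natl.
    rewrite [leRHS](bigD1 l)//= -[leLHS]add0r; apply: lerD => //.
    by apply: ler_sum => l' ll'; apply: step_cross => //; rewrite eq_sym.
  apply: (@le_trans _ _ (N%:R^-1 ^+ 2 * (N%:R * (Wd + N%:R * K2)))).
    rewrite ler_wpM2l ?sqr_ge0//; apply: (@le_trans _ _ (\sum_(l < N) (Wd + N%:R * K2))).
      by apply: ler_sum => l _; exact: row.
    by rewrite sumr_const card_ord [leRHS]mulr_natl.
  rewrite le_eqVlt; apply/orP; left; apply/eqP.
  by field; rewrite gt_eqF.
Qed.

End one_step.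
End expectation_step.

(** * Polynomial rates and the scalar recursion *)

Section rates.
Variable R : realType.

Lemma cumsizeS n t : cumsize n t.+1 = (cumsize n t + n t.+1)%N.
Proof. by rewrite /cumsize big_nat_recr. Qed.

Lemma cumsize_gt0 n t : (forall t, (0 < t)%N -> (0 < n t)%N) -> (0 < t)%N ->
  (0 < cumsize n t)%N.
Proof. by case: t => // t n0 _; rewrite cumsizeS addn_gt0 n0// orbT. Qed.

(** Used with [N * (1 - r)] as the previous cumulative size. Since [b <= 1], [(1 - r) ^ b] is at
    least [1 - r], and [1 / (1 - r) <= 1 + 2 * r] for [r <= 1 / 2]. *)
Lemma powR_shrink (N r b : R) : 0 < N -> 0 <= r <= 1 / 2 -> b <= 1 ->
  (N * (1 - r)) `^ (- b) <= N `^ (- b) * (1 + 2 * r).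
Proof.
move=> N0 /andP[r0 r1] b1; have x0 : 0 < 1 - r by lra.
rewrite powRM ?(ltW N0) ?(ltW x0)// ler_wpM2l ?powR_ge0// powRN.
have xb : 1 - r <= (1 - r) `^ b by apply: ger1_powR => //; apply/andP; split; lra.
apply: (@le_trans _ _ (1 - r)^-1).
  by rewrite lef_pV2 ?posrE// powR_gt0.
by rewrite -[leLHS]mul1r ler_pdivrMr//; nra.
Qed.

(** The condition [3 <= a] gives [(1 - a * r) * (1 + 2 * r) <= 1 - r]. The margin [r * C] then
    covers the noise [K * r] because [K <= C]. *)
Lemma recursion_bound (e : nat -> R) (n : nat -> nat) (a K b : R) :
  0 <= b <= 1 -> 3 <= a -> 0 <= K -> (forall t, 0 <= e t) ->
  (forall t, (0 < t)%N -> (0 < n t)%N) ->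
  (fun t => (n t)%:R / (cumsize n t)%:R : R) @ \oo --> (0 : R) ->
  (exists T0, forall t, (T0 <= t)%N -> e t.+1 <=
     (1 - a * ((n t.+1)%:R / (cumsize n t.+1)%:R)) * e t +
     K * ((n t.+1)%:R / (cumsize n t.+1)%:R) * (cumsize n t.+1)%:R `^ (- b)) ->
  exists C, exists T, forall t, (T <= t)%N -> e t <= C * (cumsize n t)%:R `^ (- b).
Proof.
move=> /andP[b0 b1] a3 K0 e0 n0 rho0 [T0 step].
have a0 : 0 < a by lra.
have a0' : 0 < a^-1 by rewrite invr_gt0.
(* The bound [1 / 2] is for [powR_shrink]; the bound [a^-1] keeps the factor [1 - a * r]
   nonnegative. *)
have [T1 rhoT] : exists T1, forall t, (T1 <= t)%N -> (n t)%:R / (cumsize n t)%:R <= Num.min (1 / 2) a^-1 :> R.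
  have m0 : 0 < Num.min (1 / 2) a^-1 by rewrite lt_min a0' andbT; lra.
  move/cvgrPdist_le: rho0 => /(_ _ m0)[T1 _ h]; exists T1 => t T1t.
  have := h t T1t; rewrite sub0r normrN; apply: le_trans; exact: ler_norm.
(* The successor makes [T] positive; the cumulative size at time 0 vanishes. *)
pose T := (maxn T0 T1).+1.
have NT t : (T <= t)%N -> 0 < (cumsize n t)%:R :> R.
  by move=> Tt; rewrite ltr0n cumsize_gt0//; exact: leq_trans Tt.
(* The second entry settles the base case at [T], the first the inductive step. *)
pose C := Num.max K (e T * (cumsize n T)%:R `^ b).
have CK : K <= C by rewrite le_max lexx.
exists C, T; elim=> [//|t ih] Tt.
have [tT|tT] := leqP T t; last first.
  have -> : t.+1 = T by apply/eqP; rewrite eqn_leq tT Tt.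
  rewrite powRN; apply: (@le_trans _ _ (e T * (cumsize n T)%:R `^ b / (cumsize n T)%:R `^ b)).
    by rewrite mulfK// gt_eqF// powR_gt0// NT.
  by rewrite ler_wpM2r ?invr_ge0 ?powR_ge0// le_max lexx orbT.
have iht := ih tT.
have Nt1 := NT _ Tt; set N1 := (cumsize n t.+1)%:R in Nt1 *.
set r := (n t.+1)%:R / N1 : R.
have tT0 : (T0 <= t)%N by apply: leq_trans tT; rewrite leqW// leq_maxl.
have tT1 : (T1 <= t.+1)%N by apply: leq_trans Tt; rewrite leqW// leq_maxr.
have := rhoT _ tT1; rewrite -/N1 -/r le_min => /andP[r1 r2].
have r0 : 0 <= r by rewrite divr_ge0.
have NE : (cumsize n t)%:R = N1 * (1 - r).
  by rewrite mulrBr mulr1 /r mulrC divfK ?gt_eqF// /N1 cumsizeS natrD addrK.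
have ar1 : a * r <= 1 by rewrite -(mulfV (lt0r_neq0 a0)) ler_pM2l.
have p0 : 0 <= N1 `^ (- b) by exact: powR_ge0.
have := step t tT0; rewrite -/N1 -/r => st; apply: le_trans st _.
have h1 : e t <= C * (N1 `^ (- b) * (1 + 2 * r)).
  apply: le_trans iht _; rewrite ler_wpM2l ?(le_trans K0 CK)// NE.
  by apply: powR_shrink => //; apply/andP.
have h2 : (1 - a * r) * e t <= (1 - a * r) * (C * (N1 `^ (- b) * (1 + 2 * r))).
  by rewrite ler_wpM2l// subr_ge0.
apply: le_trans (lerD h2 (lexx _)) _.
set D := N1 `^ (- b) in p0 *.
have -> : (1 - a * r) * (C * (D * (1 + 2 * r))) + K * r * D =
  ((1 - a * r) * (1 + 2 * r) * C + K * r) * D by ring.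
rewrite ler_wpM2r//.
have C0 := le_trans K0 CK.
have q1 : (1 - a * r) * (1 + 2 * r) <= 1 - r.
  have : 3 * r <= a * r by rewrite ler_wpM2r.
  have := mulr_ge0 (mulr_ge0 (ltW a0) r0) r0.
  lra.
have := ler_wpM2r C0 q1; have := ler_wpM2r r0 CK; lra.
Qed.

Variable s : R.
Hypothesis s0 : 1 / 2 < s.
Let s1 : 0 < 2 * s + 1. Proof. by move: s0; lra. Qed.
Notation b := (2 * s / (2 * s + 1)).

Lemma rate_le1 : 0 <= b <= 1.
Proof.
apply/andP; split; first by rewrite divr_ge0 ?(ltW s1)//; move: s0; lra.
by rewrite ler_pdivrMr//; lra.
Qed.

Let y N := (N%:R : R) `^ (1 / (2 * s + 1)).

Let y1 N : (0 < N)%N -> 1 <= y N.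
Proof.
move=> N0; apply: (@le_trans _ _ ((1 : R) `^ (1 / (2 * s + 1)))).
  by rewrite powR1.
by rewrite /y ge0_ler_powR ?nnegrE ?ler1n// divr_ge0// ltW.
Qed.

Lemma trunc_dimE N : ((trunc_dim s N)%:R : R) = (Num.ceil (y N))%:~R.
Proof.
rewrite /trunc_dim natr_absz ger0_norm// ceil_ge0.
by apply: lt_le_trans (powR_ge0 _ _); rewrite ltrN10.
Qed.

Lemma trunc_dim_ge N : y N <= (trunc_dim s N)%:R.
Proof. by rewrite trunc_dimE; exact: ceil_ge. Qed.

Lemma trunc_dim_le N : (0 < N)%N -> (trunc_dim s N)%:R <= 2 * y N.
Proof.
move=> /y1 h; rewrite trunc_dimE; have /andP[+ _] := ceil_itv (y N).
rewrite intrD => h2; lra.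
Qed.

Lemma trunc_dim_mono N N' : (N <= N')%N -> (trunc_dim s N <= trunc_dim s N')%N.
Proof.
move=> NN; rewrite -(ler_nat R) !trunc_dimE ler_int; apply: le_ceil.
by rewrite /y ge0_ler_powR ?nnegrE ?ler_nat ?ler0n// divr_ge0// ltW.
Qed.

Lemma inv_rate N : (0 < N)%N -> N%:R^-1 <= (N%:R : R) `^ (- b).
Proof.
move=> N0; have NR : 0 < N%:R :> R by rewrite ltr0n.
rewrite powRN lef_pV2 ?posrE ?powR_gt0//.
rewrite -[leRHS]powRr1 ?ler0n// ler_powR ?ler1n//.
by case/andP: rate_le1.
Qed.

(** The variance side of the choice of dimension: [1 / (2 * s + 1) - 1 = - b], the factor 2 coming
    from rounding up a number that is at least 1. *)
Lemma dim_rate N : (0 < N)%N ->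
  (trunc_dim s N)%:R * N%:R^-1 <= 2 * (N%:R : R) `^ (- b).
Proof.
move=> N0; have NR : 0 < N%:R :> R by rewrite ltr0n.
apply: (@le_trans _ _ (2 * y N * N%:R^-1)).
  by rewrite ler_wpM2r ?invr_ge0//; exact: trunc_dim_le.
rewrite -mulrA ler_wpM2l// /y -(powR_inv1 (ltW NR)) -powRD; last first.
  by apply/implyP => _; rewrite gt_eqF.
by rewrite (_ : 1 / (2 * s + 1) - 1 = - b)//; field; rewrite gt_eqF.
Qed.

(** The bias side. For [j >= J] the Sobolev weight [j.+1 ^ (2 * s)] is at least [N ^ b], so
    inserting [N ^ (- b)] times this weight only increases the tail, which then falls under the
    ellipsoid bound. *)
Lemma tail_rate (p : nat) (theta_star : 'I_p -> nat -> R) (Rad alpha Q : R) N :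
  (forall n, `|alpha| + \sum_(k < p) \sum_(j < n) `|theta_star k j| <= Rad) ->
  (forall k n, \sum_(j < n) (j.+1)%:R `^ (2 * s) * theta_star k j ^+ 2 <= Q ^+ 2) ->
  (0 < N)%N ->
  tail theta_star (trunc_dim s N) <= p%:R * Q ^+ 2 * (N%:R : R) `^ (- b).
Proof.
move=> l1 sob N0; have NR : 0 < N%:R :> R by rewrite ltr0n.
set J := trunc_dim s N.
have two_s : 0 <= 2 * s by move: s0; lra.
have key j : (J <= j)%N -> 1 <= N%:R `^ (- b) * (j.+1)%:R `^ (2 * s) :> R.
  move=> Jj; rewrite powRN mulrC ler_pdivlMr ?powR_gt0// mul1r.
  have -> : (N%:R : R) `^ b = y N `^ (2 * s).
    rewrite /y -powRrM; congr (_ `^ _); ring.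
  apply: ge0_ler_powR => //; rewrite ?nnegrE ?powR_ge0 ?ler0n//.
  apply: le_trans (trunc_dim_ge N) _.
  by rewrite ler_nat (leq_trans Jj).
apply: (@le_trans _ _ (\sum_(k < p) Q ^+ 2 * N%:R `^ (- b))); last first.
  by rewrite sumr_const card_ord -[_ *+ p]mulr_natl mulrA.
apply: ler_sum => k _; apply: (sqsum_le (tailc_l1bound l1 J k)) => n.
rewrite mulrC; apply: le_trans (ler_wpM2l (powR_ge0 _ _) (sob k n)).
rewrite mulr_sumr; apply: ler_sum => j _; rewrite /tailc.
case: ltnP => Jj; first by rewrite expr0n mulr_ge0 ?powR_ge0// mulr_ge0 ?powR_ge0 ?sqr_ge0.
by rewrite mulrA -[leLHS]mul1r ler_wpM2r ?sqr_ge0// key.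
Qed.

End rates.

(** The drift removes [c1 * C1 * A * (n / N) * e]. The hypothesis on [A * K2 * (n / N)] lets the
    squared mean gradient take back at most half of it; the tail and the diagonal terms form the
    noise constant. *)
Lemma step_to_rate (R : realType) (e e' A N n tl L p M D c1 c2 C1 C2 Q K2 : R) :
  0 <= e -> 0 < A -> 0 < N -> 0 < n -> 0 <= c2 -> 0 <= C2 -> 0 <= p -> 0 <= D ->
  e' <= e + 2 * (A * n / N) * (- (c1 / 2) * (C1 * e) + (c2 / 2) * (C2 * tl)) +
    (A * n / N) ^+ 2 * (n^-1 * (1 + p * L * M ^+ 2) + K2 * e) ->
  tl <= p * Q ^+ 2 * D -> N^-1 <= D -> L * N^-1 <= 2 * D ->
  A * K2 * (n / N) <= c1 * C1 / 2 ->
  e' <= (1 - c1 * C1 / 2 * A * (n / N)) * e +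
    (A * c2 * C2 * p * Q ^+ 2 + A ^+ 2 * (1 + 2 * p * M ^+ 2)) * (n / N) * D.
Proof.
move=> e0 A0 N0 n0 c20 C20 p0 D0 st tD ND LD small.
rewrite -[A * n / N]mulrA in st; set r := n / N in st small *.
have r0 : 0 <= r by rewrite divr_ge0// ltW.
(* Averaging over the batch makes the quadratic noise [(A * r) ^+ 2 / n] linear in [r], namely
   [A ^+ 2 * r / N]. *)
have rn : r * n^-1 = N^-1 by rewrite /r mulrAC mulfV ?gt_eqF// mul1r.
have h1 : r * (A * c2 * C2) * tl <= r * (A * c2 * C2) * (p * Q ^+ 2 * D).
  exact: (ler_wpM2l (mulr_ge0 r0 (mulr_ge0 (mulr_ge0 (ltW A0) c20) C20)) tD).
have h2 : A ^+ 2 * r * (N^-1 + p * M ^+ 2 * (L * N^-1)) <=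
    A ^+ 2 * r * (D + p * M ^+ 2 * (2 * D)).
  apply: ler_wpM2l; first by rewrite mulr_ge0 ?sqr_ge0.
  apply: lerD => //; apply: ler_wpM2l => //; by rewrite mulr_ge0 ?sqr_ge0.
have h3 : A * r * e * (A * K2 * r) <= A * r * e * (c1 * C1 / 2).
  exact: (ler_wpM2l (mulr_ge0 (mulr_ge0 (ltW A0) r0) e0) small).
have h4 : (A * r) ^+ 2 * (n^-1 * (1 + p * L * M ^+ 2)) =
    A ^+ 2 * r * (N^-1 + p * M ^+ 2 * (L * N^-1)).
  by rewrite -rn; ring.
apply: le_trans st _; rewrite [(A * r) ^+ 2 * (_ + _)]mulrDr h4; lra.
Qed.

(** * Removing the null event, and the final rate *)

Section theorem.
Variables (R : realType) (p : nat) (psi : 'I_p -> nat -> R -> R).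
Variables (M Rad alpha tau s Q A C1 C2 c1 c2 : R).
Variables (theta_star : 'I_p -> nat -> R) (pYX : ('I_p -> R) -> R -> R).
Notation leb := (@lebesgue_measure R).
Hypothesis onb : centered_onb_bounded psi M.
Hypothesis M1 : 1 <= M.
Hypothesis s0 : 1 / 2 < s.
Hypothesis l1star : forall n, `|alpha| + \sum_(k < p) \sum_(j < n) `|theta_star k j| <= Rad.
Hypothesis sob : forall k n,
  \sum_(j < n) (j.+1)%:R `^ (2 * s) * theta_star k j ^+ 2 <= Q ^+ 2.
Hypothesis qE : forall x, in_cube x -> cond_quantile pYX tau x =
  alpha + \sum_(k < p) limn (series (fun j => theta_star k j * psi k j (x k))).
Variables (d : measure_display) (Omega : measurableType d).
Variable P : probability Omega R.
Variables (n : nat -> nat) (X : nat -> nat -> 'I_p -> Omega -> R).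
Variables (Y : nat -> nat -> Omega -> R) (pX : ('I_p -> R) -> R).
Variable theta : nat -> Omega -> coef R p.
Hypothesis tau01 : 0 < tau < 1.
Hypothesis C10 : 0 < C1.
Hypothesis c10 : 0 < c1.
Hypothesis pXb : forall x, in_cube x -> C1 <= pX x <= C2.
Hypothesis dens : forall x, in_cube x ->
  [/\ measurable_fun setT (pYX x), (forall y, 0 <= pYX x y)
    & (\int[leb]_(y in setT) (pYX x y)%:E = 1)%E].
Hypothesis densb : forall x y, in_cube x -> - (M * Rad) <= y <= M * Rad ->
  c1 <= pYX x y <= c2.
Hypothesis iid : iid_sample P n X Y pX pYX.
Hypothesis n0 : forall t, (0 < t)%N -> (0 < n t)%N.
Hypothesis rho0 : (fun t => (n t)%:R / (cumsize n t)%:R : R) @ \oo --> (0 : R).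
Hypothesis run : forall w, pfgd_run psi tau Rad A s n (fun t i k => X t i k w)
  (fun t i => Y t i w) (fun t => theta t w).
Hypothesis A0 : 6 / (c1 * C1) <= A.

Let B0 : 0 <= M * Rad.
Proof. by rewrite mulr_ge0 ?(Rad0 l1star)//; exact: le_trans M1. Qed.
Let c20 : 0 < c2 := lt_le_trans c10 (c12 densb B0).
Let C20 : 0 < C2 := lt_le_trans C10 (C12 pXb).
Let Agt0 : 0 < A.
Proof. by apply: lt_le_trans A0; rewrite divr_gt0// mulr_gt0. Qed.

Let Jt t := trunc_dim s (cumsize n t).
Let gam t := A * (n t)%:R / (cumsize n t)%:R.

Let Jmono t : (Jt t <= Jt t.+1)%N.
Proof. by apply: trunc_dim_mono => //; rewrite cumsizeS leq_addr. Qed.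

Let theta0 w : theta 0 w = (0, fun _ _ => 0).
Proof. by case: (run w). Qed.

Let runS t w : is_l1ball_proj (Jt t.+1) Rad
  (pfgd_tilde psi tau (Jt t.+1) (n t.+1) (gam t.+1) (fun i k => X t.+1 i k w)
     (fun i => Y t.+1 i w) (theta t w)) (theta t.+1 w).
Proof. by have [_ h] := run w; exact: (h t.+1). Qed.

Let mX t i k : measurable_fun setT (X t i k). Proof. by case: iid. Qed.
Let mY t i : measurable_fun setT (Y t i). Proof. by case: iid. Qed.

Let law ti : validx n ti -> forall (A : 'I_p -> set R) (B : set R),
  (forall k, measurable (A k)) -> measurable B ->
  P (rect_event (X ti.1 ti.2) (Y ti.1 ti.2) A B) =
  cube_int (fun x => ((\prod_(k < p) \1_(A k) (x k)) * pX x)%:E *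
                      \int[leb]_(y in B) (pYX x y)%:E)%E.
Proof. by case: ti => t i v; case: iid => _ _ h _; exact: (h t i v). Qed.

Let indep S : uniq S -> all (validx n) S -> forall A B,
  (forall ti k, measurable (A ti k)) -> (forall ti, measurable (B ti)) ->
  P (rect_cap X Y S A B)
  = (\prod_(ti <- S) P (rect_event (X ti.1 ti.2) (Y ti.1 ti.2) (A ti) (B ti)))%E.
Proof. by case: iid => _ _ _; exact. Qed.

Let I01 : set R := [set` `[0%R : R, 1%R]].
Let inC t i : set Omega := rect_event (X t i) (Y t i) (fun=> I01) setT.
(** The law is specified for valid indices only, so an invalid sample never counts as bad. *)
Let bad t i : set Omega := if validx n (t, i) then ~` inC t i else set0.
Let Good : set Omega := ~` (\bigcup_t \bigcup_i bad t i).

Let minC t i : measurable (inC t i).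
Proof. by apply: measurable_rect => // k; exact: measurable_itv. Qed.

Let mbad t i : measurable (bad t i).
Proof. by rewrite /bad; case: ifP => // _; exact: measurableC. Qed.

Let mGood : measurable Good.
Proof.
by apply: measurableC; apply: bigcupT_measurable => t; exact: bigcupT_measurable.
Qed.

(** [cube_int] evaluates its integrand at points of the cube only, so the law assigns this event and
    the whole space the same value. *)
Let PinC t i : validx n (t, i) -> P (inC t i) = 1%E.
Proof.
move=> v; rewrite -(probability_setT P).
have -> : [set: Omega] = rect_event (X t i) (Y t i) (fun=> setT) setT.
  by apply/seteqP; split.
have mI (k : 'I_p) : measurable (I01 : set R) by exact: measurable_itv.
rewrite (law v mI measurableT) (law v (fun=> measurableT) measurableT).
apply: eq_cube_int => x xc; congr (_ * _)%E; congr (_ * _)%:E.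
apply: eq_bigr => k _; rewrite !indicE in_setT mem_set//=.
by rewrite /I01 /= in_itv/=; exact: xc.
Qed.

Let PGood : P (~` Good) = 0%E.
Proof.
rewrite /Good setCK; apply: measure_negligible.
  by apply: bigcupT_measurable => t; exact: bigcupT_measurable.
apply: negligible_bigcup => t; apply: negligible_bigcup => i.
apply/negligibleP; first exact: mbad.
rewrite /bad; case: ifP => [v|_]; last exact: measure0.
transitivity (1 - P (inC t i))%E; first exact: (probability_setC P (minC t i)).
by rewrite PinC// subee.
Qed.

Let exGood : exists w, Good w.
Proof.
apply: contrapT => h; have := PGood.
have -> : ~` Good = setT by apply/seteqP; split => // w _ gw; apply: h; exists w.
by rewrite (probability_setT P) => -[] /eqP; rewrite oner_eq0.
Qed.

(* Redirecting the null set of samples leaving the cube to a regular outcome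
   makes every covariate lie in the cube without changing any law. *)
Let w0 : Omega := sval (cid exGood).
Let w0P : Good w0 := svalP (cid exGood).
Let pi w := if w \in Good then w else w0.

Let piGood w : Good (pi w).
Proof. by rewrite /pi; case: ifPn => [|_]; [rewrite inE|exact: w0P]. Qed.

Let piE w : Good w -> pi w = w.
Proof. by move=> gw; rewrite /pi mem_set. Qed.

Let mpi : measurable_fun setT pi.
Proof.
move=> _ B mB; rewrite setTI.
have -> : pi @^-1` B = (Good `&` B) `|` (~` Good `&` [set w | B w0]).
  apply/seteqP; split => w; rewrite /preimage/= /pi.
    case: ifPn => [|]; first by rewrite inE; left.
    by rewrite notin_setE; right.
  case=> -[gw Bw]; first by rewrite mem_set.
  by rewrite memNset.
apply: measurableU; first exact: measurableI.
apply: measurableI; first exact: measurableC.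
have [b|nb] := pselect (B w0).
  by rewrite (_ : [set w | B w0] = setT)//; apply/seteqP; split.
by rewrite (_ : [set w | B w0] = set0)//; apply/seteqP; split.
Qed.

Let PpiI (B : set Omega) : measurable B -> P B = P (B `&` Good).
Proof.
move=> mB; have E : P B = (P (B `\` Good) + P (B `&` Good))%E.
  exact: (measureDI P mB mGood).
have mD : measurable (B `\` Good) by exact: measurableD.
have mC : measurable (~` Good) by exact: measurableC.
have Z : P (B `\` Good) = 0%E.
  apply/eqP; rewrite eq_le measure_ge0 andbT -PGood.
  by apply: le_measure; rewrite ?inE// => w [].
by rewrite E Z add0e.
Qed.

Let Ppi (B : set Omega) : measurable B -> P (pi @^-1` B) = P B.
Proof.
move=> mB; have mpB : measurable (pi @^-1` B) by rewrite -[X in measurable X]setTI; exact: mpi.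
rewrite (PpiI mB) (PpiI mpB); congr (P _).
by apply/seteqP; split => w [Bw gw]; split => //; move: Bw; rewrite /preimage/= piE.
Qed.

Let X' t i k w := X t i k (pi w).
Let Y' t i w := Y t i (pi w).
Let theta' t w := theta t (pi w).

Let mX' t i k : measurable_fun setT (X' t i k).
Proof. exact: (measurableT_comp (mX t i k) mpi). Qed.
Let mY' t i : measurable_fun setT (Y' t i).
Proof. exact: (measurableT_comp (mY t i) mpi). Qed.

Let X01' ti : validx n ti -> forall k w, 0 <= X' ti.1 ti.2 k w <= 1.
Proof.
case: ti => t i v k w /=.
have : inC t i (pi w).
  have gw : ~ (\bigcup_t \bigcup_i bad t i) (pi w) := @piGood w.
  apply: contrapT => h; apply: gw; exists t => //; exists i => //.
  by rewrite /bad v.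
by move=> [/(_ k)]; rewrite /I01 /= in_itv.
Qed.

Let rect' ti D B : rect_event (X' ti.1 ti.2) (Y' ti.1 ti.2) D B =
  pi @^-1` rect_event (X ti.1 ti.2) (Y ti.1 ti.2) D B.
Proof. by []. Qed.

Let law' ti : validx n ti -> forall (A : 'I_p -> set R) (B : set R),
  (forall k, measurable (A k)) -> measurable B ->
  P (rect_event (X' ti.1 ti.2) (Y' ti.1 ti.2) A B) =
  cube_int (fun x => ((\prod_(k < p) \1_(A k) (x k)) * pX x)%:E *
                      \int[leb]_(y in B) (pYX x y)%:E)%E.
Proof.
move=> v A' B mA mB; rewrite rect' Ppi ?law//; exact: measurable_rect.
Qed.

Let indep' S : uniq S -> all (validx n) S -> forall A B,
  (forall ti k, measurable (A ti k)) -> (forall ti, measurable (B ti)) ->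
  P (rect_cap X' Y' S A B)
  = (\prod_(ti <- S) P (rect_event (X' ti.1 ti.2) (Y' ti.1 ti.2) (A ti) (B ti)))%E.
Proof.
move=> uS vS A' B mA mB.
have -> : rect_cap X' Y' S A' B = pi @^-1` rect_cap X Y S A' B by [].
rewrite Ppi ?indep//; last first.
  apply: fin_bigcap_measurable; first exact: finite_seq.
  by move=> ti _; exact: measurable_rect.
apply: eq_bigr => ti _; rewrite rect' Ppi//; exact: measurable_rect.
Qed.

Let theta0' w : theta' 0 w = (0, fun _ _ => 0). Proof. exact: theta0. Qed.

Let run' t w : is_l1ball_proj (Jt t.+1) Rad
  (pfgd_tilde psi tau (Jt t.+1) (n t.+1) (gam t.+1) (fun i k => X' t.+1 i k w)
     (fun i => Y' t.+1 i w) (theta' t w)) (theta' t.+1 w).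
Proof. exact: runS. Qed.

Let e t := mean_err alpha theta_star P theta' t.

Let e_step t := mean_err_step onb M1 l1star qE mX' mY' X01' law' indep' tau01
  C10 c10 pXb dens densb Jmono theta0' run' (t := t).

Let e_ge0 t : 0 <= e t.
Proof. exact: (mean_err_ge0 onb l1star P mX' mY' X01' Jmono theta0' run'). Qed.

Lemma mean_err_rate : exists C, exists T, forall t, (T <= t)%N ->
  e t <= C * (cumsize n t)%:R `^ (- (2 * s / (2 * s + 1))).
Proof.
pose K := A * c2 * C2 * p%:R * Q ^+ 2 + A ^+ 2 * (1 + 2 * p%:R * M ^+ 2).
have K0 : 0 <= K := addr_ge0 (mulr_ge0 (mulr_ge0 (mulr_ge0 (mulr_ge0 (ltW Agt0)
  (ltW c20)) (ltW C20)) (ler0n _ p)) (sqr_ge0 Q)) (mulr_ge0 (sqr_ge0 A)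
  (addr_ge0 ler01 (mulr_ge0 (mulr_ge0 (ler0n _ 2) (ler0n _ p)) (sqr_ge0 M)))).
apply: (@recursion_bound R e n (c1 * C1 / 2 * A) K) => //.
- exact: rate_le1.
(* The origin of the 6 in the threshold for [A]: the contraction constant [c1 * C1 / 2 * A] must
   reach 3. *)
- have := A0; rewrite ler_pdivrMr ?mulr_gt0//; lra.
pose K2 := c2 ^+ 2 * C2 ^+ 2.
have K20 : 0 < K2 by rewrite mulr_gt0 ?exprn_gt0.
(* Once [n_t / N_t <= m], the squared mean gradient is at most half of the drift. *)
pose m := c1 * C1 / 2 / (A * K2).
have m0 : 0 < m by rewrite divr_gt0 ?mulr_gt0// divr_gt0// mulr_gt0.
move/cvgrPdist_le: rho0 => /(_ _ m0)[T0 _ h]; exists T0 => t T0t.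
have := h t.+1 (leqW T0t); rewrite sub0r normrN => h'.
have rm := le_trans (ler_norm _) h'.
have N0 : (0 < cumsize n t.+1)%N by exact: cumsize_gt0.
have nt0 : (0 < n t.+1)%N by exact: n0.
have g0 : 0 <= gam t.+1 by rewrite divr_ge0 ?mulr_ge0 ?(ltW Agt0) ?ler0n.
apply: (@step_to_rate _ _ _ _ _ _ (tail theta_star (Jt t.+1)) (Jt t.+1)%:R _ _ _ _ _ _ _ _ K2)
  => //; rewrite ?ltr0n ?(ltW c20) ?(ltW C20) ?powR_ge0//.
- exact: (e_step nt0 g0).
- exact: (tail_rate s0 l1star sob N0).
- exact: (inv_rate s0 N0).
- exact: (dim_rate s0 N0).
- by move: rm; rewrite ler_pdivlMr ?mulr_gt0// mulrC.
Qed.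

(** A crude bound valid at every outcome, including those where a sample leaves the cube; it serves
    only on that null event. *)
Let err_le t w : err alpha theta_star (theta t w) <=
  \sum_(i : idx p (Jt t)) (2 * Rad) ^+ 2 + tail theta_star (Jt t).
Proof.
have sT : supported (Jt t) (theta t w) := theta_supported theta0 runS w.
have lT : l1norm (Jt t) (theta t w) <= Rad := theta_l1norm l1star theta0 runS t w.
rewrite (err_split l1star sT) lerD2r; apply: ler_sum => i _.
rewrite -real_normK ?num_real// lerXn2r ?nnegrE// ?mulr_ge0 ?(Rad0 l1star)//.
apply: le_trans (ler_normB _ _) _; rewrite (_ : 2 * Rad = Rad + Rad); last by ring.
by apply: lerD; apply: cidx_le => //; exact: (ths_l1norm l1star).
Qed.

(** Off [Good] the original iterates are under no measurability control, as the basis is measurable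
    on [[0, 1]] only. Their error is dominated by the measurable error of the redirected run plus a
    constant on a null event, and monotonicity of the lower integral finishes. *)
Lemma int_err_le t : (\int[P]_w cube_int (fun x =>
  ((qhat psi (Jt t) (theta t w) x - cond_quantile pYX tau x) ^+ 2)%:E) <= (e t)%:E)%E.
Proof.
set K := \sum_(i : idx p (Jt t)) (2 * Rad) ^+ 2 + tail theta_star (Jt t).
have K0 : 0 <= K.
  rewrite addr_ge0 ?(tail_ge0 l1star)// sumr_ge0// => i _; exact: sqr_ge0.
have sT w : supported (Jt t) (theta t w) := theta_supported theta0 runS w.
have be : bmeas setT (fun w => err alpha theta_star (theta' t w)).
  exact: (bmeas_TS mX' mY' (err_bmeas onb l1star X01' Jmono theta0' run' t)).
have mC : measurable (~` Good) by exact: measurableC.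
have bi : bmeas setT (fun w => K * \1_(~` Good) w : R) by exact/bmeasZ/bmeas_indic.
under eq_integral => w _ do rewrite (cube_int_err onb l1star qE (sT w)).
have -> : e t = \int[P]_w (err alpha theta_star (theta' t w) + K * \1_(~` Good) w).
  rewrite (bintD measurableT (probT_fin P) be bi) int_indic1// /pr PGood/= mulr0 addr0.
  by [].
rewrite -(bintE measurableT (probT_fin P)); last exact: bmeasD.
apply: le_lower_integral => w _; rewrite lee_fin.
  exact: (err_ge0 l1star (sT w)).
have [gw|gw] := pselect (Good w).
  by rewrite /theta' piE// lerDl mulr_ge0// indicE.
rewrite indicE mem_set// mulr1; apply: le_trans (err_le t w) _.
by rewrite lerDr; exact: (err_ge0 l1star (sT (pi w))).
Qed.

End theorem.

Unset Implicit Arguments.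
Set Strict Implicit.
Set Printing Implicit Defensive.

Theorem theorem2 (R : realType) (p : nat) (tau s Q Rad M C1 C2 c1 c2 : R) :
  (0 < p)%N -> 0 < tau < 1 -> 1 / 2 < s -> 0 < Q -> 0 < Rad -> 1 <= M ->
  0 < C1 -> 0 < c1 -> 0 < c2 ->
  exists A0 : R, 0 < A0 /\
  forall A : R, A0 <= A ->
  forall (psi : 'I_p -> nat -> R -> R) (alpha : R) (theta_star : 'I_p -> nat -> R)
    (d : measure_display) (Omega : measurableType d) (P : probability Omega R)
    (n : nat -> nat)
    (X : nat -> nat -> 'I_p -> Omega -> R) (Y : nat -> nat -> Omega -> R)
    (pX : ('I_p -> R) -> R) (pYX : ('I_p -> R) -> R -> R)
    (theta : nat -> Omega -> coef R p),
  (* basis *)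
  centered_onb_bounded psi M ->
  (* model: Sobolev ellipsoid and l1 bound on the true coefficients *)
  (forall k : 'I_p,
     (\sum_(0 <= j <oo) (((j.+1)%:R `^ (2 * s)) * theta_star k j ^+ 2)%:E
        < (Q ^+ 2)%:E)%E) ->
  (`|alpha|%:E + \sum_(k < p) \sum_(0 <= j <oo) `|theta_star k j|%:E
     <= Rad%:E)%E ->
  (forall x, in_cube x ->
     cond_quantile pYX tau x =
     alpha + \sum_(k < p) limn (series (fun j => theta_star k j * psi k j (x k)))) ->
  (* (A1) *)
  (forall x, in_cube x -> C1 <= pX x <= C2) ->
  (* (A2) : Y | X = x has a density, bounded on [-B, B], B = M * Rad *)
  (forall x, in_cube x ->
     [/\ measurable_fun setT (pYX x), (forall y, 0 <= pYX x y)
       & (\int[lebesgue_measure]_(y in setT) (pYX x y)%:E = 1)%E]) ->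
  (forall x y, in_cube x -> - (M * Rad) <= y <= M * Rad ->
     c1 <= pYX x y <= c2) ->
  (* data: i.i.d. copies of (X, Y) *)
  iid_sample P n X Y pX pYX ->
  (* batch sizes *)
  (forall t, (0 < t)%N -> (0 < n t)%N) ->
  (fun t => (n t)%:R / (cumsize n t)%:R : R) @ \oo --> (0 : R) ->
  (* the P-FGD iterates (step gamma_t = A n_t / N_t, J_t = ceil N_t^(1/(2s+1))) *)
  (forall w, pfgd_run psi tau Rad A s n (fun t i k => X t i k w) (fun t i => Y t i w)
                      (fun t => theta t w)) ->
  (* conclusion: E || qhat_t - q_tau ||_{L2}^2 = O(N_t^{-2s/(2s+1)}) *)
  exists C : R, exists T : nat, forall t, (T <= t)%N ->
    (\int[P]_w cube_int (fun x =>
        ((qhat psi (trunc_dim s (cumsize n t)) (theta t w) x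
          - cond_quantile pYX tau x) ^+ 2)%:E)
     <= (C * (cumsize n t)%:R `^ (- (2 * s / (2 * s + 1))))%:E)%E.
Proof.
(* The threshold involves the lower density bounds alone, so it is fixed before the data and the
   basis are introduced. *)
move=> p0 tau01 s0 Q0 R0 M1 C10 c10 c20; exists (6 / (c1 * C1)).
split; first by rewrite divr_gt0 ?mulr_gt0.
move=> A A0 psi alpha theta_star d Omega P n X Y pX pYX theta onb sobE l1E qE pXb dens
  densb iid n0 rho run.
have l1 m : `|alpha| + \sum_(k < p) \sum_(j < m) `|theta_star k j| <= Rad.
  rewrite -lee_fin; apply: le_trans l1E; rewrite EFinD; apply: leeD2l.
  rewrite -sumEFin; apply: lee_sum => k _.
  rewrite -sumEFin -(big_mkord xpredT (fun j => `|theta_star k j|%:E)).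
  by apply: nneseries_lim_ge => j _ _; rewrite lee_fin.
have sob k m : \sum_(j < m) (j.+1)%:R `^ (2 * s) * theta_star k j ^+ 2 <= Q ^+ 2.
  rewrite -lee_fin; apply: le_trans (ltW (sobE k)).
  rewrite -sumEFin -(big_mkord xpredT
    (fun j => ((j.+1)%:R `^ (2 * s) * theta_star k j ^+ 2)%:E)).
  by apply: nneseries_lim_ge => j _ _; rewrite lee_fin mulr_ge0 ?powR_ge0 ?sqr_ge0.
have [C [T h]] := mean_err_rate onb M1 s0 l1 sob qE tau01 C10 c10 pXb dens densb
  iid n0 rho run A0.
exists C, T => t Tt; apply: le_trans (int_err_le onb s0 l1 qE iid run t) _.
by rewrite lee_fin; exact: h.
Qed.
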